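(* For any $\theta > 0$, $\sigma \in (0,1]$, $p \in (1,n/\sigma]$, $s \in (n-\sigma p,n]$, there is a constant $C > 0$ such that the following holds for any $R > 0$. Let $B_R$ be any ball in $\mathbb{R}^n$ with radius $R$, let $f \in W^{\sigma,p}(B_R)$, and assume that there is a closed set $T \subset B_R$ such that $$T \subset \Big\{x \in B_R : \ \limsup_{r \to 0} \frac{1}{|B_r(x)|}\int_{B_r(x)} |f| = 0 \Big\},$$ $$\mathcal{H}^s(T) > \frac{1}{\theta}\, R^s,$$ and, for every $r>0$ and every ball $B_r\subset\mathbb{R}^n$ with radius $r$, $$\mathcal{H}^s(T \cap B_r) \leq \theta\, r^s .$$ Then $$\|f\|_{L^p(B_R)} \leq C\, R^\sigma\, [f]_{\dot W^{\sigma,p}(B_R)}.$$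
   Context: $n\ge 1$ is the (fixed) dimension, $\mathcal{H}^s$ is the $s$-dimensional Hausdorff measure on $\mathbb{R}^n$, $B_r(x)$ is the ball of radius $r$ centered at $x$, and $|A|$ is the Lebesgue measure of $A$. For $\Omega\subset\mathbb{R}^n$ and $p\in[1,\infty)$: for $\sigma = 1$, $[f]_{\dot W^{1,p}(\Omega)} := \|\nabla f\|_{L^p(\Omega)}$ (weak gradient); for $\sigma\in(0,1)$, $$[f]_{\dot W^{\sigma,p}(\Omega)} := \left(\int_\Omega\int_\Omega \left(\frac{|f(x)-f(y)|}{|x-y|^\sigma}\right)^p \frac{dx\,dy}{|x-y|^n}\right)^{1/p}.$$ The space $W^{\sigma,p}(\Omega)$ consists of all functions $f:\Omega\to\mathbb{R}$ with finite norm $\|f\|_{W^{\sigma,p}(\Omega)} := \|f\|_{L^p(\Omega)} + [f]_{\dot W^{\sigma,p}(\Omega)}$. *)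

(* Defs.v *)
From HB Require Import structures.
From mathcomp Require Import all_boot all_order all_algebra.
From mathcomp Require Import all_classical all_reals all_analysis.
Import Order.TTheory GRing.Theory Num.Theory.
Import numFieldNormedType.Exports.

Set Implicit Arguments.
Unset Strict Implicit.
Unset Printing Implicit Defensive.

Local Open Scope classical_set_scope.
Local Open Scope ring_scope.

(* R^n is 'rV[R]_n.  Its library norm is the sup norm: this affects neither
   the topology nor directional derivatives, but distances, balls and
   diameters below are Euclidean. *)

(* The Borel sigma-algebra of R^n, generated by the coordinate maps. *)
Section measurable_rV.
Context {d} {T : measurableType d} (n : nat).

Let coords : 'I_n -> 'rV[T]_n -> T := fun i v => v ord0 i.

Let rV_set0 : g_sigma_preimage coords set0.
Proof. exact: sigma_algebra0. Qed.

Let rV_setC A : g_sigma_preimage coords A -> g_sigma_preimage coords (~` A).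
Proof. exact: sigma_algebraC. Qed.

Let rV_bigcup (F : (set 'rV[T]_n)^nat) :
  (forall i, g_sigma_preimage coords (F i)) ->
  g_sigma_preimage coords (\bigcup_i (F i)).
Proof. exact: sigma_algebra_bigcup. Qed.

HB.instance Definition _ := @isMeasurable.Build (measure_tuple_display d)
  'rV[T]_n (g_sigma_preimage coords) rV_set0 rV_setC rV_bigcup.

Lemma measurable_rV_coord (i : 'I_n) :
  measurable_fun [set: 'rV[T]_n] (fun v : 'rV[T]_n => v ord0 i).
Proof.
move=> _ Y mY; rewrite setTI; apply: sub_sigma_algebra => /=.
rewrite -bigcup_seq/=; exists i => /=; first by rewrite mem_index_enum.
by exists Y => //; rewrite setTI.
Qed.

Lemma measurable_fun_rV d1 (T1 : measurableType d1) (f : T1 -> 'rV[T]_n) :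
  (forall i, measurable_fun [set: T1] (fun x => f x ord0 i)) ->
  measurable_fun [set: T1] f.
Proof.
move=> mf _ A mA; rewrite setTI; move: A mA.
suff : g_sigma_preimage coords `<=` [set A | measurable (f @^-1` A)] by apply.
apply: smallest_sub.
  split=> [|A|F mF] /=.
  - by rewrite preimage_set0.
  - by rewrite setTD -preimage_setC; exact: measurableC.
  - by rewrite preimage_bigcup; exact: bigcupT_measurable.
rewrite -bigcup_seq/=; apply: bigcup_sub => i _ _ [B mB <-] /=.
by rewrite setTI -[X in measurable X]setTI; exact: mf.
Qed.

End measurable_rV.

Section lebesgue_measure_rV.
Context {R : realType}.
Implicit Type n : nat.

Definition cons_rV n (xv : R * 'rV[R]_n) : 'rV[R]_n.+1 :=
  row_mx (xv.1)%:M xv.2.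

Lemma cons_rV0 n xv : @cons_rV n xv ord0 ord0 = xv.1.
Proof.
rewrite (_ : @ord0 n = lshift n (ord0 : 'I_1)); last exact/val_inj.
apply: etrans; first exact: row_mxEl.
by rewrite mxE eqxx.
Qed.

Lemma cons_rVS n xv (i : 'I_n) : cons_rV xv ord0 (lift ord0 i) = xv.2 ord0 i.
Proof.
rewrite (_ : lift ord0 i = rshift 1 i); last exact/val_inj.
exact: row_mxEr.
Qed.

Lemma measurable_cons_rV n : measurable_fun [set: R * 'rV[R]_n] (@cons_rV n).
Proof.
apply: measurable_fun_rV => i.
have [->|[j ->]] : i = ord0 \/ exists j, i = lift ord0 j.
  by case: (unliftP ord0 i) => [j ->|->]; [right; exists j|left].
- by under eq_fun do rewrite cons_rV0; exact: measurable_fst.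
- under eq_fun do rewrite cons_rVS.
  by apply: (measurableT_comp (measurable_rV_coord j)); exact: measurable_snd.
Qed.

(* The product of Lebesgue measure on R with mu, carried to R^(n+1). *)
Definition lebesgue_step n (mu : {measure set 'rV[R]_n -> \bar R}) :
    set 'rV[R]_n.+1 -> \bar R :=
  pushforward (product_measure2 lebesgue_measure mu) (@cons_rV n).

Section step_is_measure.
Variables (n : nat) (mu : {measure set 'rV[R]_n -> \bar R}).
Let mcons := @measurable_cons_rV n.

Let step0 : lebesgue_step mu set0 = 0%E.
Proof. exact: measure0. Qed.

Let step_ge0 A : (0 <= lebesgue_step mu A)%E.
Proof. exact: measure_ge0. Qed.

Let step_sigma_additive : semi_sigma_additive (lebesgue_step mu).
Proof. exact: measure_semi_sigma_additive. Qed.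

HB.instance Definition _ := isMeasure.Build _ _ _ (lebesgue_step mu)
  step0 step_ge0 step_sigma_additive.

End step_is_measure.

Fixpoint lebesgue_rV n : {measure set 'rV[R]_n -> \bar R} :=
  if n is m.+1 then lebesgue_step (lebesgue_rV m) else \d_(0 : 'rV[R]_0).

Definition box n (A : 'I_n -> set R) : set 'rV[R]_n :=
  [set v | forall i, A i (v ord0 i)].

Lemma measurable_box n (A : 'I_n -> set R) :
  (forall i, measurable (A i)) -> measurable (box A).
Proof.
move=> mA; rewrite (_ : box A = \bigcap_i [set v | A i (v ord0 i)]); last first.
  by apply/seteqP; split=> v h i; [move=> _|]; exact: h.
apply: fin_bigcap_measurable => // i _.
rewrite -[X in measurable X]setTI.
exact: (@measurable_rV_coord _ _ n i measurableT (A i) (mA i)).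
Qed.

Lemma lebesgue_rV_box n (A : 'I_n -> set R) :
  (forall i, measurable (A i)) ->
  lebesgue_rV n (box A) = (\prod_(i < n) lebesgue_measure (A i))%E.
Proof.
elim: n A => [|n IH] A mA.
  by rewrite big_ord0 /= diracE mem_set// => -[].
rewrite big_ord_recl -(IH (fun i => A (lift ord0 i)))// -product_measure2E;
  [|exact: mA|exact: measurable_box].
rewrite /= /lebesgue_step /pushforward; congr (product_measure2 _ _ _).
apply/seteqP; split=> -[x v] /=.
- move=> b; split => [|i].
    by have := b ord0; rewrite cons_rV0.
  by have := b (lift ord0 i); rewrite cons_rVS.
- move=> [bx bv] i; case: (unliftP ord0 i) => [j ->|->].
    by rewrite cons_rVS; exact: bv.
  by rewrite cons_rV0.
Qed.

End lebesgue_measure_rV.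

Section euclidean.
Context {R : realType} {n : nat}.
Implicit Types (x y v : 'rV[R]_n) (A U Omega : set 'rV[R]_n).

Definition enorm v : R := Num.sqrt (\sum_(i < n) v ord0 i ^+ 2).

Definition eball x (r : R) : set 'rV[R]_n := [set y | enorm (y - x) < r].

(* -oo on the empty set *)
Definition ediam A : \bar R :=
  ereal_sup [set (enorm (x - y))%:E | x in A & y in A].

Local Open Scope ereal_scope.

(* diam(A)^s, with value 0 on the empty set also when s = 0 *)
Definition hausdorff_gauge (s : R) A : \bar R :=
  if `[< A = set0 >] then 0 else ediam A `^ s.

Definition hausdorff_pre (s delta : R) A : \bar R :=
  ereal_inf [set \sum_(0 <= k <oo) hausdorff_gauge s (U k) |
    U in [set U : (set 'rV[R]_n)^nat |
      A `<=` \bigcup_k U k /\ forall k, ediam (U k) <= delta%:E]].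

(* The s-dimensional Hausdorff measure, without normalising constant; the
   limit of hausdorff_pre as delta -> 0 is a supremum by monotonicity. *)
Definition hausdorff_measure (s : R) A : \bar R :=
  ereal_sup [set hausdorff_pre s delta A | delta in [set delta | (0 < delta)%R]].

End euclidean.

Section sobolev.
Context {R : realType} {n : nat}.
Local Notation E := 'rV[R]_n.
Local Notation mu := (@lebesgue_rV R n).
Implicit Types (Omega : set E) (f phi : E -> R) (g : E -> E).

(* Equality a.e. with a Borel function, i.e. Lebesgue measurability. *)
Definition ae_measurable Omega f :=
  exists2 h : E -> R, measurable_fun Omega h & ae_eq mu Omega f h.

Definition partial (i : 'I_n) f : E -> R := 'D_(delta_mx ord0 i) f.

Definition iter_partial (s : seq 'I_n) f : E -> R := foldr partial f s.

Definition smooth f := forall s : seq 'I_n,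
  continuous (iter_partial s f) /\
  forall i x, derivable (iter_partial s f) x (delta_mx ord0 i).

Definition test_function Omega phi := smooth phi /\
  exists K : set E, [/\ compact K, K `<=` Omega & forall x, ~ K x -> phi x = 0].

Definition loc_integrable Omega f := ae_measurable Omega f /\
  forall K : set E, compact K -> K `<=` Omega ->
    (\int[mu]_(x in K) `|f x|%:E < +oo)%E.

Definition is_weak_gradient Omega f g :=
  loc_integrable Omega f /\
  forall i : 'I_n, loc_integrable Omega (fun x => g x ord0 i) /\
    forall phi, test_function Omega phi ->
      (\int[mu]_(x in Omega) (f x * partial i phi x)%:E =
        - \int[mu]_(x in Omega) (g x ord0 i * phi x)%:E)%E.

(* The weak gradient is unique up to a.e. equality; 0 if there is none. *)
Definition weak_gradient Omega f : E -> E :=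
  xget (fun=> 0) (is_weak_gradient Omega f).

Definition Lp_norm Omega (p : R) f : \bar R :=
  Lnorm mu p%:E (EFin \o (f \_ Omega)).

Definition gagliardo Omega (sigma p : R) f : \bar R :=
  ((\int[mu]_(x in Omega) \int[mu]_(y in Omega)
      ((`|f x - f y| / enorm (x - y) `^ sigma) `^ p
         / enorm (x - y) ^+ n)%:E) `^ p^-1)%E.

Definition sobolev_seminorm Omega (sigma p : R) f : \bar R :=
  if sigma == 1 then Lp_norm Omega p (enorm \o weak_gradient Omega f)
  else gagliardo Omega sigma p f.

Definition sobolev Omega (sigma p : R) f :=
  [/\ ae_measurable Omega f,
      (sigma = 1 -> exists g, is_weak_gradient Omega f g) &
      (Lp_norm Omega p f + sobolev_seminorm Omega sigma p f < +oo)%E].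

Definition average_abs f (A : set E) : \bar R :=
  ((mu A)^-1 * \int[mu]_(y in A) `|f y|%:E)%E.

End sobolev.

(* Main.v *)
(* Let E(A) be the double integral of the Gagliardo kernel over A x A if
   sigma < 1, and the integral of |grad f|^p over A if sigma = 1. The Poincare
   inequality gives for each ball B_r in B_R a constant c such that |f - c|^p has
   integral at most C r^(sigma p) E(B_r) over B_r. Join B_R to a point x of T by
   balls A_k of radii r_k = 2^-k R. If E(A_k) <= kappa r_k^s for every k, then the
   constants of consecutive balls differ by the terms of a geometric sequence,
   because s > n - sigma p, and they tend to 0, because the averages of |f| at x
   do; so the constant c_0 of B_R is at most
   C kappa^(1/p) R^((sigma p + s - n)/p). Take kappa so small that this fails for
   the actual c_0: every x in T then lies in a ball with E(B_r) > kappa r^s. By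
   compactness of T and a finite Vitali covering,
   H^s(T) <= theta 3^s E(B_R) / kappa, which bounds kappa, hence c_0, by E(B_R).

   For sigma = 1 the Poincare inequality comes from comparing f(x) with averages
   of f against a smooth bump which shrinks from B_r to x by homotheties: the
   derivative of the bump along the homotheties is a divergence, so that the
   definition of the weak gradient applies. *)

(* For sigma = 1 the averages over shrinking bumps approach f only in the mean over the ball, while
   the Poincare inequality is wanted in L^p. Therefore |f - c| is first truncated at M: the p-th
   power of a truncated error is at most M^(p-1) times the error, so an L^1 error that vanishes in
   the limit costs nothing, and the resulting bound is free of M. Hoelder's and Jensen's
   inequalities are replaced by h <= a + a^(1-p) h^p for all a > 0, which integrates linearly and is
   optimised in a afterwards; the same inequality lets the averages of |f| control the last
   constants of a chain.

   Besides sign and finiteness, the covering argument uses only that E is monotone and superadditive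
   on disjoint sets; a double integral over A x A is not additive. The value of kappa is the one at
   which the chain bound reads |c_0| <= |c_0| / 2, so c_0 = 0 is set apart. *)
Require Import Defs.
From HB Require Import structures.
From mathcomp Require Import all_boot all_order all_algebra.
From mathcomp Require Import all_classical all_reals all_analysis.
From mathcomp Require Import measurable_realfun.
From mathcomp Require Import ring lra.
Import Order.TTheory GRing.Theory Num.Theory.
Import numFieldNormedType.Exports.
Set Implicit Arguments.
Unset Strict Implicit.
Unset Printing Implicit Defensive.
Local Open Scope classical_set_scope.
Local Open Scope ring_scope.

(** * Lebesgue measure and Euclidean balls *)

Section lebesgue_rV_theory.
Context {R : realType}.

(** A pi-system generating the Borel sets, on which measures on R^n are compared. *)
Definition mboxes n : set (set 'rV[R]_n) :=
  [set A | exists2 F : 'I_n -> set R, (forall i, measurable (F i)) & A = box F].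

Lemma measurable_mboxes n :
  @measurable _ 'rV[R]_n = <<s @mboxes n >>.
Proof.
apply/seteqP; split => A.
  have := @smallest_sigma_algebra _ setT (@mboxes n).
  move=> sb; apply: smallest_sub => //.
  rewrite -bigcup_seq/=; apply: bigcup_sub => i _ _ [B mB <-].
  apply: sub_sigma_algebra; rewrite setTI.
  exists (fun j => if j == i then B else setT) => [j|]; first by case: ifP.
  apply/seteqP; split => v /=; last by move=> /(_ i); rewrite eqxx.
  by move=> Bv j; case: eqP => // ->.
apply: smallest_sub => //; first exact: sigma_algebra_measurable.
by move=> _ [F mF ->]; exact: measurable_box.
Qed.

Lemma setI_closed_mboxes n : setI_closed (@mboxes n).
Proof.
move=> _ _ [F mF ->] [G mG ->]; exists (fun i => F i `&` G i).
  by move=> i; exact: measurableI.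
apply/seteqP; split => v /=; first by move=> [h1 h2] i.
by move=> h; split => i; have [] := h i.
Qed.

Definition cube n (k : nat) : set 'rV[R]_n :=
  box (fun=> `[- k%:R, k%:R]%classic).

Lemma measurable_cube n k : measurable (@cube n k).
Proof. by apply: measurable_box => i; exact: measurable_itv. Qed.

Lemma bigcup_cube n : \bigcup_k @cube n k = setT.
Proof.
apply/seteqP; split => // v _; pose m := \sum_(i < n) `|v ord0 i|.
exists (Num.bound m) => // i /=; rewrite in_itv/= -ler_norml.
have m0 : 0 <= m by rewrite /m sumr_ge0.
apply: (@le_trans _ _ m); last exact/ltW/archi_boundP.
by rewrite /m (bigD1 i)//= lerDl sumr_ge0.
Qed.

Lemma lebesgue_rV_cube_fin n k : (lebesgue_rV n (@cube n k) < +oo)%E.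
Proof.
rewrite /cube lebesgue_rV_box; last by move=> i; exact: measurable_itv.
rewrite [X in (X < _)%E](_ : _ = ((\prod_(i < n) (k%:R + k%:R : R))%:E)).
  exact: ltry.
rewrite (big_morph (@EFin R) (@EFinM R) erefl).
apply: eq_bigr => i _; rewrite lebesgue_measure_itv/= lte_fin.
case: ltP; first by rewrite -EFinB opprK.
move=> h; have k0 : (0 : R) <= k%:R by [].
by congr (_%:E); lra.
Qed.

Lemma sigma_finite_lebesgue_rV n : sigma_finite setT (@lebesgue_rV R n).
Proof.
exists (@cube n); first by rewrite bigcup_cube.
by move=> k; split; [exact: measurable_cube|exact: lebesgue_rV_cube_fin].
Qed.

(** A copy of [lebesgue_rV] under its own head constant, to which the sigma-finite structure
    demanded by the Fubini and Tonelli theorems is attached; the two are convertible. *)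
Definition leb n : set 'rV[R]_n -> \bar R := lebesgue_rV n.
HB.instance Definition _ n := Measure.copy (@leb n) (@lebesgue_rV R n).
HB.instance Definition _ n := Measure_isSigmaFinite.Build _ _ _ (@leb n) (@sigma_finite_lebesgue_rV n).

Lemma lebE n : @leb n = lebesgue_rV n :> (set _ -> \bar R).
Proof. by []. Qed.

(** The image measure multiplied by [a] gives half-open intervals their length, so uniqueness of
    Lebesgue measure applies. *)
Lemma lebesgue_measure_affine (a b : R) (A : set R) : 0 < a -> measurable A ->
  lebesgue_measure ((fun x => b + a * x) @^-1` A) =
  (a^-1%:E * lebesgue_measure A)%E.
Proof.
move=> a0 mA.
have mf : measurable_fun [set: measurableTypeR R] ((fun x => b + a * x) : _ -> measurableTypeR R).
  by apply: measurable_funD => //; exact: measurable_funM.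
pose m' : {measure set (measurableTypeR R) -> \bar R} :=
  mscale (NngNum (ltW a0)) (measure_function_pushforward__canonical__measure_function_Measure lebesgue_measure mf).
have -> : lebesgue_measure A = m' A.
  apply: lebesgue_measure_unique => // _ [[x y] _ <-].
  transitivity (a%:E * lebesgue_measure ((fun z => (b + a * z)%R) @^-1` `]x, y]))%E; last by [].
  rewrite [X in (_ * lebesgue_measure X)%E](_ : _ = `](x - b) / a, (y - b) / a]%classic); last first.
    apply/seteqP; split => z /=; rewrite !in_itv/= ltr_pdivrMr// ler_pdivlMr// mulrC;
      by rewrite ltrBlDl lerBrDl.
  rewrite !lebesgue_measure_itv/= !lte_fin ltr_pM2r ?invr_gt0// ltrD2r.
  case: ifP => _; last by rewrite mule0.
  rewrite -!EFinB -EFinM; congr (_%:E); field; exact: lt0r_neq0.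
transitivity (a^-1%:E * (a%:E * lebesgue_measure ((fun z => (b + a * z)%R) @^-1` A)))%E; last by [].
by rewrite muleA -EFinM mulVf ?mul1e// lt0r_neq0.
Qed.

Lemma measurable_row_affine n (a : R) (b : 'rV[R]_n) :
  measurable_fun setT (fun v : 'rV[R]_n => b + a *: v).
Proof.
apply: measurable_fun_rV => i; under eq_fun do rewrite !mxE.
apply: measurable_funD => //; apply: measurable_funM => //.
exact: measurable_rV_coord.
Qed.

(** Uniqueness of measures on the pi-system of boxes, with the cubes as exhausting sequence; on a
    box each factor is an instance of the one-dimensional lemma. *)
Lemma lebesgue_rV_affine n (a : R) (b : 'rV[R]_n) (A : set 'rV[R]_n) : 0 < a -> measurable A ->
  lebesgue_rV n ((fun v => b + a *: v) @^-1` A) =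
  ((a ^- n)%:E * lebesgue_rV n A)%E.
Proof.
move=> a0 mA.
have an0 : 0 <= a ^+ n by rewrite exprn_ge0// ltW.
pose m' : {measure set 'rV[R]_n -> \bar R} :=
  mscale (NngNum an0) (measure_function_pushforward__canonical__measure_function_Measure (lebesgue_rV n) (measurable_row_affine a b)).
have -> : lebesgue_rV n A = m' A.
  apply: (measure_unique (@mboxes n) (@cube n)) => //.
  - exact: measurable_mboxes.
  - exact: setI_closed_mboxes.
  - by move=> i; exists (fun=> `[- i%:R, i%:R]%classic).
  - exact: bigcup_cube.
  - move=> _ [F mF ->]; rewrite lebesgue_rV_box//.
    transitivity ((a ^+ n)%:E * lebesgue_rV n ((fun v => (b + a *: v)%R) @^-1` box F))%E; last by [].
    rewrite [X in (_ * lebesgue_rV n X)%E](_ : _ = box (fun i => (fun x => b ord0 i + a * x) @^-1` (F i))); last first.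
      by apply/seteqP; split => v /= h i; have := h i; rewrite !mxE.
    rewrite lebesgue_rV_box; last first.
      move=> i; rewrite -[X in measurable X]setTI.
      have mg : measurable_fun [set: R] (fun x : R => b ord0 i + a * x).
        by apply: measurable_funD => //; exact: measurable_funM.
      exact: (mg measurableT _ (mF i)).
    under [in RHS]eq_bigr do rewrite lebesgue_measure_affine//.
    rewrite big_split/= muleA -(big_morph (@EFin R) (@EFinM R) erefl).
    rewrite prodr_const card_ord -EFinM -exprMn divff ?lt0r_neq0// expr1n.
    by rewrite mul1e.
  - exact: lebesgue_rV_cube_fin.
transitivity ((a ^- n)%:E * ((a ^+ n)%:E * lebesgue_rV n ((fun v => (b + a *: v)%R) @^-1` A)))%E; last by [].
rewrite muleA -EFinM mulVf ?mul1e//.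
by rewrite lt0r_neq0// exprn_gt0.
Qed.

End lebesgue_rV_theory.

Section lebesgue_rV_integral.
Context {R : realType}.

Lemma ge0_integral_affine n (a : R) (b : 'rV[R]_n) (f : 'rV[R]_n -> \bar R) :
  0 < a -> measurable_fun setT f -> (forall x, (0 <= f x)%E) ->
  (\int[lebesgue_rV n]_v f (b + a *: v)%R = (a ^- n)%:E * \int[lebesgue_rV n]_v f v)%E.
Proof.
move=> a0 mf f0.
have an0 : 0 <= a ^- n by rewrite invr_ge0 exprn_ge0// ltW.
rewrite -(ge0_integral_mscale (lebesgue_rV n) measurableT (NngNum an0) mf (fun x _ => f0 x)).
have := ge0_integral_pushforward (measurable_row_affine a b) (lebesgue_rV n)
  measurableT mf (fun x _ => f0 x).
rewrite preimage_setT => <-.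
apply: eq_measure_integral => [|mf' A mA _]; first exact: measurable_row_affine.
exact: (lebesgue_rV_affine b a0 mA).
Qed.

End lebesgue_rV_integral.

(** * The Euclidean norm, its balls and their volume *)

Section enorm_theory.
Context {R : realType} {n : nat}.
Implicit Types (x y z v : 'rV[R]_n) (r : R).

Lemma enorm_ge0 v : 0 <= enorm v. Proof. exact: sqrtr_ge0. Qed.

Lemma sumsq_ge0 v : 0 <= \sum_(i < n) v ord0 i ^+ 2.
Proof. by apply: sumr_ge0 => i _; exact: sqr_ge0. Qed.

Lemma sqr_enorm v : enorm v ^+ 2 = \sum_(i < n) v ord0 i ^+ 2.
Proof. by rewrite sqr_sqrtr// sumsq_ge0. Qed.

Lemma enormZ a v : enorm (a *: v) = `|a| * enorm v.
Proof.
rewrite /enorm; under eq_bigr do rewrite mxE exprMn.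
by rewrite -mulr_sumr sqrtrM ?sqr_ge0// sqrtr_sqr.
Qed.

Lemma enorm0 : enorm (0 : 'rV[R]_n) = 0.
Proof. by rewrite -(scale0r 0) enormZ normr0 mul0r. Qed.

Lemma enormN v : enorm (- v) = enorm v.
Proof. by rewrite -scaleN1r enormZ normrN1 mul1r. Qed.

Lemma enormB x y : enorm (x - y) = enorm (y - x).
Proof. by rewrite -enormN opprB. Qed.

(** Cauchy-Schwarz from Lagrange's identity. Squares are compared, so a nonpositive scalar product
    is treated apart. *)
Lemma enorm_dot_le x y : \sum_(i < n) x ord0 i * y ord0 i <= enorm x * enorm y.
Proof.
set S := \sum_(i < n) _.
have [S0|S0] := lerP S 0; first by rewrite (le_trans S0)// mulr_ge0 ?enorm_ge0.
rewrite -ler_sqr ?nnegrE ?mulr_ge0 ?enorm_ge0 ?(ltW S0)// exprMn !sqr_enorm.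
have : 0 <= \sum_(i < n) \sum_(j < n) (x ord0 i * y ord0 j - x ord0 j * y ord0 i) ^+ 2.
  by apply: sumr_ge0 => i _; apply: sumr_ge0 => j _; exact: sqr_ge0.
under eq_bigr do under eq_bigr do rewrite sqrrB !exprMn.
under eq_bigr do rewrite big_split/= sumrB.
rewrite big_split/= sumrB.
have -> : \sum_(i < n) \sum_(j < n) x ord0 i ^+ 2 * y ord0 j ^+ 2 =
  (\sum_(i < n) x ord0 i ^+ 2) * (\sum_(i < n) y ord0 i ^+ 2).
  by rewrite mulr_suml; apply: eq_bigr => i _; rewrite mulr_sumr.
have -> : \sum_(i < n) \sum_(j < n) x ord0 j ^+ 2 * y ord0 i ^+ 2 =
  (\sum_(i < n) x ord0 i ^+ 2) * (\sum_(i < n) y ord0 i ^+ 2).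
  by rewrite mulrC mulr_suml; apply: eq_bigr => i _; rewrite mulr_sumr; under eq_bigr do rewrite mulrC.
have -> : \sum_(i < n) \sum_(j < n) (x ord0 i * y ord0 j * (x ord0 j * y ord0 i)) *+ 2 = S ^+ 2 *+ 2.
  rewrite expr2 mulr_suml -sumrMnl; apply: eq_bigr => i _.
  rewrite mulr_sumr -sumrMnl; apply: eq_bigr => j _; congr (_ *+ 2); ring.
lra.
Qed.

Lemma ler_enormD x y : enorm (x + y) <= enorm x + enorm y.
Proof.
rewrite -ler_sqr ?nnegrE ?addr_ge0 ?enorm_ge0// sqrrD !sqr_enorm.
under eq_bigr do rewrite mxE sqrrD.
rewrite !big_split/= lerD2r lerD2l -mulr2n lerMn2r/=.
exact: enorm_dot_le.
Qed.

Lemma enorm_triangle x y z : enorm (x - z) <= enorm (x - y) + enorm (y - z).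
Proof. by rewrite (le_trans _ (ler_enormD _ _))// addrA subrK. Qed.

Lemma coord_le_enorm v i : `|v ord0 i| <= enorm v.
Proof.
rewrite -ler_sqr ?nnegrE ?enorm_ge0// sqr_enorm real_normK ?num_real//.
by rewrite (bigD1 i)//= lerDl sumr_ge0// => j _; exact: sqr_ge0.
Qed.

Lemma measurable_enorm : measurable_fun setT (@enorm R n).
Proof.
apply: (@measurableT_comp _ _ _ _ _ _ (@Num.sqrt R)).
  by apply: continuous_measurable_fun; exact: sqrt_continuous.
apply: measurable_sum => i; apply: measurable_funX; exact: measurable_rV_coord.
Qed.

Lemma measurable_row_sub d (T : measurableType d) (f g : T -> 'rV[R]_n) :
  measurable_fun [set: T] f -> measurable_fun [set: T] g ->
  measurable_fun [set: T] (fun t => f t - g t).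
Proof.
move=> mf mg; apply: measurable_fun_rV => i; under eq_fun do rewrite !mxE.
by apply: measurable_funB; apply: (measurableT_comp (measurable_rV_coord i)).
Qed.

Lemma measurable_eball x r : measurable (eball x r).
Proof.
have : measurable_fun setT (fun y => enorm (y - x)).
  by apply: measurableT_comp; [exact: measurable_enorm|exact: measurable_row_sub].
move=> /(_ measurableT `]-oo, r[%classic (measurable_itv _)); rewrite setTI.
by rewrite (_ : _ @^-1` _ = eball x r)//; apply/seteqP; split=> y /=; rewrite in_itv.
Qed.

Lemma continuous_sumr (T : topologicalType) I (s : seq I) (F : I -> T -> R) :
  (forall i, continuous (F i)) -> continuous (fun t => \sum_(i <- s) F i t).
Proof.
move=> cF t; elim: s => [|i s IH].
  by under eq_fun do rewrite big_nil; exact: cst_continuous.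
by under eq_fun do rewrite big_cons; apply: cvgD; [exact: cF|exact: IH].
Qed.

Lemma continuous_edist x : continuous (fun y => enorm (y - x)).
Proof.
move=> v; apply: (@continuous_comp _ _ _ _ (@Num.sqrt R)); last exact: sqrt_continuous.
apply: continuous_sumr => i {}v; apply: (@continuous_comp _ _ _ _ (fun t : R => t ^+ 2)); last exact: exprn_continuous.
have -> : (fun y : 'rV[R]_n => (y - x) ord0 i) = (fun y => y ord0 i - x ord0 i).
  by apply/funext => y; rewrite !mxE.
by apply: continuousB; [exact: coord_continuous|exact: cst_continuous].
Qed.

Lemma open_eball x r : open (eball x r).
Proof.
rewrite (_ : eball x r = (fun y => enorm (y - x)) @^-1` [set t | t < r])//.
by apply: open_comp; [move=> y _; exact: continuous_edist|exact: open_lt].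
Qed.

Lemma closed_ecball x r : closed [set y | enorm (y - x) <= r].
Proof.
rewrite (_ : [set y | _] = (fun y => enorm (y - x)) @^-1` [set t | t <= r])//.
by apply: preimage_closed; [move=> y _; exact: continuous_edist|exact: closed_le].
Qed.

Lemma compact_ecball x r : compact [set y | enorm (y - x) <= r].
Proof.
apply: bounded_closed_compact; last exact: closed_ecball.
exists (r + enorm x); split; first exact: num_real.
move=> M rM y /= yr.
have yM : enorm y <= M.
  by rewrite (le_trans _ (ltW rM))// -[y](subrK x) (le_trans (ler_enormD _ _))// lerD2r.
have M0 : 0 <= M by rewrite (le_trans _ yM)// enorm_ge0.
rewrite [leLHS]/Num.Def.normr /= mx_normrE; apply: bigmax_le => //= -[i j] _ /=.
by rewrite ord1 (le_trans (coord_le_enorm _ _)).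
Qed.

Local Notation mu := (@lebesgue_rV R n).

Lemma eball_affine x r : 0 < r ->
  eball x r = (fun v => - (r^-1 *: x) + r^-1 *: v) @^-1` eball 0 1.
Proof.
move=> r0; apply/eq_set => y.
have E : - (r^-1 *: x) + r^-1 *: y = r^-1 *: (y - x) by rewrite scalerBr addrC.
by rewrite /preimage/eball/= subr0 E enormZ ger0_norm ?invr_ge0 ?(ltW r0)// mulrC ltr_pdivrMr// mul1r.
Qed.

Definition ball_vol : R := fine (mu (eball 0 1)).

Lemma eball_sub_cube : eball (0 : 'rV[R]_n) 1 `<=` cube 1.
Proof.
move=> v; rewrite /eball/= subr0 => v1 i /=.
by rewrite in_itv/= -ler_norml (le_trans (coord_le_enorm _ _)) ?ltW.
Qed.

Lemma lebesgue_eball1 : mu (eball 0 1) = ball_vol%:E.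
Proof.
rewrite /ball_vol fineK// ge0_fin_numE// (le_lt_trans _ (@lebesgue_rV_cube_fin R n 1))//.
by apply: le_measure; rewrite ?inE; [exact: measurable_eball|exact: measurable_cube|exact: eball_sub_cube].
Qed.

Lemma lebesgue_eball x r : 0 < r -> mu (eball x r) = (r ^+ n * ball_vol)%:E.
Proof.
move=> r0; rewrite eball_affine// lebesgue_rV_affine ?invr_gt0//; last exact: measurable_eball.
by rewrite exprVn invrK EFinM; congr (_ * _)%E; exact: lebesgue_eball1.
Qed.

Lemma ball_vol_gt0 : 0 < ball_vol.
Proof.
rewrite -lte_fin -lebesgue_eball1.
(* A cube of half-side 1/(n+1) fits in the unit ball: its points have squared norm at most
   n/(n+1). *)
pose F := fun i : 'I_n => `[- (n.+1%:R^-1), n.+1%:R^-1]%classic : set R.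
have mF i : measurable (F i) by exact: measurable_itv.
apply: (@lt_le_trans _ _ (mu (box F))); last first.
  apply: le_measure; rewrite ?inE; [exact: measurable_box|exact: measurable_eball|].
  move=> v /= Fv; rewrite /eball/= subr0.
  rewrite -(@ltr_pXn2r _ 2)// ?nnegrE ?enorm_ge0//.
  rewrite sqr_enorm expr1n.
  apply: (@le_lt_trans _ _ (\sum_(i < n) n.+1%:R^-1)).
    apply: ler_sum => i _; have := Fv i; rewrite /F/= in_itv/= -ler_norml => vi.
    rewrite -real_normK ?num_real// expr2.
    rewrite (le_trans (ler_pM _ _ vi vi))//.
    by rewrite ler_piMl// invf_le1// ler1n.
  by rewrite sumr_const card_ord -[X in X < _]mulr_natr mulrC ltr_pdivrMr// mul1r ltr_nat.
rewrite lebesgue_rV_box//.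
rewrite [X in (_ < X)%E](_ : _ = ((\prod_(i < n) (n.+1%:R^-1 + n.+1%:R^-1 : R))%:E)).
  by rewrite lte_fin prodr_gt0// => i _; rewrite addr_gt0// invr_gt0.
rewrite (big_morph (@EFin R) (@EFinM R) erefl).
apply: eq_bigr => i _; rewrite /F lebesgue_measure_itv/= lte_fin ifT; last first.
  by rewrite gtrN// invr_gt0.
by rewrite -EFinB opprK.
Qed.

End enorm_theory.

(** * Smooth bump functions *)

Section flat_exponential.
Context {R : realType}.
Implicit Types (P : {poly R}) (t u : R).

(* This class of functions contains [exp (- 1/t)] and is closed under
   differentiation, hence consists of smooth functions. *)
Definition flat P t : R := if 0 < t then P.[t^-1] * expR (- t^-1) else 0.

(** The power [k] is carried along so that peeling a coefficient off [P] can move one factor u into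
    it; what is left is u^k / k! <= exp u. *)
Lemma poly_expRN_bounded P k :
  exists2 C : R, 0 <= C & forall u, 0 <= u -> `|P.[u]| * u ^+ k * expR (- u) <= C.
Proof.
elim/poly_ind: P k => [|P c IH] k.
  by exists 0 => // u _; rewrite horner0 normr0 !mul0r.
have [C C0 hC] := IH k.+1.
exists (C + `|c| * k`!%:R) => [|u u0]; first by rewrite addr_ge0// mulr_ge0.
rewrite hornerMXaddC.
apply: (@le_trans _ _ ((`|P.[u]| * u ^+ k.+1 + `|c| * u ^+ k) * expR (- u))).
  rewrite ler_wpM2r ?expR_ge0// exprS mulrA -mulrDl ler_wpM2r ?exprn_ge0//.
  by rewrite (le_trans (ler_normD _ _))// normrM (ger0_norm u0).
rewrite mulrDl lerD// ?hC// -mulrA ler_wpM2l//.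
rewrite expRN ler_pdivrMr ?expR_gt0//.
case: k {IH C C0 hC} => [|k].
  by rewrite expr0 fact0 mul1r (le_trans _ (expR_ge1Dx _))// lerDl.
rewrite mulrC -ler_pdivrMr ?ltr0n ?fact_gt0//.
by apply: le_trans (expR_ge1Dxn k u0); rewrite lerDr.
Qed.

Lemma is_derive_horner P t : is_derive t 1 (horner P) P^`().[t].
Proof.
apply: (@DeriveDef _ _ _ t 1 (horner P)); first exact: derivable_horner.
by rewrite derivE derive1E.
Qed.

(** With u = 1/t, the derivative of P(u) exp(-u) in t is u^2 (P - P')(u) exp(-u), again of the same
    form. The point 0 needs its own argument. *)
Lemma is_derive_flat P t : is_derive t 1 (flat P) (flat ('X^2 * (P - P^`())) t).
Proof.
have [t0|t0|->] := ltgtP t 0.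
- have E : {near t, cst 0 =1 flat P}.
    near=> s; rewrite /flat ifF//; apply/negbTE; rewrite -leNgt ltW//.
    by near: s; exact: lt_nbhsl.
  rewrite {2}/flat ifF; last by rewrite ltNge (ltW t0).
  exact: near_eq_is_derive E (is_derive_cst 0 t 1).
- have tn0 : t != 0 by rewrite gt_eqF.
  have E : {near t, (fun s => P.[s^-1] * expR (- s^-1)) =1 flat P}.
    near=> s; rewrite /flat ifT//; near: s; exact: lt_nbhsr.
  rewrite {2}/flat t0.
  apply: near_eq_is_derive E _.
  have dV : is_derive t 1 (fun s : R => s^-1) (- t ^- 2).
    have := @is_deriveV _ id t 1 1 tn0 (is_derive_id t 1).
    by rewrite scaler1.
  have dP : is_derive t 1 (fun s : R => P.[s^-1]) (P^`().[t^-1] * - t ^- 2).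
    exact: (@is_derive1_comp _ (horner P) (fun s => s^-1) _ _ _ (is_derive_horner P _)).
  have dE : is_derive t 1 (fun s : R => expR (- s^-1)) (expR (- t^-1) * - (- t ^- 2)).
    exact: (@is_derive1_comp _ expR (fun s => - s^-1) _ _ _ (is_derive_expR _) (is_deriveN dV)).
  apply: is_derive_eq; rewrite !hornerE /= /GRing.scale/= !exprVn; ring.
- rewrite {2}/flat ltxx.
  (* Exponent 2: one factor 1/h comes from the difference quotient, and the other one is traded for
     a factor h that tends to 0. *)
  have [C C0 hC] := poly_expRN_bounded P 2.
  have cv : (fun h => h^-1 *: ((flat P \o shift 0) (h *: 1) - flat P 0)) @ 0^' --> (0:R).
    apply/cvgrPdist_le => e e0; near=> h.
    rewrite sub0r normrN /= addr0 {2}/flat ltxx subr0 [_ *: 1]mulr1.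
    rewrite /flat; case: ifPn => h0; last by rewrite scaler0 normr0 ltW.
    have := hC h^-1; rewrite invr_ge0 (ltW h0) => /(_ isT) hb.
    have -> : `|h^-1 *: (P.[h^-1] * expR (- h^-1))| = h * (`|P.[h^-1]| * h^-1 ^+ 2 * expR (- h^-1)).
      rewrite /GRing.scale/= !normrM (ger0_norm (expR_ge0 _)) ger0_norm ?invr_ge0 ?(ltW h0)//.
      by field; rewrite gt_eqF.
    apply: (@le_trans _ _ (h * (C + 1))).
      by rewrite ler_wpM2l ?(ltW h0)// (le_trans hb)// lerDl.
    rewrite -ler_pdivlMr; last lra.
    rewrite (le_trans (ler_norm _))//; near: h; apply: dnbhs0_le.
    by rewrite divr_gt0//; lra.
  apply: DeriveDef; first by apply/cvg_ex; exists 0.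
  exact: cvg_lim cv.
Unshelve. all: by end_near. Qed.

Lemma flat1_ge0 t : 0 <= flat 1 t.
Proof. by rewrite /flat; case: ifP => // _; rewrite hornerC mul1r expR_ge0. Qed.

Lemma flat1_gt0 t : 0 < t -> 0 < flat 1 t.
Proof. by move=> t0; rewrite /flat t0 hornerC mul1r expR_gt0. Qed.

Lemma flat1_le1 t : flat 1 t <= 1.
Proof.
rewrite /flat; case: ifP => // t0; rewrite hornerC mul1r.
by rewrite -expR0 ler_expR oppr_le0 invr_ge0 ltW.
Qed.

Lemma flat_le0 P t : t <= 0 -> flat P t = 0.
Proof. by move=> t0; rewrite /flat ltNge t0. Qed.

Lemma continuous_flat P : continuous (flat P).
Proof.
move=> t; apply: differentiable_continuous; apply/derivable1_diffP.
by have [] := is_derive_flat P t.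
Qed.

Lemma flat_bounded P : exists2 C : R, 0 <= C & forall t, `|flat P t| <= C.
Proof.
have [C C0 hC] := poly_expRN_bounded P 0.
exists C => // t; rewrite /flat; case: ifP => [t0|_]; last by rewrite normr0.
have := hC t^-1; rewrite invr_ge0 (ltW t0) expr0 mulr1 => /(_ isT).
by rewrite normrM (ger0_norm (expR_ge0 _)).
Qed.

End flat_exponential.

(** * A class of smooth functions of several variables *)

Section smooth_functions.
Context {R : realType} {n : nat}.
Local Notation V := 'rV[R]_n.

(** Closed under partial derivatives, so that smoothness of every order follows by induction on the
    list of derivatives. The constructor [smooth_flat] covers all [P] because differentiation
    changes the polynomial. *)
Inductive smooth_expr : (V -> R) -> Prop :=
| smooth_cst c : smooth_expr (cst c)
| smooth_coord i : smooth_expr (fun v => v ord0 i)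
| smooth_add f g : smooth_expr f -> smooth_expr g -> smooth_expr (f + g)
| smooth_mul f g : smooth_expr f -> smooth_expr g -> smooth_expr (f * g)
| smooth_flat P f : smooth_expr f -> smooth_expr (flat P \o f).

Lemma derive_line (f : V -> R) x v : 'D_v f x = 'D_1 (fun h : R => f (h *: v + x)) 0.
Proof.
rewrite /derive; set g1 := fun h => _; set g2 := fun h => _.
suff -> : g1 = g2 by [].
by apply/funext => h; rewrite /g1 /g2 /= addr0 scale0r add0r [_%:A]mulr1.
Qed.

Lemma is_derive_line (f : V -> R) x v df :
  is_derive (0 : R) 1 (fun h => f (h *: v + x)) df -> is_derive x v f df.
Proof.
move=> [h1 h2]; apply: DeriveDef; first exact/derivable1P.
by rewrite derive_line.
Qed.

(** Restricting to the line through [x] reduces this to one variable; only the directional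
    derivative of [f] is assumed, not differentiability. *)
Lemma is_derive_comp1 (g : R -> R) (f : V -> R) x v df dg :
  is_derive (f x) 1 g dg -> is_derive x v f df -> is_derive x v (g \o f) (dg * df).
Proof.
move=> dg1 [f1 f2]; apply: is_derive_line.
apply: (@is_derive1_comp _ g (fun h => f (h *: v + x))).
  by rewrite scale0r add0r.
apply: (@DeriveDef _ _ _ (0 : R) 1 (fun h : R => f (h *: v + x))).
  exact: (derivable1P f x v).1 f1.
by rewrite -derive_line.
Qed.

Lemma is_derive_coord (i j : 'I_n) (x : V) :
  is_derive x (delta_mx ord0 j) (fun v : V => v ord0 i) (i == j)%:R.
Proof.
apply: is_derive_line; set b : R := (i == j)%:R.
have D : is_derive (0 : R) 1 (b \*: (id : R -> R) + cst (x ord0 i)) (b *: 1 + 0).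
  by apply: is_deriveD.
rewrite (_ : (fun h : R => _) = b \*: (id : R -> R) + cst (x ord0 i)); last first.
  by apply/funext => h; rewrite !mxE eqxx/= mulrC.
by apply: is_derive_eq D _; rewrite addr0 [_ *: _]mulr1.
Qed.

Lemma smooth_exprP f : smooth_expr f -> continuous f /\
  forall i, exists2 g, smooth_expr g & forall x, is_derive x (delta_mx ord0 i) f (g x).
Proof.
elim=> [c|j|{}f g _ [cf df] _ [cg dg]|{}f g sf [cf df] sg [cg dg]|P {}f sf [cf df]]; split.
- exact: cst_continuous.
- by move=> i; exists (cst 0); [exact: smooth_cst|move=> x; exact: is_derive_cst].
- exact: coord_continuous.
- move=> i; exists (cst (j == i)%:R); [exact: smooth_cst|move=> x; exact: is_derive_coord].
- by move=> x; exact: (continuousD (cf x) (cg x)).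
- move=> i; have [f' sf' hf] := df i; have [g' sg' hg] := dg i.
  exists (f' + g'); first exact: smooth_add.
  by move=> x; exact: is_deriveD.
- by move=> x; exact: (continuousM (cf x) (cg x)).
- move=> i; have [f' sf' hf] := df i; have [g' sg' hg] := dg i.
  exists (f * g' + g * f').
    by apply: smooth_add; exact: smooth_mul.
  by move=> x; exact: is_deriveM.
- by move=> x; exact: (continuous_comp (cf x) (@continuous_flat _ P (f x))).
- move=> i; have [f' sf' hf] := df i.
  exists ((flat ('X^2 * (P - P^`())) \o f) * f').
    by apply: smooth_mul => //; exact: smooth_flat.
  by move=> x; apply: is_derive_comp1 => //; exact: is_derive_flat.
Qed.

Lemma partial_smooth_expr i f : smooth_expr f -> smooth_expr (partial i f).
Proof.
move=> /smooth_exprP[_ /(_ i) [g sg fg]].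
suff -> : partial i f = g by [].
by apply/funext => x; rewrite /partial; have [] := fg x.
Qed.

Lemma smooth_expr_smooth f : smooth_expr f -> smooth f.
Proof.
move=> sf s; have : smooth_expr (iter_partial s f).
  by elim: s => //= i s IH; exact: partial_smooth_expr.
move=> /smooth_exprP[? h]; split=> // i x.
by have [g _ /(_ x) []] := h i.
Qed.

Lemma smooth_expr_measurable f : smooth_expr f -> measurable_fun [set: V] f.
Proof.
elim=> [c|j|{}f g _ mf _ mg|{}f g _ mf _ mg|P {}f _ mf].
- exact: measurable_cst.
- exact: measurable_rV_coord.
- exact: measurable_funD.
- exact: measurable_funM.
- by apply: measurableT_comp mf; exact: (continuous_measurable_fun (@continuous_flat _ P)).
Qed.

Lemma smooth_sum I (s : seq I) (F : I -> V -> R) : (forall i, smooth_expr (F i)) ->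
  smooth_expr (fun x => \sum_(i <- s) F i x).
Proof.
move=> sF; elim: s => [|i s IH].
  rewrite (_ : (fun x => _) = cst 0); first exact: smooth_cst.
  by apply/funext => x; rewrite big_nil.
rewrite (_ : (fun x => _) = F i + (fun x => \sum_(j <- s) F j x)); first exact: smooth_add.
by apply/funext => x; rewrite big_cons.
Qed.

End smooth_functions.

(** * Averages over shrinking bumps *)

Section kernel.
Context {R : realType} {n : nat}.
Local Notation V := 'rV[R]_n.
Local Notation mu := (@leb R n).
Implicit Types (x z w : V) (l : R).

(** Supported in the closed ball of radius 1/2, hence after rescaling in a compact subset of the
    open ball, as test functions require. *)
Definition bump w : R := flat 1 (4^-1 - enorm w ^+ 2).

Lemma bump_ge0 w : 0 <= bump w. Proof. exact: flat1_ge0. Qed.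
Lemma bump_le1 w : bump w <= 1. Proof. exact: flat1_le1. Qed.

Lemma bump_neq0 w : bump w != 0 -> enorm w <= 2^-1.
Proof.
apply: contraNT; rewrite -ltNge => h; rewrite /bump flat_le0// subr_le0.
have : 2^-1 * 2^-1 <= enorm w * enorm w by rewrite ler_pM// ltW.
by rewrite -expr2 => h2; lra.
Qed.

Lemma bumpN w : bump (- w) = bump w. Proof. by rewrite /bump enormN. Qed.

Lemma measurable_bump : measurable_fun [set: V] bump.
Proof.
apply: (measurableT_comp (continuous_measurable_fun (@continuous_flat R 1))).
by apply: measurable_funB => //; apply: measurable_funX; exact: measurable_enorm.
Qed.

Lemma bump_le_indic w : bump w <= \1_(eball 0 1) w.
Proof.
rewrite indicE; case: (boolP (w \in _)) => [_|]; first exact: bump_le1.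
move=> /negP h; have [->//|/bump_neq0 h'] := eqVneq (bump w) 0.
by exfalso; apply: h; rewrite inE /eball/= subr0; lra.
Qed.

Definition bump_mass : R := fine (\int[mu]_w (bump w)%:E)%E.

Lemma bump_massE : (\int[mu]_w (bump w)%:E = bump_mass%:E)%E.
Proof.
rewrite fineK// ge0_fin_numE; last first.
  by apply: integral_ge0 => w _; rewrite lee_fin bump_ge0.
apply: (@le_lt_trans _ _ (\int[mu]_w (\1_(eball (0 : V) 1) w)%:E)%E).
  apply: ge0_le_integral => //.
  - by move=> w _; rewrite lee_fin bump_ge0.
  - by apply/measurable_EFinP; exact: measurable_bump.
  - by apply/measurable_EFinP; apply: measurable_indic; exact: measurable_eball.
  - by move=> w _; rewrite lee_fin bump_le_indic.
rewrite integral_indic//=; last exact: measurable_eball.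
by rewrite setIT lebE lebesgue_eball1 ltry.
Qed.

Lemma bump_mass_gt0 : 0 < bump_mass.
Proof.
(* On the ball of radius 1/3 the argument of [flat] is at least 1/4 - 1/9 = 5/36 > 1/8. *)
have e0 : 0 < flat 1 (8^-1 : R) by rewrite flat1_gt0.
rewrite -lte_fin -bump_massE.
apply: (@lt_le_trans _ _ (\int[mu]_w (flat 1 8^-1 * \1_(eball (0 : V) 3^-1) w)%:E)%E); last first.
  apply: ge0_le_integral => //.
  - by move=> w _; rewrite lee_fin mulr_ge0// ltW.
  - by apply/measurable_EFinP/measurable_funM => //; apply: measurable_indic; exact: measurable_eball.
  - by apply/measurable_EFinP; exact: measurable_bump.
  - move=> w _; rewrite lee_fin indicE.
    case: (boolP (w \in _)) => [|_]; last by rewrite mulr0 bump_ge0.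
    rewrite inE /eball/= subr0 mulr1 => h.
    have h2 : enorm w ^+ 2 <= 9^-1.
      rewrite (_ : 9^-1 = 3^-1 * 3^-1); last by rewrite -invfM -natrM.
      by rewrite expr2 ler_pM ?enorm_ge0// ltW.
    rewrite /bump /flat ifT; last by rewrite invr_gt0.
    rewrite ifT; last by lra.
    rewrite !hornerC !mul1r ler_expR lerN2 lef_pV2// ?posrE; lra.
under eq_integral do rewrite EFinM.
rewrite ge0_integralZl//; last 2 first.
- by apply/measurable_EFinP; apply: measurable_indic; exact: measurable_eball.
- by rewrite lee_fin ltW.
rewrite integral_indic//; last exact: measurable_eball.
rewrite setIT /= lebE lebesgue_eball ?invr_gt0//.
by rewrite -EFinM lte_fin !mulr_gt0 ?ball_vol_gt0// exprn_gt0// invr_gt0.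
Qed.

Variables (c : V) (r : R).

(** The normalised bump of [eball c r], carried by the homothety of centre [x] and ratio 1/l. For l
    = 1 it does not depend on [x]; as l grows it concentrates at [x]. *)
Definition kern l x z : R :=
  l ^+ n * (r ^- n / bump_mass) * bump (r^-1 *: (l *: (z - x) + (x - c))).

Definition ncst : R := r ^- n / bump_mass.

Hypothesis r0 : 0 < r.

Lemma ncst_gt0 : 0 < ncst.
Proof. by rewrite /ncst divr_gt0 ?bump_mass_gt0// invr_gt0 exprn_gt0. Qed.

Lemma kern_ge0 l x z : 0 <= l -> 0 <= kern l x z.
Proof.
move=> l0; rewrite /kern !mulr_ge0 ?bump_ge0 ?exprn_ge0//.
  by rewrite invr_ge0 exprn_ge0// ltW.
by rewrite invr_ge0 ltW// bump_mass_gt0.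
Qed.

Lemma kern_supp0 l x z : kern l x z != 0 -> enorm (l *: (z - x) + (x - c)) <= r / 2.
Proof.
rewrite /kern mulf_eq0 negb_or => /andP[_ /bump_neq0].
rewrite enormZ ger0_norm ?invr_ge0 ?(ltW r0)// ler_pdivrMl//.
Qed.

(** Put y = x + l (z - x), a point within r/2 of [c]. Then z is a convex combination of x and y,
    hence in the ball, and l (z - x) = (y - c) - (x - c). *)
Lemma scaled_supp l x z : 1 <= l -> eball c r x ->
  enorm (l *: (z - x) + (x - c)) <= r / 2 ->
  eball c r z /\ l * enorm (z - x) <= 2 * r.
Proof.
rewrite /eball/= => l1 xc h.
have l0 : 0 < l by exact: lt_le_trans l1.
have ln0 : l != 0 by rewrite gt_eqF.
have h1 : l * enorm (z - x) <= r / 2 + enorm (x - c).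
  rewrite -(ger0_norm (ltW l0)) -enormZ.
  rewrite -[l *: (z - x)](addrK (x - c)).
  by rewrite (le_trans (ler_enormD _ _))// enormN lerD2r.
split; last by move: h1 xc r0; set a := (_ * _); set b := enorm (x - c) => *; lra.
rewrite -(ltr_pM2l l0) -[X in X * enorm _](ger0_norm (ltW l0)) -enormZ.
have -> : l *: (z - c) = (l *: (z - x) + (x - c)) + (l - 1) *: (x - c).
  by rewrite scalerBl scale1r -addrA [x - c + _]addrC addrNK -scalerDr addrA subrK.
rewrite (le_lt_trans (ler_enormD _ _))// enormZ ger0_norm ?subr_ge0//.
have : (l - 1) * enorm (x - c) <= (l - 1) * r by rewrite ler_wpM2l ?subr_ge0// ltW.
by move: h r0; nra.
Qed.

Lemma kern_supp l x z : 1 <= l -> eball c r x -> kern l x z != 0 ->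
  eball c r z /\ l * enorm (z - x) <= 2 * r.
Proof. by move=> l1 xc /kern_supp0; exact: scaled_supp. Qed.

Lemma measurable_kern d (T : measurableType d) (fl : T -> R) (fx fz : T -> V) :
  measurable_fun [set: T] fl -> measurable_fun [set: T] fx -> measurable_fun [set: T] fz ->
  measurable_fun [set: T] (fun t => kern (fl t) (fx t) (fz t)).
Proof.
move=> ml mx mz; apply: measurable_funM.
  by apply: measurable_funM => //; exact: measurable_funX.
apply: (measurableT_comp measurable_bump); apply: measurable_fun_rV => i.
under eq_fun do rewrite !mxE.
have mc (f : T -> V) : measurable_fun [set: T] f -> measurable_fun [set: T] (fun t => f t ord0 i).
  by move=> mf; apply: (measurableT_comp (measurable_rV_coord i)).
apply: measurable_funM => //; apply: measurable_funD.
  by apply: measurable_funM => //; apply: measurable_funB; exact: mc.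
by apply: measurable_funB => //; exact: mc.
Qed.

Lemma integral_bump_affine (a : R) (b : V) : 0 < a ->
  (\int[mu]_w (bump (b + a *: w))%:E = (a ^- n * bump_mass)%:E)%E.
Proof.
move=> a0.
rewrite (@ge0_integral_affine _ _ a b (fun w => (bump w)%:E))//.
- by rewrite bump_massE.
- by apply/measurable_EFinP; exact: measurable_bump.
- by move=> w; rewrite lee_fin bump_ge0.
Qed.

Lemma integral_kern l x : 0 < l -> (\int[mu]_z (kern l x z)%:E = 1)%E.
Proof.
move=> l0; rewrite /kern.
under eq_integral do rewrite EFinM.
rewrite ge0_integralZl//; last 3 first.
- apply/measurable_EFinP; apply: (measurableT_comp measurable_bump).
  apply: measurable_fun_rV => i; under eq_fun do rewrite !mxE.
  apply: measurable_funM => //; apply: measurable_funD => //.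
  apply: measurable_funM => //; apply: measurable_funB => //.
  exact: measurable_rV_coord.
- by move=> z _; rewrite lee_fin bump_ge0.
- by rewrite lee_fin mulr_ge0 ?exprn_ge0 ?(ltW l0)// ltW// ncst_gt0.
under eq_integral => z _.
  rewrite (_ : r^-1 *: (l *: (z - x) + (x - c)) =
    r^-1 *: (x - c - l *: x) + (l / r) *: z); last first.
    by apply/rowP => i; rewrite !mxE; ring.
  over.
rewrite integral_bump_affine ?divr_gt0// -EFinM.
rewrite expr_div_n invf_div; congr (_%:E).
have := bump_mass_gt0; have : 0 < l ^+ n by rewrite exprn_gt0.
have : 0 < r ^+ n by rewrite exprn_gt0.
by move=> h1 h2 h3; field; rewrite !gt_eqF.
Qed.

Definition kern_cst : R := 2 ^+ n * (1 + ball_vol (R := R) (n := n) / bump_mass).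

(** As a function of [x] the kernel is dilated by l - 1 rather than l, so its integral over R^n is
    (l / (l - 1))^n, at most 2^n for l > 2. For l <= 2 the kernel is bounded by 2^n times its
    normalisation, and the ball has finite volume. [kern_cst] adds both bounds. *)
Lemma integral_kern1 l z : 1 <= l ->
  (\int[mu]_(x in eball c r) (kern l x z)%:E <= kern_cst%:E)%E.
Proof.
move=> l1; have l0 : 0 < l by exact: lt_le_trans l1.
have mk : measurable_fun [set: V] (fun x => (kern l x z)%:E).
  by apply/measurable_EFinP; exact: measurable_kern.
have bv : 0 <= ball_vol (R := R) (n := n) / bump_mass.
  by rewrite divr_ge0 ?ltW ?ball_vol_gt0 ?bump_mass_gt0.
have [l2|l2] := leP l 2.
  apply: (@le_trans _ _ (\int[mu]_(x in eball c r) (cst (2 ^+ n * ncst)%:E x)))%E.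
    apply: ge0_le_integral => //.
    - exact: measurable_eball.
    - by move=> x _; rewrite lee_fin kern_ge0// ltW.
    - exact: measurable_funTS.
    - move=> x _; rewrite lee_fin /kern -[leRHS]mulr1 ler_pM//.
      + by rewrite mulr_ge0 ?exprn_ge0 ?(ltW l0)// ltW// ncst_gt0.
      + exact: bump_ge0.
      + apply: ler_wpM2r; first exact/ltW/ncst_gt0.
        by rewrite lerXn2r// nnegrE ltW.
      + exact: bump_le1.
  rewrite integral_cst; last exact: measurable_eball.
  rewrite /= lebE lebesgue_eball// -EFinM lee_fin /kern_cst -!mulrA ler_wpM2l ?exprn_ge0//.
  rewrite /ncst (_ : r ^- n * _ = ball_vol (R := R) (n := n) / bump_mass); first by rewrite lerDr.
  by field; rewrite !gt_eqF ?bump_mass_gt0 ?exprn_gt0.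
have l10 : 0 < l - 1 by rewrite subr_gt0 (lt_trans _ l2)// ltr1n.
apply: (@le_trans _ _ (\int[mu]_x (kern l x z)%:E))%E.
  apply: ge0_subset_integral => //; first exact: measurable_eball.
  by move=> x _; rewrite lee_fin kern_ge0// ltW.
rewrite /kern.
under eq_integral do rewrite EFinM.
rewrite ge0_integralZl//; last 3 first.
- apply/measurable_EFinP; apply: (measurableT_comp measurable_bump).
  apply: measurable_fun_rV => i; under eq_fun do rewrite !mxE.
  apply: measurable_funM => //; apply: measurable_funD => //; last first.
    by apply: measurable_funB => //; exact: measurable_rV_coord.
  apply: measurable_funM => //; apply: measurable_funB => //.
  exact: measurable_rV_coord.
- by move=> x _; rewrite lee_fin bump_ge0.
- by rewrite lee_fin mulr_ge0 ?exprn_ge0 ?(ltW l0)// ltW// ncst_gt0.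
under eq_integral => x _.
  rewrite -bumpN (_ : - (r^-1 *: (l *: (z - x) + (x - c))) =
    r^-1 *: (c - l *: z) + ((l - 1) / r) *: x); last first.
    apply/rowP => i; rewrite !mxE; field; exact: lt0r_neq0.
  over.
rewrite integral_bump_affine ?divr_gt0// -EFinM lee_fin.
have b0 := bump_mass_gt0; have ln : 0 < l ^+ n by rewrite exprn_gt0.
have rn : 0 < r ^+ n by rewrite exprn_gt0.
have l1n : 0 < (l - 1) ^+ n by rewrite exprn_gt0.
rewrite [leLHS](_ : _ = (l / (l - 1)) ^+ n); last first.
  by rewrite !expr_div_n invf_div; field; rewrite !gt_eqF.
rewrite /kern_cst -[leLHS]mulr1 ler_pM ?lerDl//.
  by rewrite exprn_ge0// divr_ge0 ?ltW.
apply: lerXn2r; rewrite ?nnegrE ?divr_ge0 ?(ltW l0) ?(ltW l10)//.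
by rewrite ler_pdivrMr//; lra.
Qed.

End kernel.

(** * The derivative of the kernel in the scale is a divergence *)

Section kernel_derivative.
Context {R : realType} {n : nat}.
Local Notation V := 'rV[R]_n.
Variables (c : V) (r : R) (x : V).
Hypothesis r0 : 0 < r.
Implicit Types (z : V) (l : R) (i : 'I_n).

Definition kdisp l z i : R := l * (z ord0 i - x ord0 i) + (x ord0 i - c ord0 i).

Definition qk l z : R := 4^-1 - r ^- 2 * \sum_(j < n) kdisp l z j ^+ 2.

Lemma kdispE l z i : kdisp l z i = (l *: (z - x) + (x - c)) ord0 i.
Proof. by rewrite !mxE. Qed.

Lemma qkE l z : qk l z = 4^-1 - enorm (r^-1 *: (l *: (z - x) + (x - c))) ^+ 2.
Proof.
rewrite enormZ exprMn real_normK ?num_real// sqr_enorm exprVn /qk.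
by under [in RHS]eq_bigr do rewrite -kdispE.
Qed.

Definition dflat1 : {poly R} := 'X^2 * (1 - 1^`()).

(** Component i of the bump times z - x, the field generating the homotheties of centre [x];
    [dpsi i] is its i-th partial derivative, so the sum of the latter is a divergence. *)
Definition psi i l z : R := flat 1 (qk l z) * (z ord0 i - x ord0 i).

Definition dpsi i l z : R := flat 1 (qk l z) +
  flat dflat1 (qk l z) * (- r ^- 2 * (2 * l * kdisp l z i)) * (z ord0 i - x ord0 i).

Lemma kernE l z : kern c r l x z = l ^+ n * ncst (n := n) r * flat 1 (qk l z).
Proof. by rewrite /kern /bump -qkE. Qed.

Lemma smooth_expr_qk l : smooth_expr (qk l).
Proof.
have sd i : smooth_expr (fun z => kdisp l z i).
  rewrite (_ : (fun z => _) = cst l * ((fun z => z ord0 i) + cst (- x ord0 i)) + cst (x ord0 i - c ord0 i)).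
    apply: smooth_add; last exact: smooth_cst.
    apply: smooth_mul; first exact: smooth_cst.
    by apply: smooth_add; [exact: smooth_coord|exact: smooth_cst].
  by apply/funext => z.
rewrite (_ : qk l = cst 4^-1 + cst (- r ^- 2) * (fun z => \sum_(j < n) kdisp l z j ^+ 2)).
  apply: smooth_add; first exact: smooth_cst.
  apply: smooth_mul; first exact: smooth_cst.
  apply: smooth_sum => i.
  rewrite (_ : (fun z => _) = (fun z => kdisp l z i) * (fun z => kdisp l z i)).
    exact: smooth_mul.
  by apply/funext => z; rewrite expr2.
by apply/funext => z; rewrite /qk -mulNr.
Qed.

Lemma smooth_expr_psi i l : smooth_expr (psi i l).
Proof.
rewrite (_ : psi i l = (flat 1 \o qk l) * ((fun z => z ord0 i) + cst (- x ord0 i))).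
  apply: smooth_mul; first by apply: smooth_flat; exact: smooth_expr_qk.
  by apply: smooth_add; [exact: smooth_coord|exact: smooth_cst].
by apply/funext.
Qed.

Lemma is_derive_qk i l z :
  is_derive z (delta_mx ord0 i) (qk l) (- r ^- 2 * (2 * l * kdisp l z i)).
Proof.
have dk j : is_derive z (delta_mx ord0 i) (fun z => kdisp l z j) (l * (j == i)%:R).
  rewrite (_ : (fun z => _) = l \*: ((fun z : V => z ord0 j) + cst (- x ord0 j)) + cst (x ord0 j - c ord0 j)); last first.
    by apply/funext.
  apply: is_derive_eq.
    apply: is_deriveD; apply: is_deriveZ; apply: is_deriveD; exact: is_derive_coord.
  by rewrite !addr0.
have ds : is_derive z (delta_mx ord0 i) (\sum_(j < n) (fun z => kdisp l z j) ^+ 2)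
    (\sum_(j < n) ((2%:R * kdisp l z j ^+ 1) *: (l * (j == i)%:R))).
  by apply: is_derive_sum => j; exact: is_deriveX.
rewrite (_ : qk l = cst 4^-1 + (- r ^- 2) \*: (\sum_(j < n) (fun z => kdisp l z j) ^+ 2)); last first.
  apply/funext => w; rewrite /qk -mulNr; congr (_ + _ * _).
  by rewrite fct_sumE; apply: eq_bigr => j _; rewrite fctE.
apply: is_derive_eq.
rewrite add0r (bigD1 i)//= big1 => [|j /negbTE ji].
  by rewrite eqxx mulr1 addr0 expr1 /GRing.scale/=; ring.
by rewrite ji mulr0 scaler0.
Qed.

Lemma partial_psi i l z : partial i (psi i l) z = dpsi i l z.
Proof.
rewrite /partial.
have D : is_derive z (delta_mx ord0 i) ((flat 1 \o qk l) * ((fun z => z ord0 i) + cst (- x ord0 i)))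
   ((flat 1 \o qk l) z *: ((i == i)%:R + 0) + ((z ord0 i - x ord0 i) *: (flat dflat1 (qk l z) * (- r ^- 2 * (2 * l * kdisp l z i))))).
  apply: is_deriveM.
    by apply: is_derive_comp1; [exact: is_derive_flat|exact: is_derive_qk].
  by apply: is_deriveD; exact: is_derive_coord.
rewrite (_ : psi i l = (flat 1 \o qk l) * ((fun z => z ord0 i) + cst (- x ord0 i))); last by apply/funext.
case: D => _ ->; rewrite eqxx addr0 [_ *: 1]mulr1 /dpsi /=; congr (_ + _).
by rewrite [LHS]mulrC.
Qed.

Lemma qk_supp P l z : flat P (qk l z) != 0 -> enorm (l *: (z - x) + (x - c)) <= r / 2.
Proof.
apply: contraNT; rewrite -ltNge => h; rewrite flat_le0// qkE subr_le0.
rewrite enormZ ger0_norm ?invr_ge0 ?(ltW r0)//.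
have : 2^-1 <= r^-1 * enorm (l *: (z - x) + (x - c)).
  by rewrite mulrC ler_pdivlMr// mulrC ltW.
by rewrite expr2; move: (_ * enorm _) => y y2; nra.
Qed.

Lemma test_psi Omega i l : 1 <= l -> eball c r x -> eball c r `<=` Omega ->
  test_function Omega (psi i l).
Proof.
move=> l1 xc BO; have l0 : 0 < l by exact: lt_le_trans l1.
split; first by apply: smooth_expr_smooth; exact: smooth_expr_psi.
(* The image under the homothety of the closed ball of radius r/2 about [c]. *)
exists [set z | enorm (z - (x - l^-1 *: (x - c))) <= r / 2 / l].
have E z : l *: (z - x) + (x - c) = l *: (z - (x - l^-1 *: (x - c))).
  by apply/rowP => j; rewrite !mxE; field; rewrite gt_eqF.
have K z : (enorm (z - (x - l^-1 *: (x - c))) <= r / 2 / l) =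
    (enorm (l *: (z - x) + (x - c)) <= r / 2).
  by rewrite E enormZ ger0_norm ?(ltW l0)// ler_pdivlMr// mulrC.
split; first exact: compact_ecball.
- by move=> z /=; rewrite K => /(scaled_supp r0 l1 xc)[/BO].
- move=> z /=; rewrite K => h; rewrite /psi.
  have [->|/qk_supp//] := eqVneq (flat 1 (qk l z)) 0; exact: mul0r.
Qed.

(** Uniform in [l] because the factor l always meets z - x, and l |z - x| is at most 2r on the
    support. *)
Lemma dpsi_bounded : exists2 C : R, 0 <= C &
  forall i l z, 1 <= l -> eball c r x -> `|dpsi i l z| <= C.
Proof.
have [C C0 hC] := @flat_bounded R dflat1.
exists (1 + C * 2) => [|i l z l1 xc]; first by lra.
have l0 : 0 < l by exact: lt_le_trans l1.
rewrite /dpsi (le_trans (ler_normD _ _))// lerD//.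
  by rewrite ger0_norm ?flat1_ge0 ?flat1_le1.
have [->|h] := eqVneq (flat dflat1 (qk l z)) 0.
  by rewrite !mul0r normr0 mulr_ge0.
have h1 := qk_supp h.
have [_ h2] := scaled_supp r0 l1 xc h1.
rewrite -mulrA normrM ler_pM//.
have -> : - r ^- 2 * (2 * l * kdisp l z i) * (z ord0 i - x ord0 i) =
   - (2 * r ^- 2 * (kdisp l z i * (l * (z ord0 i - x ord0 i)))) by ring.
rewrite normrN normrM ger0_norm ?mulr_ge0 ?invr_ge0 ?exprn_ge0 ?(ltW r0)//.
rewrite [leRHS](_ : _ = 2 * r ^- 2 * (r / 2 * (2 * r))); last by field; rewrite gt_eqF.
apply: ler_wpM2l; first by rewrite mulr_ge0 ?invr_ge0 ?exprn_ge0 ?(ltW r0).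
rewrite normrM ler_pM//.
  by rewrite kdispE (le_trans (coord_le_enorm _ _)).
rewrite normrM ger0_norm ?(ltW l0)// (le_trans _ h2)// ler_wpM2l ?(ltW l0)//.
by rewrite (le_trans _ (coord_le_enorm (z - x) i))// !mxE.
Qed.

(** The factor r of the Poincare inequality originates here, from l |z - x| <= 2r on the support. *)
Lemma dot_psi_le (g : V) l z : 1 <= l -> eball c r x ->
  `|l * \sum_(i < n) g ord0 i * psi i l z| <= 2 * r * (enorm g * flat 1 (qk l z)).
Proof.
move=> l1 xc; have l0 : 0 < l by exact: lt_le_trans l1.
have -> : l * \sum_(i < n) g ord0 i * psi i l z =
    flat 1 (qk l z) * (l * \sum_(i < n) g ord0 i * (z - x) ord0 i).
  by rewrite [RHS]mulrCA; congr (_ * _); rewrite mulr_sumr; apply: eq_bigr => i _; rewrite /psi !mxE; ring.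
have [->|h] := eqVneq (flat 1 (qk l z)) 0; first by rewrite mul0r normr0 !mulr0.
have [_ h2] := scaled_supp r0 l1 xc (qk_supp h).
rewrite normrM ger0_norm ?flat1_ge0// mulrA mulrC ler_wpM2r ?flat1_ge0//.
rewrite normrM ger0_norm ?(ltW l0)//.
apply: (@le_trans _ _ (l * (enorm g * enorm (z - x)))).
  rewrite ler_wpM2l ?(ltW l0)// ler_norml enorm_dot_le andbT lerNl.
  rewrite -sumrN -[enorm g]enormN; under eq_bigr do rewrite -mulNr.
  rewrite (eq_bigr (fun i => (- g) ord0 i * (z - x) ord0 i)) ?enorm_dot_le//.
  by move=> i _; rewrite !mxE.
by rewrite mulrCA mulrC ler_wpM2r ?enorm_ge0.
Qed.

(** Differentiating l^n produces n times the bump, which is the bump times the divergence of z - x;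
    differentiating the bump in l produces z - x times its gradient, up to 1/l. Together they form
    the divergence of [psi]. *)
Lemma is_derive_kern l z : 0 < l ->
  is_derive l 1 (fun l => kern c r l x z)
    (l^-1 * (l ^+ n * ncst (n := n) r * \sum_(i < n) dpsi i l z)).
Proof.
move=> l0.
have dk j : is_derive l 1 (fun l => kdisp l z j) (z ord0 j - x ord0 j).
  rewrite (_ : (fun l => _) = (z ord0 j - x ord0 j) \*: (id : R -> R) + cst (x ord0 j - c ord0 j)); last first.
    by apply/funext => u; rewrite /kdisp mulrC.
  apply: is_derive_eq.
  by rewrite addr0 [_ *: _]mulr1.
pose S := \sum_(j < n) ((2%:R * kdisp l z j ^+ 1) *: (z ord0 j - x ord0 j)).
have ds : is_derive l 1 (\sum_(j < n) (fun l => kdisp l z j) ^+ 2) S.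
  by apply: is_derive_sum => j; exact: is_deriveX.
have dq : is_derive l 1 (fun l => qk l z) (- r ^- 2 * S).
  rewrite (_ : (fun l => qk l z) = cst 4^-1 + (- r ^- 2) \*: (\sum_(j < n) (fun l => kdisp l z j) ^+ 2)); last first.
    apply/funext => w; rewrite /qk -mulNr; congr (_ + _ * _).
    by rewrite fct_sumE; apply: eq_bigr => j _; rewrite fctE.
  by apply: is_derive_eq; rewrite add0r.
have df : is_derive l 1 (flat 1 \o (fun l => qk l z)) (flat dflat1 (qk l z) * (- r ^- 2 * S)).
  by apply: is_derive1_comp; exact: is_derive_flat.
have dn : is_derive l 1 (fun l : R => l ^+ n) (n%:R * l ^+ n.-1).
  apply: (@DeriveDef _ _ _ l 1 (@GRing.exp R ^~ n)); first exact: exprn_derivable.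
  by rewrite exp_derive /GRing.scale/= mulr1.
rewrite (_ : (fun l => kern c r l x z) = (ncst (n := n) r \*: (fun l : R => l ^+ n)) * (flat 1 \o (fun l => qk l z))); last first.
  by apply/funext => u; rewrite kernE [u ^+ n * _]mulrC.
apply: is_derive_eq.
rewrite /dpsi big_split/= sumr_const card_ord -[flat 1 _ *+ n]mulr_natl.
have -> : \sum_(i < n) flat dflat1 (qk l z) * (- r ^- 2 * (2 * l * kdisp l z i)) *
    (z ord0 i - x ord0 i) = flat dflat1 (qk l z) * (- r ^- 2 * l * S).
  rewrite /S !mulr_sumr; apply: eq_bigr => i _; rewrite /GRing.scale/= expr1; ring.
(* For n = 0 the exponent [n.-1] is 0, hence the separate case. *)
have -> : n%:R * l ^+ n.-1 = l^-1 * (n%:R * l ^+ n).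
  case: (n) => [|m]; first by rewrite !mul0r mulr0.
  by rewrite exprS mulrCA mulKf// gt_eqF.
rewrite /GRing.scale/=; field; rewrite gt_eqF//.
by rewrite gt_eqF.
Qed.

End kernel_derivative.

Section kernel_evolution.
Context {R : realType} {n : nat}.
Local Notation V := 'rV[R]_n.
Variables (c : V) (r : R) (x : V).
Hypothesis r0 : 0 < r.
Implicit Types (z : V) (t l a : R).

(* [t `^ (-1)] agrees with [t^-1] for [t >= 0] and is measurable in [t]. *)
Definition lam t : R := t `^ (-1).

Lemma lamE t : 0 <= t -> lam t = t^-1.
Proof. by move=> t0; rewrite /lam powR_inv1. Qed.

Lemma measurable_lam : measurable_fun [set: R] lam.
Proof. exact: measurable_powR. Qed.

(** The derivative in t = 1/l. One factor l in l^(n+1) is absorbed by z - x, so the estimates below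
    involve a kernel of mass 1 for each t, and t ranges over an interval of length at most 1. *)
Definition dkern t z : R :=
  - (lam t ^+ n.+1 * ncst (n := n) r * \sum_(i < n) dpsi c r x i (lam t) z).

Lemma continuous_dpsi i z : continuous (fun l => dpsi c r x i l z).
Proof.
have ck j : continuous (fun l => kdisp c x l z j).
  rewrite /kdisp => l; apply: cvgD; last exact: cvg_cst.
  by apply: cvgM; [exact: cvg_id|exact: cvg_cst].
have cq : continuous (fun l => qk c r x l z).
  rewrite /qk => l; apply: cvgB; first exact: cvg_cst.
  apply: cvgM; first exact: cvg_cst.
  apply: continuous_sumr => j {}l.
  exact: (continuous_comp (ck j l) (@exprn_continuous R 2 _)).
have cf P : continuous (fun l => flat P (qk c r x l z)).
  by move=> l; exact: (continuous_comp (cq l) (@continuous_flat _ P _)).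
rewrite /dpsi => l; apply: cvgD; first exact: cf.
apply: cvgM; last exact: cvg_cst.
apply: cvgM; first exact: cf.
apply: cvgM; first exact: cvg_cst.
apply: cvgM; last exact: ck.
by apply: cvgM; [exact: cvg_cst|exact: cvg_id].
Qed.

Lemma is_derive_kernV t z : 0 < t ->
  is_derive t 1 (fun t => kern c r t^-1 x z) (dkern t z).
Proof.
move=> t0; have tn0 : t != 0 by rewrite gt_eqF.
have dV : is_derive t 1 (fun s : R => s^-1) (- t ^- 2).
  have := @is_deriveV _ id t 1 1 tn0 (is_derive_id t 1).
  by rewrite scaler1.
have ti0 : 0 < t^-1 by rewrite invr_gt0.
have D := @is_derive1_comp _ (fun l => kern c r l x z) (fun t => t^-1) t _ _ (is_derive_kern c x r0 z ti0) dV.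
apply: is_derive_eq D _.
rewrite /dkern lamE ?(ltW t0)// [t^-1 ^+ n.+1]exprS.
by move: (\sum_(i < n) _) (t^-1 ^+ n) => S p; field.
Qed.

Lemma continuous_dkern t z : 0 < t -> {for t, continuous (fun t => dkern t z)}.
Proof.
move=> t0; have tn0 : t != 0 by rewrite gt_eqF.
pose h t := - (t^-1 ^+ n.+1 * ncst (n := n) r * \sum_(i < n) dpsi c r x i t^-1 z).
have E : \forall s \near t, h s = dkern s z.
  near=> s; rewrite /h /dkern lamE//; apply: ltW; near: s; exact: lt_nbhsr.
have ch : {for t, continuous h}.
  have ci : {for t, continuous (fun t : R => t^-1)} by exact: inv_continuous.
  have cl (F : R -> R) : continuous F -> {for t, continuous (fun t => F t^-1)}.
    by move=> cF; exact: (continuous_comp ci (cF _)).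
  apply: continuousN; apply: continuousM.
    apply: continuousM; last exact: cst_continuous.
    apply: (cl (fun l => l ^+ n.+1)); exact: exprn_continuous.
  apply: (cl (fun l => \sum_(i < n) dpsi c r x i l z)).
  by apply: continuous_sumr => i; exact: continuous_dpsi.
rewrite /prop_for /continuous_at -(nbhs_singleton E).
by apply: cvg_trans ch; apply: near_eq_cvg.
Unshelve. all: by end_near. Qed.

Lemma integral_dkern a z : 0 < a < 1 ->
  (\int[lebesgue_measure]_(t in `[a, 1%R]) (dkern t z)%:E =
   (kern c r 1 x z - kern c r a^-1 x z)%:E)%E.
Proof.
move=> /andP[a0 a1].
have C t : 0 < t -> {for t, continuous (fun t => kern c r t^-1 x z)}.
  move=> t0; apply: differentiable_continuous; apply/derivable1_diffP.
  by have [] := is_derive_kernV z t0.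
have H1 : {within `[a, 1], continuous (fun t => dkern t z)}.
  apply: continuous_in_subspaceT => t; rewrite inE/= in_itv/= => /andP[t0 _].
  by apply: continuous_dkern; exact: lt_le_trans t0.
have H2 : derivable_oo_LRcontinuous (fun t => kern c r t^-1 x z) a 1.
  split.
  - move=> t; rewrite in_itv/= => /andP[t0 _].
    by have [] := is_derive_kernV z (lt_trans a0 t0).
  - exact: cvg_at_right_filter (C _ a0).
  - exact: cvg_at_left_filter (C _ ltr01).
have H3 : {in `]a, 1[, (fun t => kern c r t^-1 x z)^`()%classic =1 (fun t => dkern t z)}.
  move=> t; rewrite in_itv/= => /andP[t0 _].
  by have [_] := is_derive_kernV z (lt_trans a0 t0); rewrite derive1E.
by have := continuous_FTC2 a1 H1 H2 H3; rewrite invr1 -EFinB.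
Qed.

Lemma measurable_dpsi d (T : measurableType d) (fl : T -> R) (fz : T -> V) i :
  measurable_fun [set: T] fl -> measurable_fun [set: T] fz ->
  measurable_fun [set: T] (fun w => dpsi c r x i (fl w) (fz w)).
Proof.
move=> ml mz.
have mc j : measurable_fun [set: T] (fun w => fz w ord0 j).
  by apply: (measurableT_comp (measurable_rV_coord j)).
have mk j : measurable_fun [set: T] (fun w => kdisp c x (fl w) (fz w) j).
  apply: measurable_funD => //; apply: measurable_funM => //; exact: measurable_funB.
have mf P : measurable_fun [set: T] (fun w => flat P (qk c r x (fl w) (fz w))).
  apply: (measurableT_comp (continuous_measurable_fun (@continuous_flat R P))).
  apply: measurable_funB => //; apply: measurable_funM => //.
  by apply: measurable_sum => j; exact: measurable_funX.
apply: measurable_funD => //; apply: measurable_funM; last exact: measurable_funB.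
apply: measurable_funM => //; apply: measurable_funM => //.
by apply: measurable_funM => //; exact: measurable_funM.
Qed.

Lemma measurable_dkern d (T : measurableType d) (ft : T -> R) (fz : T -> V) :
  measurable_fun [set: T] ft -> measurable_fun [set: T] fz ->
  measurable_fun [set: T] (fun w => dkern (ft w) (fz w)).
Proof.
move=> mt mz; have ml : measurable_fun [set: T] (fun w => lam (ft w)).
  exact: (measurableT_comp measurable_lam).
apply: measurable_funN; apply: measurable_funM.
  by apply: measurable_funM => //; exact: measurable_funX.
by apply: measurable_sum => i; exact: measurable_dpsi.
Qed.

Lemma dkern_bounded a : 0 < a -> eball c r x -> exists2 C : R, 0 <= C &
  forall t z, a <= t <= 1 -> `|dkern t z| <= C.
Proof.
move=> a0 xc; have [C C0 hC] := @dpsi_bounded _ _ c r x r0.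
have N0 := ncst_gt0 (n := n) r0.
exists (a^-1 ^+ n.+1 * ncst (n := n) r * (n%:R * C)).
  apply: mulr_ge0; last exact: mulr_ge0.
  apply: mulr_ge0; last exact: ltW.
  by rewrite exprn_ge0// invr_ge0 ltW.
move=> t z /andP[at1 t1]; have t0 : 0 < t by exact: lt_le_trans at1.
rewrite /dkern normrN lamE ?(ltW t0)// normrM.
rewrite ler_pM//.
  rewrite normrM [`|ncst r|]ger0_norm ?(ltW N0)//; apply: ler_wpM2r; first exact: ltW.
  by rewrite ger0_norm ?exprn_ge0 ?invr_ge0 ?(ltW t0)// lerXn2r ?nnegrE ?invr_ge0 ?(ltW t0) ?(ltW a0)// lef_pV2.
rewrite (le_trans (ler_norm_sum _ _ _))// mulr_natl -[in leRHS](card_ord n) -sumr_const.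
apply: ler_sum => i _; apply: hC => //.
by rewrite invf_ge1.
Qed.

End kernel_evolution.

Lemma integrable_bddM d (T : measurableType d) (R : realType)
    (m : {measure set T -> \bar R}) (f b : T -> R) (C : R) :
  m.-integrable setT (fun z => (f z)%:E) -> measurable_fun setT b ->
  (forall z, `|b z| <= C) -> m.-integrable setT (fun z => (f z * b z)%:E).
Proof.
move=> fi mb bC.
have := @integrableMl _ _ _ m _ measurableT (EFin \o f) b fi mb.
apply; exists C; split; first exact: num_real.
by move=> M CM z _ /=; rewrite (le_trans (bC z))// ltW.
Qed.

(** * Comparing averages of f at two scales through the weak gradient *)

Section weak_estimate.
Context {R : realType} {n : nat}.
Local Notation V := 'rV[R]_n.
Local Notation mu := (@leb R n).
Variables (c : V) (r : R) (x : V) (Omega : set V) (f : V -> R) (g : V -> V).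
Hypothesis r0 : 0 < r.
Hypothesis xc : eball c r x.
Hypothesis BO : eball c r `<=` Omega.
Hypothesis fi : mu.-integrable setT (fun z => (f z)%:E).
Hypothesis gi : forall i, mu.-integrable setT (fun z => (g z ord0 i)%:E).
Hypothesis weak : forall i phi, test_function Omega phi ->
  (\int[mu]_z (f z * partial i phi z)%:E = - \int[mu]_z (g z ord0 i * phi z)%:E)%E.

Let mf : measurable_fun setT f.
Proof. by apply/measurable_EFinP; exact: measurable_int fi. Qed.

Let mg i : measurable_fun setT (fun z => g z ord0 i).
Proof. by apply/measurable_EFinP; exact: measurable_int (gi i). Qed.

Let mgv : measurable_fun setT (fun z => enorm (g z)).
Proof.
apply: (measurableT_comp measurable_enorm); exact: measurable_fun_rV.
Qed.

(** [dkern] is a multiple of the divergence of the test functions [psi], so the definition of the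
    weak gradient replaces f by g, and [dot_psi_le] bounds the integrand. *)
Lemma integral_dkern_weak (t : R) : 0 < t <= 1 ->
  (`|\int[mu]_z (f z * dkern c r x t z)%:E| <=
   (2 * r)%:E * \int[mu]_z (enorm (g z) * kern c r (lam t) x z)%:E)%E.
Proof.
move=> /andP[t0 t1]; set l := lam t.
have l1 : 1 <= l by rewrite /l lamE ?(ltW t0)// invf_ge1.
have l0 : 0 < l by exact: lt_le_trans l1.
pose K := l ^+ n.+1 * ncst (n := n) r.
have mpsi i : measurable_fun setT (psi c r x i l).
  by apply: smooth_expr_measurable; exact: smooth_expr_psi.
have [C C0 hC] := @dpsi_bounded _ _ c r x r0.
have fdi i : mu.-integrable setT (fun z => (f z * dpsi c r x i l z)%:E).
  by apply: integrable_bddM => //; [exact: measurable_dpsi|move=> z; exact: hC].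
have gpi i : mu.-integrable setT (fun z => (g z ord0 i * psi c r x i l z)%:E).
  apply: (@integrable_bddM _ _ _ _ (fun z => g z ord0 i) _ (2 * r) (gi i)) => // z.
  rewrite /psi.
  have [->|h] := eqVneq (flat 1 (qk c r x l z)) 0; first by rewrite mul0r normr0 mulr_ge0// ltW.
  have [_ h2] := scaled_supp r0 l1 xc (qk_supp r0 h).
  rewrite normrM -[leRHS]mul1r ler_pM//; first by rewrite ger0_norm ?flat1_ge0 ?flat1_le1.
  rewrite (le_trans _ h2)// -[leLHS]mul1r ler_pM//.
  by rewrite (le_trans _ (coord_le_enorm (z - x) i))// !mxE.
have fdK i : mu.-integrable setT (fun z => (- K * (f z * dpsi c r x i l z))%:E).
  under eq_fun do rewrite EFinM; exact: integrableZl.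
have gpK i : mu.-integrable setT (fun z => (K * (g z ord0 i * psi c r x i l z))%:E).
  under eq_fun do rewrite EFinM; exact: integrableZl.
have -> : (\int[mu]_z (f z * dkern c r x t z)%:E =
    \int[mu]_z (\sum_(i < n) (K * (g z ord0 i * psi c r x i l z))%:E))%E.
  transitivity (\int[mu]_z (\sum_(i < n) ((- K * (f z * dpsi c r x i l z))%:E)))%E.
    apply: eq_integral => z _; rewrite sumEFin; congr (_%:E).
    rewrite /dkern -/l -/K -mulNr mulrCA mulr_sumr mulr_sumr.
    by apply: eq_bigr => i _.
  rewrite !integral_sum//; apply: eq_bigr => i _.
  under eq_integral do rewrite EFinM.
  rewrite integralZl//.
  under eq_integral do rewrite -partial_psi.
  rewrite weak; last exact: test_psi.
  under [RHS]eq_integral do rewrite EFinM.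
  by rewrite integralZl// EFinN mulNe muleN oppeK.
have mS : measurable_fun setT (fun z => \sum_(i < n) (K * (g z ord0 i * psi c r x i l z))%:E)%E.
  under eq_fun do rewrite sumEFin.
  apply/measurable_EFinP; apply: measurable_sum => i.
  by apply: measurable_funM => //; exact: measurable_funM.
have mk : measurable_fun setT (fun z => kern c r l x z) by exact: measurable_kern.
apply: (le_trans (le_abse_integral mu measurableT mS)).
rewrite -ge0_integralZl//; last 3 first.
- by apply/measurable_EFinP; exact: measurable_funM.
- by move=> z _; rewrite lee_fin mulr_ge0 ?enorm_ge0// kern_ge0// ltW.
- by rewrite lee_fin mulr_ge0// ltW.
apply: ge0_le_integral => //.
- exact: measurableT_comp.
- apply: emeasurable_funM => //; apply/measurable_EFinP; exact: measurable_funM.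
move=> z _; rewrite sumEFin -EFinM abse_EFin lee_fin.
rewrite -mulr_sumr kernE /K exprS.
have -> : l * l ^+ n * ncst (n := n) r * (\sum_(i < n) g z ord0 i * psi c r x i l z) =
  l ^+ n * ncst (n := n) r * (l * \sum_(i < n) g z ord0 i * psi c r x i l z) by ring.
have N0 := ncst_gt0 (n := n) r0.
rewrite normrM ger0_norm; last first.
  by apply: mulr_ge0; [rewrite exprn_ge0// ltW|exact: ltW].
rewrite [leRHS](_ : _ = l ^+ n * ncst (n := n) r * (2 * r * (enorm (g z) * flat 1 (qk c r x l z)))); last first.
  by move: (ncst _) (flat _ _) => N F; ring.
apply: ler_wpM2l; last exact: dot_psi_le.
by apply: mulr_ge0; [rewrite exprn_ge0// ltW|exact: ltW].
Qed.

(** The fundamental theorem of calculus in t, Fubini, and the bound for each t. The cut-off a > 0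
    keeps [dkern] bounded. *)
Lemma kernel_average_diff (a : R) : 0 < a < 1 ->
  (`|\int[mu]_z (f z * (kern c r 1 x z - kern c r a^-1 x z))%:E| <=
   (2 * r)%:E * \int[lebesgue_measure]_(t in `[a, 1%R])
     \int[mu]_z (enorm (g z) * kern c r (lam t) x z)%:E)%E.
Proof.
move=> a01; have /andP[a0 a1] := a01.
have [C C0 hC] := @dkern_bounded _ _ c r x r0 a a0 xc.
pose I := `[a, 1%R]%classic : set R.
have mI : measurable I by exact: measurable_itv.
pose F (tz : R * V) : \bar R := (f tz.2 * (\1_I tz.1 * dkern c r x tz.1 tz.2))%:E.
have mF : measurable_fun [set: R * V] F.
  apply/measurable_EFinP; apply: measurable_funM.
    exact: (measurableT_comp mf measurable_snd).
  apply: measurable_funM.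
    have m1I : measurable_fun [set: R] (\1_I : R -> R) by exact: measurable_indic.
    exact: (measurableT_comp m1I measurable_fst).
  exact: measurable_dkern.
have bF t z : (`|F (t, z)| <= (C * \1_I t)%:E * `|(f z)%:E|)%E.
  rewrite /F/= lee_fin normrM mulrC ler_wpM2r// indicE.
  case: (boolP (t \in I)) => [|_]; last by rewrite mul0r normr0 mulr0.
  by rewrite inE /I/= in_itv/= => tI; rewrite mul1r mulr1 hC.
(* Integrability on the product: the integrand is dominated by C |f| on [a, 1] and vanishes for
   other t. *)
have iF : ((lebesgue_measure \x mu)%E).-integrable setT F.
  apply/integrable12ltyP => //.
  set M := (\int[mu]_z `|(f z)%:E|)%E.
  have Moo : (M < +oo)%E by have /integrableP[] := fi.
  have M0 : (0 <= M)%E by exact: integral_ge0.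
  apply: (@le_lt_trans _ _ (\int[lebesgue_measure]_t ((C * \1_I t)%:E * M))%E).
    apply: ge0_le_integral => //.
    - by move=> t _; exact: integral_ge0.
    - by apply: (measurable_fun_fubini_tonelli_F (abse \o F)) => //=; exact: measurableT_comp.
    - apply: emeasurable_funM => //; apply/measurable_EFinP; exact: measurable_funM.
    - move=> t _; rewrite /M -ge0_integralZl//.
      + apply: ge0_le_integral => //.
        * apply: measurableT_comp => //; apply: (measurableT_comp mF); exact: pair1_measurable.
        * by apply: emeasurable_funM => //; apply: measurableT_comp => //; exact/measurable_EFinP.
      + by apply: measurableT_comp => //; exact/measurable_EFinP.
      + by rewrite lee_fin mulr_ge0.
  under eq_integral do rewrite EFinM -muleA [((\1_I _)%:E * M)%E]muleC muleA.
  rewrite ge0_integralZl//; last 2 first.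
  - by apply/measurable_EFinP; exact: measurable_indic.
  - by rewrite mule_ge0.
  rewrite integral_indic// setIT /=.
  have -> : lebesgue_measure I = (1 - a)%:E.
    by rewrite /I lebesgue_measure_itv/= lte_fin a1 -EFinB.
  rewrite lte_mul_pinfty ?mule_ge0// ?fin_numM//; last exact: ltry.
  by rewrite ge0_fin_numE.
have -> : (\int[mu]_z (f z * (kern c r 1 x z - kern c r a^-1 x z))%:E =
    \int[mu]_z \int[lebesgue_measure]_t F (t, z))%E.
  apply: eq_integral => z _; rewrite EFinM -(integral_dkern c x r0 z a01).
  have mdz : measurable_fun setT (fun t => dkern c r x t z) by exact: measurable_dkern.
  have idz : lebesgue_measure.-integrable `[a, 1]%classic (EFin \o (fun t => dkern c r x t z)).
    apply: measurable_bounded_integrable => //.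
    - by rewrite /= lebesgue_measure_itv/= lte_fin a1 -EFinB ltry.
    - exact: measurable_funTS.
    - exists C; split; first exact: num_real.
      by move=> N CN t /=; rewrite in_itv/= => tI; rewrite (le_trans (hC _ _ tI))// ltW.
  rewrite -integralZl//.
  rewrite integral_mkcond; apply: eq_integral => t _.
  rewrite patchE /F/= indicE; case: ifP => tI; first by rewrite -EFinM mul1r.
  by rewrite mul0r mulr0.
rewrite -Fubini//.
have mH := measurable_fubini_F iF.
apply: (le_trans (le_abse_integral _ measurableT mH)).
have mG : measurable_fun setT (fun t => \int[mu]_z (enorm (g z) * kern c r (lam t) x z)%:E)%E.
  apply: (measurable_fun_fubini_tonelli_F (fun tz : R * V => (enorm (g tz.2) * kern c r (lam tz.1) x tz.2)%:E)).
    apply/measurable_EFinP; apply: measurable_funM.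
      exact: (measurableT_comp mgv measurable_snd).
    apply: measurable_kern => //.
    exact: (measurableT_comp measurable_lam measurable_fst).
  by move=> tz; rewrite lee_fin mulr_ge0 ?enorm_ge0// kern_ge0// powR_ge0.
have G0 t : (0 <= \int[mu]_z (enorm (g z) * kern c r (lam t) x z)%:E)%E.
  by apply: integral_ge0 => z _; rewrite lee_fin mulr_ge0 ?enorm_ge0// kern_ge0// powR_ge0.
rewrite -ge0_integralZl//; last 2 first.
- exact: measurable_funTS.
- by rewrite lee_fin mulr_ge0// ltW.
rewrite [leRHS]integral_mkcond; apply: ge0_le_integral => //.
- exact: measurableT_comp.
- apply/(measurable_restrictT _ _).1 => //; apply: measurable_funTS.
  exact: emeasurable_funM.
move=> t _; rewrite patchE /fubini_F; case: ifP => tI.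
  under eq_integral do rewrite /F/= indicE tI mul1r.
  move: tI; rewrite inE/= in_itv/= => /andP[at1 t1].
  by apply: integral_dkern_weak; rewrite t1 (lt_le_trans a0).
under eq_integral do rewrite /F/= indicE tI mul0r mulr0.
by rewrite integral0 abse0.
Qed.

End weak_estimate.

Lemma integral_indicM d (T : measurableType d) (R : realType)
    (m : {measure set T -> \bar R}) (D : set T) (h : T -> R) :
  (\int[m]_(z in D) (h z)%:E = \int[m]_z (\1_D z * h z)%:E)%E.
Proof.
rewrite integral_mkcond; apply: eq_integral => z _.
by rewrite patchE indicE; case: ifPn => zD; rewrite ?mul1r ?mul0r.
Qed.

(** * Mean oscillation against the kernel *)

Section kernel_approximation.
Context {R : realType} {n : nat}.
Local Notation V := 'rV[R]_n.
Local Notation mu := (@leb R n).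
Variables (c : V) (r : R).
Hypothesis r0 : 0 < r.
Local Notation B := (eball c r).
Local Notation CK := (kern_cst (R := R) (n := n)).
Implicit Types (f g : V -> R) (a l : R).

Let mB : measurable B := measurable_eball c r.

Lemma kern_cst_ge0 : 0 <= CK.
Proof.
rewrite mulr_ge0 ?exprn_ge0// addr_ge0// divr_ge0// ltW//.
  exact: ball_vol_gt0.
exact: bump_mass_gt0.
Qed.

Lemma measurable_kern_pair l : measurable_fun [set: V * V] (fun w => kern c r l w.1 w.2).
Proof. exact: measurable_kern. Qed.

Lemma measurable_integral_kern (u : V * V -> R) l : 0 <= l ->
  measurable_fun setT u -> (forall w, 0 <= u w) ->
  measurable_fun setT (fun x => \int[mu]_z (u (x, z) * kern c r l x z)%:E)%E.
Proof.
move=> l0 mu0 u0.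
apply: (measurable_fun_fubini_tonelli_F (fun w : V * V => (u w * kern c r l w.1 w.2)%:E)).
  by apply/measurable_EFinP/measurable_funM => //; exact: measurable_kern_pair.
by move=> w; rewrite lee_fin mulr_ge0// kern_ge0.
Qed.

(** Tonelli, then the mass of the kernel in its centre variable. For x in the ball the kernel lives
    in the ball, so only the values of [f] there count. *)
Lemma integral_kern_avg_le f l : 1 <= l -> measurable_fun setT f -> (forall z, 0 <= f z) ->
  (\int[mu]_(x in B) \int[mu]_z (f z * kern c r l x z)%:E <=
   CK%:E * \int[mu]_(z in B) (f z)%:E)%E.
Proof.
move=> l1 mf f0; have l0 : 0 <= l by exact: le_trans l1.
have m1B : measurable_fun [set: V] (\1_B : V -> R) by exact: measurable_indic.
have mfB : measurable_fun [set: V] (fun z => \1_B z * f z) by exact: measurable_funM.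
pose K (w : V * V) : \bar R := (\1_B w.1 * (\1_B w.2 * f w.2) * kern c r l w.1 w.2)%:E.
have K0 w : (0 <= K w)%E by rewrite lee_fin mulr_ge0 ?kern_ge0// mulr_ge0// mulr_ge0.
have mK : measurable_fun setT K.
  apply/measurable_EFinP/measurable_funM; last exact: measurable_kern_pair.
  apply: measurable_funM; first exact: (measurableT_comp m1B measurable_fst).
  exact: (measurableT_comp mfB measurable_snd).
have -> : (\int[mu]_(x in B) \int[mu]_z (f z * kern c r l x z)%:E =
    \int[mu]_x \int[mu]_z K (x, z))%E.
  rewrite integral_mkcond; apply: eq_integral => x _.
  rewrite patchE; case: ifPn => xB.
    apply: eq_integral => z _; rewrite /K/= !indicE xB mul1r.
    have [->|k0] := eqVneq (kern c r l x z) 0; first by rewrite !mulr0.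
    have [zB _] := kern_supp r0 l1 (set_mem xB) k0.
    by rewrite (mem_set zB) mul1r.
  rewrite [LHS](_ : _ = 0%E)//.
  by under eq_integral do rewrite /K/= indicE (negbTE xB) !mul0r; rewrite integral0.
rewrite (fubini_tonelli K)//.
rewrite [in leRHS]integral_indicM -ge0_integralZl//; last 3 first.
- exact/measurable_EFinP.
- by move=> z _; rewrite lee_fin mulr_ge0.
- by rewrite lee_fin kern_cst_ge0.
apply: ge0_le_integral => //.
- by move=> z _; exact: integral_ge0.
- exact: (measurable_fun_fubini_tonelli_G K).
- by apply: emeasurable_funM => //; exact/measurable_EFinP.
move=> z _.
rewrite muleC.
under eq_integral => x _.
  rewrite /K/= mulrAC mulrC EFinM; over.
rewrite (ge0_integralZl mu measurableT); last 3 first.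
- apply/measurable_EFinP/measurable_funM => //; exact: measurable_kern.
- by move=> x _; rewrite lee_fin mulr_ge0// kern_ge0.
- by rewrite lee_fin mulr_ge0.
apply: lee_wpmul2l; first by rewrite lee_fin mulr_ge0.
rewrite (le_trans _ (@integral_kern1 _ _ c r r0 l z l1))//.
by rewrite [leRHS]integral_indicM.
Qed.

Definition osc f a : \bar R :=
  (\int[mu]_(x in B) \int[mu]_z (`|f x - f z| * kern c r a^-1 x z)%:E)%E.

(** Convergence of the kernel averages to [f] in the mean over the ball, which takes the place of
    Lebesgue differentiation. *)
Definition smoothable f := measurable_fun setT f /\
  forall e : R, 0 < e -> exists2 a0 : R, 0 < a0 < 1 &
    forall a, 0 < a <= a0 -> (osc f a <= e%:E)%E.

Let mdiff f : measurable_fun setT f ->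
  measurable_fun [set: V * V] (fun w => `|f w.1 - f w.2|).
Proof.
move=> mf; apply: measurableT_comp => //; apply: measurable_funB.
  exact: (measurableT_comp mf measurable_fst).
exact: (measurableT_comp mf measurable_snd).
Qed.

Let mosc f l : 0 <= l -> measurable_fun setT f ->
  measurable_fun setT (fun x => \int[mu]_z (`|f x - f z| * kern c r l x z)%:E)%E.
Proof.
by move=> l0 mf; apply: (@measurable_integral_kern (fun w => `|f w.1 - f w.2|)) => //; exact: mdiff.
Qed.

Let oscx_ge0 f l x : 0 <= l -> (0 <= \int[mu]_z (`|f x - f z| * kern c r l x z)%:E)%E.
Proof. by move=> l0; apply: integral_ge0 => z _; rewrite lee_fin mulr_ge0// kern_ge0. Qed.

Let mfk f l x : measurable_fun setT f ->
  measurable_fun setT (fun z => (`|f x - f z| * kern c r l x z)%:E).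
Proof.
move=> mf; apply/measurable_EFinP/measurable_funM; last exact: measurable_kern.
by apply: measurableT_comp => //; exact: measurable_funB.
Qed.

Lemma osc_le (F f g : V -> R) (C : R) a : 0 < a -> 0 <= C ->
  measurable_fun setT F -> measurable_fun setT f -> measurable_fun setT g ->
  (forall x z, `|F x - F z| <= C * (`|f x - f z| + `|g x - g z|)) ->
  (osc F a <= C%:E * (osc f a + osc g a))%E.
Proof.
move=> a0 C0 mF mf mg h; have ai0 : 0 <= a^-1 by rewrite invr_ge0 ltW.
rewrite /osc -ge0_integralD//; last 4 first.
- by move=> x _; exact: oscx_ge0.
- by apply: measurable_funTS; exact: mosc.
- by move=> x _; exact: oscx_ge0.
- by apply: measurable_funTS; exact: mosc.
rewrite -ge0_integralZl//; last 2 first.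
- by apply: measurable_funTS; apply: emeasurable_funD; exact: mosc.
- by move=> x _; rewrite adde_ge0// oscx_ge0.
apply: ge0_le_integral => //.
- by move=> x _; exact: oscx_ge0.
- by apply: measurable_funTS; exact: mosc.
- apply: emeasurable_funM => //.
  by apply: measurable_funTS; apply: emeasurable_funD; exact: mosc.
move=> x _.
rewrite -ge0_integralD//; last 4 first.
- by move=> z _; rewrite lee_fin mulr_ge0// kern_ge0.
- exact: mfk.
- by move=> z _; rewrite lee_fin mulr_ge0// kern_ge0.
- exact: mfk.
rewrite -ge0_integralZl//; last 2 first.
- by apply: emeasurable_funD; exact: mfk.
- by move=> z _; rewrite adde_ge0// lee_fin mulr_ge0// kern_ge0.
apply: ge0_le_integral => //.
- by move=> z _; rewrite lee_fin mulr_ge0// kern_ge0.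
- exact: mfk.
- by apply: emeasurable_funM => //; apply: emeasurable_funD; exact: mfk.
by move=> z _; rewrite -EFinD -EFinM lee_fin -mulrDl mulrA ler_wpM2r// kern_ge0.
Qed.

(** A single closure rule: complements, unions and linear combinations all satisfy such a bound on
    increments. *)
Lemma smoothable_le (F f g : V -> R) (C : R) : 0 <= C -> measurable_fun setT F ->
  smoothable f -> smoothable g ->
  (forall x z, `|F x - F z| <= C * (`|f x - f z| + `|g x - g z|)) -> smoothable F.
Proof.
move=> C0 mF [mf sf] [mg sg] h; split; [exact: mF|move=> e e0].
have e1 : 0 < e / (C + 1) / 2 by rewrite !divr_gt0// ltr_wpDl.
have [a1 /andP[a10 a11] h1] := sf _ e1; have [a2 /andP[a20 a21] h2] := sg _ e1.
exists (Num.min a1 a2); first by rewrite lt_min a10 a20 gt_min a11.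
move=> a /andP[a0]; rewrite le_min => /andP[aa1 aa2].
apply: (le_trans (osc_le a0 C0 mF mf mg h)).
apply: (@le_trans _ _ (C%:E * ((e / (C + 1) / 2)%:E + (e / (C + 1) / 2)%:E))%E).
  apply: lee_wpmul2l; first by rewrite lee_fin.
  by apply: leeD; [apply: h1|apply: h2]; rewrite a0.
rewrite -EFinD -EFinM lee_fin -splitr mulrA ler_pdivrMr ?ltr_wpDl//.
by rewrite mulrC ler_wpM2l ?(ltW e0)// lerDl.
Qed.

Lemma smoothable_cst (k : R) : smoothable (cst k).
Proof.
split=> // e e0; exists 2^-1 => [|a _]; first by rewrite invr_gt0 ltr0n invf_lt1// ltr1n.
rewrite /osc; under eq_integral do under eq_integral do rewrite subrr normr0 mul0r.
under eq_integral do rewrite integral0.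
by rewrite integral0 lee_fin ltW.
Qed.

(** Compare [F] with [f] at both points. The error at x is integrated against mass 1 in z, which
    gives 1; the error at z costs [kern_cst]. *)
Lemma osc_approx (F f : V -> R) a : 0 < a <= 1 ->
  measurable_fun setT F -> measurable_fun setT f ->
  (osc F a <= osc f a + (1 + CK)%:E * \int[mu]_(x in B) (`|F x - f x|)%:E)%E.
Proof.
move=> /andP[a0 a1] mF mf; have ai0 : 0 < a^-1 by rewrite invr_gt0.
have ai1 : 1 <= a^-1 by rewrite invf_ge1.
have md : measurable_fun setT (fun x => `|F x - f x|).
  by apply: measurableT_comp => //; exact: measurable_funB.
have mdE : measurable_fun setT (fun x => (`|F x - f x|)%:E) by exact/measurable_EFinP.
have mdk x : measurable_fun setT (fun z => (`|F z - f z| * kern c r a^-1 x z)%:E).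
  by apply/measurable_EFinP/measurable_funM => //; exact: measurable_kern.
have mDk : measurable_fun setT (fun x => \int[mu]_z (`|F z - f z| * kern c r a^-1 x z)%:E)%E.
  apply: (@measurable_integral_kern (fun w => `|F w.2 - f w.2|)) => //; first exact: ltW.
  exact: (measurableT_comp md measurable_snd).
have Dk0 x : (0 <= \int[mu]_z (`|F z - f z| * kern c r a^-1 x z)%:E)%E.
  by apply: integral_ge0 => z _; rewrite lee_fin mulr_ge0// kern_ge0// ltW.
apply: (@le_trans _ _ (\int[mu]_(x in B) (\int[mu]_z (`|f x - f z| * kern c r a^-1 x z)%:E
   + ((`|F x - f x|)%:E + \int[mu]_z (`|F z - f z| * kern c r a^-1 x z)%:E)))%E).
  apply: ge0_le_integral => //.
  - by move=> x _; apply: oscx_ge0; exact: ltW.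
  - by apply: measurable_funTS; apply: mosc => //; exact: ltW.
  - apply: measurable_funTS; apply: emeasurable_funD; first by apply: mosc => //; exact: ltW.
    exact: emeasurable_funD.
  move=> x _.
  have -> : (`|F x - f x|)%:E = (\int[mu]_z (`|F x - f x| * kern c r a^-1 x z)%:E)%E.
    under eq_integral do rewrite EFinM.
    rewrite ge0_integralZl//; last 2 first.
    - by apply/measurable_EFinP; exact: measurable_kern.
    - by move=> z _; rewrite lee_fin kern_ge0// ltW.
    by rewrite integral_kern// mule1.
  rewrite -ge0_integralD//; last 3 first.
  - by move=> z _; rewrite lee_fin mulr_ge0// kern_ge0// ltW.
  - by apply/measurable_EFinP/measurable_funM => //; exact: measurable_kern.
  - by move=> z _; rewrite lee_fin mulr_ge0// kern_ge0// ltW.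
  rewrite -ge0_integralD//; last 4 first.
  - by move=> z _; rewrite lee_fin mulr_ge0// kern_ge0// ltW.
  - exact: mfk.
  - by move=> z _; rewrite adde_ge0// lee_fin mulr_ge0// kern_ge0// ltW.
  - apply: emeasurable_funD; last exact: mdk.
    by apply/measurable_EFinP/measurable_funM => //; exact: measurable_kern.
  apply: ge0_le_integral => //.
  - by move=> z _; rewrite lee_fin mulr_ge0// kern_ge0// ltW.
  - exact: mfk.
  - apply: emeasurable_funD; first exact: mfk.
    apply: emeasurable_funD; last exact: mdk.
    by apply/measurable_EFinP/measurable_funM => //; exact: measurable_kern.
  move=> z _; rewrite -!EFinD lee_fin -!mulrDl ler_wpM2r ?kern_ge0 ?(ltW ai0)//.
  have -> : F x - F z = (f x - f z) + ((F x - f x) - (F z - f z)) by ring.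
  by rewrite (le_trans (ler_normD _ _))// lerD2l (le_trans (ler_normD _ _))// normrN.
rewrite ge0_integralD//; last 4 first.
- by move=> x _; apply: oscx_ge0; exact: ltW.
- by apply: measurable_funTS; apply: mosc => //; exact: ltW.
- by move=> x _; rewrite adde_ge0.
- by apply: measurable_funTS; exact: emeasurable_funD.
apply: leeD => //.
rewrite ge0_integralD//; last 2 first.
- exact: measurable_funTS.
- exact: measurable_funTS.
rewrite EFinD ge0_muleDl ?lee_fin ?kern_cst_ge0// mul1e; apply: leeD => //.
exact: integral_kern_avg_le.
Qed.

Lemma smoothable_approx (F : V -> R) : measurable_fun setT F ->
  (forall e : R, 0 < e -> exists2 f, smoothable f &
    (\int[mu]_(x in B) (`|F x - f x|)%:E <= e%:E)%E) -> smoothable F.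
Proof.
move=> mF h; split; [exact: mF|move=> e e0].
have D0 : 0 < 1 + CK by rewrite ltr_pwDl// kern_cst_ge0.
have e1 : 0 < e / 2 / (1 + CK) by rewrite !divr_gt0.
have [f [mf sf] Ff] := h _ e1.
have e2 : 0 < e / 2 by rewrite divr_gt0.
have [a0 /andP[a00 a01] ha] := sf _ e2.
exists a0; first by rewrite a00.
move=> a /[dup] aa /andP[a1 a2].
apply: (@le_trans _ _ ((e / 2)%:E + (1 + CK)%:E * (e / 2 / (1 + CK))%:E)%E).
  apply: (@le_trans _ _ (osc f a + (1 + CK)%:E * \int[mu]_(x in B) (`|F x - f x|)%:E)%E).
    by apply: osc_approx => //; rewrite a1 (le_trans a2)// ltW.
  by apply: leeD; [exact: ha|apply: lee_wpmul2l => //; rewrite lee_fin ltW].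
by rewrite -EFinM -EFinD lee_fin [X in _ + X]mulrC divfK ?gt_eqF// -splitr.
Qed.

End kernel_approximation.

Lemma cvge0_exists_le (R : realType) (u : (\bar R)^nat) (e : R) :
  u @ \oo --> (0 : \bar R)%E -> 0 < e -> exists N, (u N <= e%:E)%E.
Proof.
move=> u0 e0; apply: contrapT => /forallNP h.
have : (e%:E <= 0)%E.
  apply: (cvge_to_ge u0); apply: nearW => N.
  by rewrite leNgt; apply/negP => /ltW; exact: h.
by rewrite lee_fin leNgt e0.
Qed.

(** * Vanishing oscillation of integrable functions *)

Section smoothable_integrable.
Context {R : realType} {n : nat}.
Local Notation V := 'rV[R]_n.
Local Notation mu := (@leb R n).
Variables (c : V) (r : R).
Hypothesis r0 : 0 < r.
Local Notation B := (eball c r).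
Local Notation smoothable := (smoothable c r).

Let mB : measurable B := measurable_eball c r.

(** The kernel couples only points at distance at most 2ra, so the indicator can change only for x
    in a slab of that half-width around the hyperplane, whose part in the ball has measure of order
    a. *)
Lemma smoothable_halfspace i (s : R) : smoothable (\1_[set v : V | v ord0 i < s]).
Proof.
set H := [set v : V | _].
have mH : measurable H.
  have := @measurable_rV_coord _ _ n i measurableT `]-oo, s[%classic (measurable_itv _).
  by rewrite setTI (_ : _ @^-1` _ = H)//; apply/seteqP; split=> v /=; rewrite in_itv.
have mF : measurable_fun [set: V] (\1_H : V -> R) by exact: measurable_indic.
split; first exact: mF.
move=> e e0.
pose P := \prod_(j < n | j != i) (r + r).
have P0 : 0 < P by apply: prodr_gt0 => j _; exact: addr_gt0.
have D0 : 0 < e / (4 * r * P) by rewrite divr_gt0// mulr_gt0// mulr_gt0.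
(* The slab below has measure 4 r a P, with [P] the product of the other sides of a box around the
   ball. *)
exists (Num.min 2^-1 (e / (4 * r * P))).
  by rewrite lt_min D0 invr_gt0 ltr0n/= gt_min invf_lt1// ltr1n.
move=> a /andP[a0]; rewrite le_min => /andP[a1 ae].
have ai1 : 1 <= a^-1 by rewrite invf_ge1// (le_trans a1)// invf_le1// ler1n.
have ai0 : 0 <= a^-1 by exact: le_trans ai1.
pose S := box (fun j : 'I_n => if j == i then `[s - 2 * r * a, s + 2 * r * a]%classic
   else `[c ord0 j - r, c ord0 j + r]%classic).
have mS : measurable S by apply: measurable_box => j; case: ifP => _; exact: measurable_itv.
have m1S : measurable_fun [set: V] (\1_S : V -> R) by exact: measurable_indic.
have SE : mu S = (4 * r * a * P)%:E.
  rewrite lebE lebesgue_rV_box; last by move=> j; case: ifP => _; exact: measurable_itv.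
  rewrite (bigD1 i)//= eqxx EFinM; congr (_ * _)%E.
    have ra0 : 0 < 2 * r * a by rewrite !mulr_gt0.
    rewrite lebesgue_measure_itv/= lte_fin ifT; last lra.
    by rewrite -EFinB; congr (_%:E); ring.
  rewrite /P (big_morph (@EFin R) (@EFinM R) erefl); apply: eq_bigr => j /negbTE ->.
  rewrite lebesgue_measure_itv/= lte_fin ifT; last by rewrite ltrD2l gtrN.
  by rewrite -EFinB; congr (_%:E); ring.
apply: (@le_trans _ _ (mu S)); last first.
  rewrite SE lee_fin; move: ae; rewrite ler_pdivlMr ?mulr_gt0//.
  by rewrite mulrC mulrAC.
apply: (@le_trans _ _ (\int[mu]_(x in B) (\1_S x)%:E)%E); last first.
  have := integral_indic mu measurableT mS; rewrite setIT => <-.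
  apply: ge0_subset_integral => //.
  exact/measurable_EFinP.
apply: ge0_le_integral => //.
- by move=> x _; apply: integral_ge0 => z _; rewrite lee_fin mulr_ge0// kern_ge0.
- apply: measurable_funTS.
  apply: (@measurable_integral_kern _ _ c r r0 (fun w => `|\1_H w.1 - \1_H w.2|)) => //.
  apply: measurableT_comp => //; apply: measurable_funB.
    exact: (measurableT_comp mF measurable_fst).
  exact: (measurableT_comp mF measurable_snd).
- by apply: measurable_funTS; exact/measurable_EFinP.
move=> x xB.
have -> : (\1_S x)%:E = (\int[mu]_z (\1_S x * kern c r a^-1 x z)%:E)%E.
  under eq_integral do rewrite EFinM.
  rewrite (ge0_integralZl mu measurableT); last 3 first.
  - by apply/measurable_EFinP; exact: measurable_kern.
  - by move=> z _; rewrite lee_fin kern_ge0.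
  - by rewrite lee_fin.
  by rewrite integral_kern// ?invr_gt0// mule1.
apply: ge0_le_integral => //.
- by move=> z _; rewrite lee_fin mulr_ge0// kern_ge0.
- apply/measurable_EFinP/measurable_funM; last exact: measurable_kern.
  by apply: measurableT_comp => //; exact: measurable_funB.
- by apply/measurable_EFinP/measurable_funM => //; exact: measurable_kern.
move=> z _; rewrite lee_fin.
have [->|k0] := eqVneq (kern c r a^-1 x z) 0; first by rewrite !mulr0.
have [_ zx] := kern_supp r0 ai1 xB k0.
apply: ler_wpM2r; first by rewrite kern_ge0.
have zxi : `|z ord0 i - x ord0 i| <= 2 * r * a.
  have := coord_le_enorm (z - x) i; rewrite !mxE => /le_trans; apply.
  by move: zx; rewrite ler_pdivrMl// mulrC.
rewrite !indicE.
have [xS|xS] := boolP (x \in S); first by case: (_ \in _); case: (_ \in _); rewrite ?subrr ?subr0 ?sub0r ?normrN ?normr0 ?normr1.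
have hx : ~ (s - 2 * r * a <= x ord0 i <= s + 2 * r * a).
  move=> hx; move/negP: xS; apply; apply/mem_set => j /=.
  case: eqP => [->|_] /=; first by rewrite in_itv/=.
  rewrite in_itv/= -ler_distl.
  have := coord_le_enorm (x - c) j; rewrite !mxE => /le_trans; apply.
  exact: ltW xB.
have -> : (x \in H) = (z \in H).
  apply/idP/idP; rewrite !inE /H/= => h; rewrite ltNge; apply/negP => h'; apply: hx;
  move: zxi; rewrite ler_norml => /andP[z1 z2]; apply/andP; split; lra.
by rewrite subrr normr0.
Qed.

(** Half-spaces generate the Borel sets. Complements and finite unions come from [smoothable_le]; a
    countable union is a limit in measure, within the ball, of finite ones. *)
Lemma smoothable_indic (A : set V) : measurable A -> smoothable (\1_A).
Proof.
pose D := [set A : set V | measurable A /\ smoothable (\1_A)].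
suff : measurable `<=` D by move=> h mA; have [] := h _ mA.
have m1 (E : set V) : measurable E -> measurable_fun [set: V] (\1_E : V -> R).
  by move=> mE; exact: measurable_indic.
have DT : D setT.
  split=> //; have -> : \1_(@setT V) = cst 1 :> (V -> R) by apply/funext => v; rewrite indicE in_setT.
  exact: smoothable_cst.
have DC E : D E -> D (~` E).
  move=> [mE sE]; have mC : measurable (~` E) by exact: measurableC.
  split; first exact: mC.
  apply: (smoothable_le r0 ler01 (m1 _ mC) sE (smoothable_cst c r 0)) => x z.
  rewrite !indicE !in_setC; do 2 case: (_ \in _);
    by rewrite /= ?subrr ?subr0 ?sub0r ?normrN ?normr0 ?normr1 ?addr0 ?mul1r.
have DU E E' : D E -> D E' -> D (E `|` E').
  move=> [mE sE] [mE' sE']; have mU : measurable (E `|` E') by exact: measurableU.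
  split; first exact: mU.
  apply: (smoothable_le r0 ler01 (m1 _ mU) sE sE') => x z.
  rewrite !indicE !in_setU mul1r; do 4 case: (_ \in _);
    by rewrite /= ?subrr ?subr0 ?sub0r ?normrN ?normr0 ?normr1 ?addr0 ?add0r ?ler01// lerDl.
have DG (E : (set V)^nat) N : (forall k, D (E k)) -> D (\bigcup_(k < N) E k).
  move=> DE; elim: N => [|N IH].
    by rewrite bigcup_mkord big_ord0 -(setCK set0) setC0; exact: DC.
  have -> : \bigcup_(k < N.+1) E k = \bigcup_(k < N) E k `|` E N.
    by rewrite bigcup_mkord big_ord_recr/= -bigcup_mkord.
  exact: (DU _ _ IH (DE N)).
have DB (E : (set V)^nat) : (forall k, D (E k)) -> D (\bigcup_k E k).
  move=> DE; have mU : measurable (\bigcup_k E k).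
    by apply: bigcupT_measurable => k; have [] := DE k.
  split; first exact: mU.
  apply: (smoothable_approx r0 (m1 _ mU)) => e e0.
  pose G N := \bigcup_(k < N) E k.
  have mG N : measurable (G N) by have [] := DG E N DE.
  (* The part of the ball missed by the first [N] sets; it decreases to the empty set and the ball
     has finite measure. *)
  pose H N := B `&` (\bigcup_k E k `\` G N).
  have mH N : measurable (H N) by apply: measurableI => //; exact: measurableD.
  have H0 : \bigcap_N H N = set0.
    apply/seteqP; split => // v Hv.
    have [_ [[k _ Ek] _]] := Hv 0%N I.
    have [_ [_]] := Hv k.+1 I; apply.
    by exists k => //=.
  have cvgH : (mu \o H) @ \oo --> (0 : \bar R)%E.
    rewrite -(measure0 mu) -H0; apply: nonincreasing_cvg_mu => //.
    - apply: (@le_lt_trans _ _ (mu B)).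
        by apply: le_measure; rewrite ?inE//; exact: subIsetl.
      by rewrite lebE lebesgue_eball// ltry.
    - by rewrite H0.
    - move=> N M NM; apply/subsetPset; apply: setIS; apply: setDS.
      by apply: bigcup_subset => k /= kN; exact: leq_trans kN NM.
  have [N HN] := cvge0_exists_le cvgH e0.
  exists (\1_(G N)); first by have [] := DG E N DE.
  rewrite (le_trans _ HN)// integral_indicM.
  rewrite [leLHS](_ : _ = \int[mu]_z (\1_(H N) z)%:E)%E.
    by rewrite integral_indic ?setIT.
  apply: eq_integral => v _; congr (_%:E).
  have GE : (v \in G N) -> (v \in \bigcup_k E k).
    by rewrite !inE => -[k _ Ek]; exists k.
  rewrite !indicE /H in_setI in_setD; move: GE.
  by do 3 case: (_ \in _) => //=; rewrite ?subrr ?subr0 ?sub0r ?normrN ?normr0 ?normr1 ?mulr0 ?mulr1//; move=> /(_ isT).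
apply: smallest_sub.
  split; [by rewrite -setCT; exact: DC| |exact: DB].
  by move=> E DE; rewrite setTD; exact: DC.
rewrite -bigcup_seq/=; apply: bigcup_sub => i _ _ [Y mY <-]; rewrite setTI.
have : ((@RGenInftyO.G R).-sigma.-measurable Y) by rewrite -RGenInftyO.measurableE.
move: Y {mY}; apply: smallest_sub.
  split.
  - by rewrite /= preimage_set0 -setCT; exact: DC.
  - by move=> Y /= DY; rewrite setTD preimage_setC; exact: DC.
  - by move=> Y /= DY; rewrite preimage_bigcup; exact: DB.
move=> _ [s ->] /=.
have -> : (fun v : V => v ord0 i) @^-1` `]-oo, s[ = [set v : V | v ord0 i < s].
  by apply/seteqP; split=> v /=; rewrite in_itv.
have := smoothable_halfspace i s; split => //.
have := @measurable_rV_coord _ _ n i measurableT `]-oo, s[%classic (measurable_itv _).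
by rewrite setTI (_ : _ @^-1` _ = [set v : V | v ord0 i < s])//; apply/seteqP; split=> v /=; rewrite in_itv.
Qed.

Import HBSimple.

Lemma smoothable_sfun (f : {sfun V >-> R}) : smoothable f.
Proof.
have [s ->] : exists s : seq R,
    (f : V -> R) = (fun x => \sum_(y <- s) y * \1_(f @^-1` [set y]) x).
  by eexists; apply/funext => x; rewrite [LHS]fimfunE fsbig_finite.
have mS (s1 : seq R) : measurable_fun [set: V] (fun x => \sum_(y <- s1) y * \1_(f @^-1` [set y]) x).
  by apply: measurable_sum => y; exact: measurable_funM.
elim: s => [|y s IH].
  under eq_fun do rewrite big_nil; exact: smoothable_cst.
have mE : measurable (f @^-1` [set y]) by exact: measurable_funPTI.
have C0 : 0 <= `|y| + 1 by rewrite addr_ge0.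
apply: (smoothable_le r0 C0 (mS _) (smoothable_indic mE) IH) => x z.
rewrite !big_cons.
set S := \sum_(j <- s) _; set S' := \sum_(j <- s) _.
rewrite (_ : _ + S - _ = y * (\1_(f @^-1` [set y]) x - \1_(f @^-1` [set y]) z) + (S - S')); last ring.
rewrite (le_trans (ler_normD _ _))// normrM mulrDr lerD//.
  by rewrite ler_wpM2r// lerDl.
by rewrite ler_peMl// lerDr.
Qed.

(** Simple functions are dense in L^1, and [smoothable] is stable under L^1 limits. *)
Lemma smoothable_integrable (f : V -> R) :
  mu.-integrable setT (fun z => (f z)%:E) -> smoothable f.
Proof.
move=> fi; have mf : measurable_fun setT f by apply/measurable_EFinP; exact: measurable_int fi.
apply: (smoothable_approx r0 mf) => e e0.
have [g_ [_ _ cvg0]] := approximation_sfun_integrable measurableT fi.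
have [N HN] := cvge0_exists_le cvg0 e0.
exists (g_ N); first exact: smoothable_sfun.
rewrite (le_trans _ HN)//.
apply: ge0_subset_integral => //.
apply/measurable_EFinP; apply: measurableT_comp => //; exact: measurable_funB.
Qed.

End smoothable_integrable.

(** * The Poincare inequality for the weak gradient *)

Section power_inequalities.
Context {R : realType}.
Implicit Types (a b u v h p : R).

Lemma powRD_gt0 a u v : 0 < a -> a `^ (u + v) = a `^ u * a `^ v.
Proof. by move=> a0; rewrite powRD// (gt_eqF a0) implybT. Qed.

(** For h > a write h = h^(1-p) h^p and use that 1 - p is nonpositive. Being linear in h^p, the
    bound can be integrated against any measure. *)
Lemma powR_split h a p : 0 <= h -> 0 < a -> 1 <= p ->
  h <= a + a `^ (1 - p) * h `^ p.
Proof.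
move=> h0 a0 p1; have [ha|ah] := leP h a.
  by rewrite (le_trans ha)// lerDl mulr_ge0// powR_ge0.
have hp0 : 0 < h by exact: lt_trans ah.
rewrite (@le_trans _ _ (a `^ (1 - p) * h `^ p))//; last by rewrite lerDr ltW.
rewrite -[leLHS]powRr1// -[X in h `^ X](subrK p) powRD_gt0//.
apply: ler_wpM2r; first exact: powR_ge0.
rewrite -[1 - p]opprB !powRN lef_pV2 ?posrE ?powR_gt0//.
by rewrite ge0_ler_powR ?nnegrE ?subr_ge0 ?(ltW ah) ?(ltW a0).
Qed.

(** The choice a = v^(1/p) makes the two terms equal. For v = 0 this choice is not positive, and [u]
    is at most every positive number. *)
Lemma powR_unsplit u v p : 0 <= u -> 0 <= v -> 1 <= p ->
  (forall a, 0 < a -> u <= a + a `^ (1 - p) * v) -> u `^ p <= 2 `^ p * v.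
Proof.
move=> u0 v0 p1 h; have p0 : 0 < p by exact: lt_le_trans p1.
move: v0; rewrite le_eqVlt => /predU1P[v0|v0].
  have -> : u = 0.
    apply/eqP; rewrite eq_le u0 andbT; apply/ler_addgt0Pr => e e0.
    by have := h e e0; rewrite -v0 mulr0 addr0 add0r.
  by rewrite powR0 ?gt_eqF// -v0 mulr0.
have w0 : 0 < v `^ p^-1 by rewrite powR_gt0.
have := h _ w0.
have -> : v `^ p^-1 `^ (1 - p) * v = v `^ p^-1.
  rewrite -powRrM -[X in _ * X]powRr1 ?ltW// -powRD_gt0//.
  by congr (_ `^ _); field; rewrite gt_eqF.
rewrite -mulr2n => hu; have {}hu : u <= 2 * v `^ p^-1 by rewrite mulr_natl.
rewrite (@le_trans _ _ ((2 * v `^ p^-1) `^ p))//.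
  by rewrite ge0_ler_powR ?nnegrE ?(ltW p0) ?mulr_ge0 ?powR_ge0.
by rewrite powRM ?powR_ge0// -powRrM mulVf ?gt_eqF// powRr1// ltW.
Qed.

Lemma powRD_le u v p : 0 <= u -> 0 <= v -> 0 <= p ->
  (u + v) `^ p <= 2 `^ p * (u `^ p + v `^ p).
Proof.
move=> u0 v0 p0; have m0 : 0 <= Num.max u v by rewrite le_max u0.
rewrite (@le_trans _ _ ((2 * Num.max u v) `^ p))//.
  rewrite ge0_ler_powR ?nnegrE ?addr_ge0 ?mulr_ge0//.
  rewrite mulr_natl mulr2n lerD// le_max lexx ?orbT//.
rewrite powRM// ler_wpM2l ?powR_ge0//.
by have [_|_] := leP u v; rewrite ?lerDr ?lerDl powR_ge0.
Qed.

(** This lets an error that is small only in L^1 enter an estimate of p-th powers. *)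
Lemma powR_min_le w M p : 0 <= w -> 0 < M -> 1 <= p ->
  Num.min w M `^ p <= M `^ (p - 1) * w.
Proof.
move=> w0 M0 p1; have m0 : 0 <= Num.min w M by rewrite le_min w0 ltW.
have p0 : 0 < p by exact: lt_le_trans p1.
rewrite -(mulr_powRB1 m0 p0) mulrC; apply: ler_pM; rewrite ?powR_ge0//.
  by rewrite ge0_ler_powR ?nnegrE ?subr_ge0 ?(ltW M0)// ge_min lexx orbT.
by rewrite ge_min lexx.
Qed.

End power_inequalities.

(** * Integrated kernel averages *)

Section poincare_ball.
Context {R : realType} {n : nat}.
Local Notation V := 'rV[R]_n.
Local Notation mu := (@leb R n).
Local Notation CK := (kern_cst (R := R) (n := n)).
Local Notation leb1 := (@lebesgue_measure R).
Variables (c : V) (r : R) (p : R).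
Hypothesis r0 : 0 < r.
Hypothesis p1 : 1 <= p.
Local Notation B := (eball c r).

Let mB : measurable B := measurable_eball c r.

Definition kavg (h : V -> R) (a : R) (x : V) : \bar R :=
  (\int[leb1]_(t in `[a, 1%R]) \int[mu]_z (h z * kern c r (lam t) x z)%:E)%E.

Let lam_ge0 (t : R) : 0 <= lam t. Proof. exact: powR_ge0. Qed.

Lemma measurable_kavg_inner (h : V -> R) : measurable_fun setT h -> (forall z, 0 <= h z) ->
  measurable_fun [set: R * V] (fun tx => \int[mu]_z (h z * kern c r (lam tx.1) tx.2 z)%:E)%E.
Proof.
move=> mh h0.
apply: (measurable_fun_fubini_tonelli_F (fun w : (R * V) * V => (h w.2 * kern c r (lam w.1.1) w.1.2 w.2)%:E)).
  apply/measurable_EFinP; apply: measurable_funM.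
    exact: (measurableT_comp mh measurable_snd).
  apply: measurable_kern => //.
  - apply: (measurableT_comp measurable_lam).
    exact: (measurableT_comp measurable_fst measurable_fst).
  - exact: (measurableT_comp measurable_snd measurable_fst).
by move=> w; rewrite lee_fin mulr_ge0// kern_ge0.
Qed.

Let mkz (h : V -> R) t x : measurable_fun setT h ->
  measurable_fun setT (fun z => (h z * kern c r (lam t) x z)%:E).
Proof. by move=> mh; apply/measurable_EFinP/measurable_funM => //; exact: measurable_kern. Qed.

Let kz0 (h : V -> R) t x : (forall z, 0 <= h z) ->
  (0 <= \int[mu]_z (h z * kern c r (lam t) x z)%:E)%E.
Proof. by move=> h0; apply: integral_ge0 => z _; rewrite lee_fin mulr_ge0// kern_ge0. Qed.

Lemma measurable_kavg_t (h : V -> R) x : measurable_fun setT h -> (forall z, 0 <= h z) ->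
  measurable_fun [set: R] (fun t => \int[mu]_z (h z * kern c r (lam t) x z)%:E)%E.
Proof.
move=> mh h0.
apply: (measurable_fun_fubini_tonelli_F (fun w : R * V => (h w.2 * kern c r (lam w.1) x w.2)%:E)).
  apply/measurable_EFinP; apply: measurable_funM.
    exact: (measurableT_comp mh measurable_snd).
  apply: measurable_kern => //.
  exact: (measurableT_comp measurable_lam measurable_fst).
by move=> w; rewrite lee_fin mulr_ge0// kern_ge0.
Qed.

Lemma measurable_kavg (h : V -> R) a : measurable_fun setT h -> (forall z, 0 <= h z) ->
  measurable_fun setT (kavg h a).
Proof.
move=> mh h0; rewrite /kavg; under eq_fun do rewrite integral_mkcond.
have mI : measurable (`[a, 1%R]%classic : set R) by exact: measurable_itv.
pose F (xt : V * R) := ((\1_(`[a, 1]%classic : set R) xt.2)%:E * \int[mu]_z (h z * kern c r (lam xt.2) xt.1 z)%:E)%E.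
have mF : measurable_fun setT F.
  apply: emeasurable_funM.
    apply/measurable_EFinP.
    have m1I : measurable_fun [set: R] (\1_(`[a, 1]%classic : set R) : R -> R) by exact: measurable_indic.
    exact: (measurableT_comp m1I measurable_snd).
  have ms : measurable_fun [set: V * R] (fun w : V * R => (w.2, w.1)).
    by apply: measurable_fun_pair; [exact: measurable_snd|exact: measurable_fst].
  exact: (measurableT_comp (measurable_kavg_inner mh h0) ms).
have F0 w : (0 <= F w)%E by rewrite mule_ge0// ?lee_fin//; exact: kz0.
have := measurable_fun_fubini_tonelli_F (m2 := leb1) F mF F0.
apply: eq_measurable_fun => x _; rewrite /fubini_F; apply: eq_integral => t _.
rewrite /F patchE/= indicE; case: ifPn => tI; first by rewrite mul1e.
by rewrite mul0e.
Qed.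

(** For each t this is [integral_kern_avg_le]; the interval of t has length 1 - a, so the constant
    does not depend on [a]. *)
Lemma integral_kavg_le (h : V -> R) a : 0 < a < 1 -> measurable_fun setT h -> (forall z, 0 <= h z) ->
  (\int[mu]_(x in B) kavg h a x <= CK%:E * \int[mu]_(z in B) (h z)%:E)%E.
Proof.
move=> /andP[a0 a1] mh h0.
have mI : measurable (`[a, 1%R]%classic : set R) by exact: measurable_itv.
have m1I : measurable_fun [set: R] (\1_(`[a, 1]%classic : set R) : R -> R) by exact: measurable_indic.
have m1B : measurable_fun [set: V] (\1_B : V -> R) by exact: measurable_indic.
pose G (tx : R * V) := (\int[mu]_z (h z * kern c r (lam tx.1) tx.2 z)%:E)%E.
have mG : measurable_fun setT G by exact: measurable_kavg_inner.
pose F (tx : R * V) := ((\1_(`[a, 1]%classic : set R) tx.1 * \1_B tx.2)%:E * G tx)%E.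
have mF : measurable_fun setT F.
  apply: emeasurable_funM => //; apply/measurable_EFinP; apply: measurable_funM.
    exact: (measurableT_comp m1I measurable_fst).
  exact: (measurableT_comp m1B measurable_snd).
have F0 w : (0 <= F w)%E by rewrite mule_ge0 ?lee_fin ?mulr_ge0//; exact: kz0.
have -> : (\int[mu]_(x in B) kavg h a x = \int[mu]_x \int[leb1]_t F (t, x))%E.
  rewrite integral_mkcond; apply: eq_integral => x _; rewrite patchE.
  case: ifPn => xB.
    rewrite /kavg integral_mkcond; apply: eq_integral => t _.
    rewrite patchE /F/= !indicE xB mulr1; case: ifPn => tI; first by rewrite mul1e.
    by rewrite mul0e.
  rewrite [LHS](_ : _ = 0%E)//.
  under eq_integral do rewrite /F/= [\1_B x]indicE (negbTE xB) mulr0 mul0e.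
  by rewrite integral0.
rewrite -(fubini_tonelli (m1 := leb1) (m2 := mu) F)//.
set K := (CK%:E * _)%E.
have K0 : (0 <= K)%E.
  by rewrite mule_ge0 ?lee_fin ?kern_cst_ge0//; apply: integral_ge0 => z _; rewrite lee_fin.
apply: (@le_trans _ _ (\int[leb1]_t (K * (\1_(`[a, 1]%classic : set R) t)%:E))%E).
  apply: ge0_le_integral => //.
  - by move=> t _; exact: integral_ge0.
  - exact: (measurable_fun_fubini_tonelli_F F).
  - by apply: emeasurable_funM => //; exact/measurable_EFinP.
  move=> t _; rewrite /F/= indicE; have [tI|tI] := boolP (t \in _); last first.
    by under eq_integral do rewrite mul0r mul0e; rewrite integral0 mule0.
  rewrite mule1.
  have t1 : 1 <= lam t.
    move: tI; rewrite inE/= in_itv/= => /andP[at1 t1].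
    have t0 : 0 < t by exact: lt_le_trans at1.
    by rewrite lamE ?(ltW t0)// invf_ge1.
  rewrite (le_trans _ (integral_kern_avg_le c r0 t1 mh h0))//.
  rewrite [leRHS]integral_mkcond le_eqVlt; apply/orP; left; apply/eqP.
  apply: eq_integral => x _; rewrite patchE indicE mul1r; case: ifPn => xB; first by rewrite mul1e.
  by rewrite mul0e.
rewrite (ge0_integralZl leb1 measurableT); last 3 first.
- by apply/measurable_EFinP; exact: m1I.
- by move=> t _; rewrite lee_fin.
- exact: K0.
rewrite -[leRHS]mule1; apply: lee_wpmul2l => //.
have := integral_indic leb1 measurableT mI; rewrite setIT => ->.
rewrite /= lebesgue_measure_itv/= lte_fin a1 -EFinB lee_fin; lra.
Qed.

(** Jensen's inequality before optimisation in [b]; the total mass of [kavg] is 1 - a <= 1, so the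
    constant b contributes at most b. *)
Lemma kavg_split (h : V -> R) a (b : R) x : 0 < a < 1 -> 0 < b ->
  measurable_fun setT h -> (forall z, 0 <= h z) ->
  (kavg h a x <= b%:E + (b `^ (1 - p))%:E * kavg (fun z => (h z `^ p)%R) a x)%E.
Proof.
move=> /andP[a0 a1] b0 mh h0.
have mhp : measurable_fun setT (fun z => h z `^ p).
  by apply: (measurableT_comp (measurable_powR p)).
have hp0 z : 0 <= h z `^ p by exact: powR_ge0.
have mI : measurable (`[a, 1%R]%classic : set R) by exact: measurable_itv.
have b1 : 0 <= b `^ (1 - p) by exact: powR_ge0.
apply: (@le_trans _ _ (\int[leb1]_(t in `[a, 1%R]) (b%:E + (b `^ (1 - p))%:E *
   \int[mu]_z (h z `^ p * kern c r (lam t) x z)%:E))%E).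
  apply: ge0_le_integral => //.
  - by move=> t _; exact: kz0.
  - by apply: measurable_funTS; exact: measurable_kavg_t.
  - apply: measurable_funTS; apply: emeasurable_funD => //; apply: emeasurable_funM => //.
    exact: (measurable_kavg_t x mhp hp0).
  move=> t; rewrite /= in_itv/= => /andP[at1 t1].
  have t0 : 0 < t by exact: lt_le_trans at1.
  have l0 : 0 < lam t by rewrite lamE ?(ltW t0)// invr_gt0.
  have -> : (b%:E = \int[mu]_z (b * kern c r (lam t) x z)%:E)%E.
    under eq_integral do rewrite EFinM.
    rewrite (ge0_integralZl mu measurableT); last 3 first.
    - by apply/measurable_EFinP; exact: measurable_kern.
    - by move=> z _; rewrite lee_fin kern_ge0.
    - by rewrite lee_fin ltW.
    by rewrite integral_kern// mule1.
  rewrite -(ge0_integralZl mu measurableT); last 3 first.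
  - exact: mkz.
  - by move=> z _; rewrite lee_fin mulr_ge0 ?kern_ge0.
  - by rewrite lee_fin.
  rewrite -(ge0_integralD mu measurableT); last 4 first.
  - by move=> z _; rewrite lee_fin mulr_ge0 ?kern_ge0 ?(ltW b0).
  - exact: (@mkz (cst b)).
  - by move=> z _; rewrite mule_ge0 ?lee_fin// mulr_ge0 ?kern_ge0.
  - by apply: emeasurable_funM => //; exact: mkz.
  apply: ge0_le_integral => //.
  - by move=> z _; rewrite lee_fin mulr_ge0 ?kern_ge0.
  - exact: mkz.
  - apply: emeasurable_funD; first exact: (@mkz (cst b)).
    by apply: emeasurable_funM => //; exact: mkz.
  move=> z _; rewrite -EFinM -EFinD lee_fin [X in _ + X]mulrA -mulrDl.
  by apply: ler_wpM2r; [exact: kern_ge0|exact: powR_split].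
rewrite (ge0_integralD leb1 mI); last 4 first.
- by move=> t _; rewrite lee_fin ltW.
- exact: measurable_cst.
- by move=> t _; rewrite mule_ge0 ?lee_fin//; exact: kz0.
- apply: measurable_funTS; apply: emeasurable_funM => //.
  exact: (measurable_kavg_t x mhp hp0).
apply: leeD.
  rewrite integral_cst//= lebesgue_measure_itv/= lte_fin a1 -EFinB -EFinM lee_fin.
  by rewrite -[leRHS]mulr1 ler_wpM2l ?ltW//; lra.
rewrite (ge0_integralZl leb1 mI)//.
- by apply: measurable_funTS; exact: (measurable_kavg_t x mhp hp0).
- by move=> t _; exact: kz0.
Qed.

End poincare_ball.

(** * From kernel averages to the Poincare inequality *)

Section poincare_gradient.
Context {R : realType} {n : nat}.
Local Notation V := 'rV[R]_n.
Local Notation mu := (@leb R n).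
Local Notation CK := (kern_cst (R := R) (n := n)).
Variables (c : V) (r p : R) (Omega : set V) (f : V -> R) (g : V -> V).
Hypothesis r0 : 0 < r.
Hypothesis p1 : 1 <= p.
Local Notation B := (eball c r).
Hypothesis BO : B `<=` Omega.
Hypothesis fi : mu.-integrable setT (fun z => (f z)%:E).
Hypothesis gi : forall i, mu.-integrable setT (fun z => (g z ord0 i)%:E).
Hypothesis weak : forall i phi, test_function Omega phi ->
  (\int[mu]_z (f z * partial i phi z)%:E = - \int[mu]_z (g z ord0 i * phi z)%:E)%E.

Let p0 : 0 < p. Proof. exact: lt_le_trans p1. Qed.

Let mB : measurable B := measurable_eball c r.

Let mf : measurable_fun setT f.
Proof. by apply/measurable_EFinP; exact: measurable_int fi. Qed.

Let mg : measurable_fun setT (fun z => enorm (g z)).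
Proof.
apply: (measurableT_comp measurable_enorm); apply: measurable_fun_rV => i.
by apply/measurable_EFinP; exact: measurable_int (gi i).
Qed.

Let h (z : V) : R := \1_B z * enorm (g z).

Let h0 z : 0 <= h z. Proof. by rewrite mulr_ge0 ?enorm_ge0. Qed.

Let mh : measurable_fun setT h.
Proof. by apply: measurable_funM => //; exact: measurable_indic. Qed.

Let hp (z : V) : R := h z `^ p.

Let mhp : measurable_fun setT hp.
Proof. exact: (measurableT_comp (measurable_powR p)). Qed.

(** The average of f against the unshrunk bump. By [kern1E] it is the starting point of the averages
    at every x. *)
Let center : R := fine (\int[mu]_z (f z * kern c r 1 c z)%:E)%E.

Let kern1E x z : kern c r 1 x z = kern c r 1 c z.
Proof. by rewrite /kern subrr addr0 !scale1r addrA subrK. Qed.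

Let fk l x : 0 <= l -> mu.-integrable setT (fun z => (f z * kern c r l x z)%:E).
Proof.
move=> l0; apply: (@integrable_bddM _ _ _ _ f _ (l ^+ n * ncst (n := n) r)) => //.
  exact: measurable_kern.
move=> z; rewrite ger0_norm ?kern_ge0// /kern -[leRHS]mulr1; apply: ler_wpM2l.
  by apply: mulr_ge0; [exact: exprn_ge0|apply: ltW; exact: ncst_gt0].
exact: bump_le1.
Qed.

Let ki l x : 0 < l -> mu.-integrable setT (fun z => (kern c r l x z)%:E).
Proof.
move=> l0; apply/integrableP; split.
  by apply/measurable_EFinP; exact: measurable_kern.
under eq_integral do rewrite gee0_abs ?lee_fin ?kern_ge0 ?(ltW l0)//.
by rewrite integral_kern// ltry.
Qed.

Let W a x : \bar R := (\int[mu]_z (`|f x - f z| * kern c r a^-1 x z)%:E)%E.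

(** f(x) differs from its average at scale a by at most W, and the averages at scales a and 1 differ
    by at most the bound of [kernel_average_diff]. *)
Lemma dist_center_le a x : 0 < a < 1 -> B x ->
  ((`|f x - center|)%:E <= W a x + (2 * r)%:E * kavg c r h a x)%E.
Proof.
move=> a01 xB; have /andP[a0 a1] := a01.
have ai0 : 0 < a^-1 by rewrite invr_gt0.
have ai := ltW ai0.
have fc : (\int[mu]_z (f z * kern c r 1 x z)%:E = center%:E)%E.
  under eq_integral do rewrite kern1E.
  by rewrite /center fineK//; apply: integrable_fin_num => //; exact: fk.
have i1 : mu.-integrable setT (fun z => (f x * kern c r a^-1 x z)%:E).
  under eq_fun do rewrite EFinM; apply: integrableZl => //; exact: ki.
have i2 : mu.-integrable setT (fun z => ((f x - f z) * kern c r a^-1 x z)%:E).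
  under eq_fun do rewrite mulrBl EFinB; by apply: integrableB; [exact: measurableT|exact: i1|exact: (fk x ai)].
have i3 : mu.-integrable setT (fun z => (f z * (kern c r 1 x z - kern c r a^-1 x z))%:E).
  under eq_fun do rewrite mulrBr EFinB.
  by apply: integrableB; [exact: measurableT|exact: (fk x ler01)|exact: (fk x ai)].
have E : ((f x - center)%:E = \int[mu]_z ((f x - f z) * kern c r a^-1 x z)%:E
    - \int[mu]_z (f z * (kern c r 1 x z - kern c r a^-1 x z))%:E)%E.
  have -> : ((f x - center)%:E = \int[mu]_z (f x * kern c r a^-1 x z)%:E -
      \int[mu]_z (f z * kern c r 1 x z)%:E)%E.
    have fx : (\int[mu]_z (f x * kern c r a^-1 x z)%:E = (f x)%:E)%E.
      under eq_integral do rewrite EFinM.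
      by rewrite (integralZl measurableT (ki x ai0)) integral_kern// mule1.
    by rewrite EFinB -fx -fc.
  apply: (etrans (esym (integralB measurableT i1 (fk x ler01)))).
  apply: (etrans _ (integralB measurableT i2 i3)).
  apply: eq_integral => z _; rewrite -!EFinB; congr (_%:E).
  by move: (kern _ _ _ _ _) (kern _ _ _ _ _) => k k'; ring.
rewrite -abse_EFin E.
apply: (le_trans (lee_abs_sub _ _)); apply: leeD.
  apply: (le_trans (le_abse_integral mu measurableT (measurable_int _ i2))).
  rewrite /W le_eqVlt; apply/orP; left; apply/eqP; apply: eq_integral => z _.
  by rewrite abse_EFin normrM [`|kern _ _ _ _ _|]ger0_norm// kern_ge0.
apply: (le_trans (kernel_average_diff r0 xB BO fi gi weak a01)).
rewrite /kavg le_eqVlt; apply/orP; left; apply/eqP; congr (_ * _)%E.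
apply: eq_integral => t; rewrite inE/= in_itv/= => /andP[at1 t1].
apply: eq_integral => z _; congr (_%:E); rewrite /h indicE.
have t0 : 0 < t by exact: lt_le_trans at1.
have l1 : 1 <= lam t by rewrite lamE ?(ltW t0)// invf_ge1.
have [->|k0] := eqVneq (kern c r (lam t) x z) 0; first by rewrite !mulr0.
by have [zB _] := kern_supp r0 l1 xB k0; rewrite (mem_set zB) mul1r.
Qed.

(** The gradient term is raised to the power p by [powR_unsplit] applied to [kavg_split]; the error
    W, once truncated, enters linearly. *)
Lemma truncated_dist_le a M x : 0 < a < 1 -> 0 < M -> B x ->
  ((Num.min `|f x - center| M `^ p)%:E <=
   (2 `^ p * ((2 * r) `^ p * 2 `^ p))%:E * kavg c r hp a x +
   (2 `^ p * M `^ (p - 1))%:E * W a x)%E.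
Proof.
move=> a01 M0 xB; have /andP[a0 a1] := a01.
have W0 : (0 <= W a x)%E.
  by apply: integral_ge0 => z _; rewrite lee_fin mulr_ge0 ?kern_ge0// invr_ge0 ltW.
have K0 u : (forall z, 0 <= u z) -> (0 <= kavg c r u a x)%E.
  move=> u0; apply: integral_ge0 => t _; apply: integral_ge0 => z _.
  by rewrite lee_fin mulr_ge0 ?kern_ge0// /lam powR_ge0.
have hp0 z : 0 <= hp z by exact: powR_ge0.
have r2 : 0 < 2 * r by rewrite mulr_gt0.
have C1 : 0 < 2 `^ p * ((2 * r) `^ p * 2 `^ p) by rewrite !mulr_gt0// powR_gt0.
have C2 : 0 < 2 `^ p * M `^ (p - 1) by rewrite mulr_gt0// powR_gt0.
(* An infinite term makes the right-hand side infinite; afterwards all quantities are real. *)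
have [W_oo|] := eqVneq (W a x) +oo%E.
  rewrite W_oo gt0_muley ?lte_fin// addey ?leey// -ltNye.
  by rewrite (@lt_le_trans _ _ 0%E)// mule_ge0 ?lee_fin ?(ltW C1)// K0.
rewrite -ltey => Wlt.
have [J_oo|] := eqVneq (kavg c r hp a x) +oo%E.
  rewrite J_oo gt0_muley ?lte_fin// addye ?leey// -ltNye.
  by rewrite (@lt_le_trans _ _ 0%E)// mule_ge0 ?lee_fin ?(ltW C2).
rewrite -ltey => Jlt.
have Wfin : W a x \is a fin_num by rewrite ge0_fin_numE.
have Jpfin : kavg c r hp a x \is a fin_num by rewrite ge0_fin_numE// K0.
have Jsplit b : 0 < b -> (kavg c r h a x <= b%:E + (b `^ (1 - p))%:E * kavg c r hp a x)%E.
  by move=> b0; exact: kavg_split.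
have Jfin : kavg c r h a x \is a fin_num.
  rewrite (ge0_fin_numE (K0 h h0)) (le_lt_trans (Jsplit 1 ltr01))//.
  by rewrite -(fineK Jpfin) -EFinM -EFinD ltry.
have := dist_center_le a01 xB.
rewrite -(fineK Wfin) -(fineK Jfin) -(fineK Jpfin) -!EFinM -!EFinD !lee_fin.
set w := fine (W a x); set j := fine _; set jp := fine _ => D.
have w0 : 0 <= w by exact: fine_ge0.
have j0 : 0 <= j by apply: fine_ge0; exact: K0.
have jp0 : 0 <= jp by apply: fine_ge0; exact: K0.
have Dmin : Num.min `|f x - center| M <= 2 * r * j + Num.min w M.
  have rj : 0 <= 2 * r * j by rewrite mulr_ge0// ltW.
  by have [wM|Mw] := leP w M; rewrite ge_min; apply/orP; [left; rewrite [leRHS]addrC|right; rewrite lerDr].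
have m0 : 0 <= Num.min w M by rewrite le_min w0 ltW.
rewrite (@le_trans _ _ ((2 * r * j + Num.min w M) `^ p))//.
  have rj0 : 0 <= 2 * r * j by rewrite mulr_ge0// ltW.
  by rewrite ge0_ler_powR ?nnegrE ?(ltW p0) ?le_min ?normr_ge0 ?(ltW M0)// addr_ge0.
apply: (le_trans (powRD_le _ m0 (ltW p0))); first by rewrite mulr_ge0// ltW.
rewrite -!mulrA -mulrDr ler_wpM2l ?powR_ge0//; apply: lerD; last exact: powR_min_le.
rewrite mulrA (powRM _ (ltW r2) j0); apply: ler_wpM2l; first exact: powR_ge0.
apply: (powR_unsplit j0 jp0 p1) => b b0.
by have := Jsplit b b0; rewrite -(fineK Jfin) -(fineK Jpfin) -EFinM -EFinD lee_fin.
Qed.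

(** One factor 2^p from splitting the p-th power of a sum, one from (2r)^p, one from [powR_unsplit];
    [kern_cst] from the integration in x. *)
Definition poincare_cst : R := 2 `^ p * 2 `^ p * 2 `^ p * CK.

Lemma integral_hp : (\int[mu]_(z in B) (hp z)%:E = \int[mu]_(z in B) (enorm (g z) `^ p)%:E)%E.
Proof. by apply: eq_integral => z zB; rewrite /hp /h indicE zB mul1r. Qed.

Let Hp : \bar R := (\int[mu]_(z in B) (enorm (g z) `^ p)%:E)%E.

Lemma integral_truncated_le M : 0 < M ->
  (\int[mu]_(x in B) (Num.min `|f x - center| M `^ p)%:E <= (poincare_cst * r `^ p)%:E * Hp)%E.
Proof.
move=> M0; apply/lee_addgt0Pr => e e0.
set C2 := 2 `^ p * M `^ (p - 1).
have C20 : 0 < C2 by rewrite mulr_gt0// powR_gt0.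
(* The scale [a] is chosen after [M], so that the error times its coefficient [C2] integrates to at
   most [e]. *)
have [_ /(_ (e / C2))] := smoothable_integrable c r0 fi.
rewrite divr_gt0// => /(_ isT) [a /[dup] a01 /andP[a0 a1]] /(_ a).
rewrite a0 lexx => /(_ isT) osce.
set C1 := 2 `^ p * ((2 * r) `^ p * 2 `^ p).
have C10 : 0 <= C1 by rewrite !mulr_ge0// powR_ge0.
have ai0 : 0 <= a^-1 by rewrite invr_ge0 ltW.
have hp0 z : 0 <= hp z by exact: powR_ge0.
have mW : measurable_fun setT (W a).
  apply: (@measurable_integral_kern _ _ c r r0 (fun w => `|f w.1 - f w.2|)) => //.
  apply: measurableT_comp => //; apply: measurable_funB.
    exact: (measurableT_comp mf measurable_fst).
  exact: (measurableT_comp mf measurable_snd).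
have mK : measurable_fun setT (kavg c r hp a) by exact: measurable_kavg.
have W0 x : (0 <= W a x)%E.
  by apply: integral_ge0 => z _; rewrite lee_fin mulr_ge0 ?kern_ge0.
have K0 x : (0 <= kavg c r hp a x)%E.
  apply: integral_ge0 => t _; apply: integral_ge0 => z _.
  by rewrite lee_fin mulr_ge0 ?kern_ge0// /lam powR_ge0.
have mfc : measurable_fun setT (fun x => `|f x - center|).
  by apply: measurableT_comp => //; exact: measurable_funB.
apply: (@le_trans _ _ (\int[mu]_(x in B) (C1%:E * kavg c r hp a x + C2%:E * W a x))%E).
  apply: ge0_le_integral => //.
  - by move=> x _; rewrite lee_fin powR_ge0.
  - apply: measurable_funTS; apply/measurable_EFinP.
    apply: (measurableT_comp (measurable_powR p)).
    exact: measurable_minr.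
  - by apply: measurable_funTS; apply: emeasurable_funD; exact: emeasurable_funM.
  - by move=> x xB; exact: truncated_dist_le.
rewrite (ge0_integralD mu mB); last 4 first.
- by move=> x _; rewrite mule_ge0 ?lee_fin.
- by apply: measurable_funTS; exact: emeasurable_funM.
- by move=> x _; rewrite mule_ge0 ?lee_fin// ltW.
- by apply: measurable_funTS; exact: emeasurable_funM.
rewrite (ge0_integralZl mu mB); [|exact: measurable_funTS|by []|by []].
rewrite (ge0_integralZl mu mB); [|exact: measurable_funTS|by []|by rewrite lee_fin ltW].
apply: leeD.
  apply: (@le_trans _ _ (C1%:E * (CK%:E * \int[mu]_(z in B) (hp z)%:E))%E).
    by apply: lee_wpmul2l; [by rewrite lee_fin|exact: integral_kavg_le].
  rewrite integral_hp muleA -EFinM -/Hp le_eqVlt; apply/orP; left; apply/eqP.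
  by congr (_%:E * _)%E; rewrite /C1 /poincare_cst powRM ?(ltW r0)//; ring.
apply: (@le_trans _ _ (C2%:E * (e / C2)%:E)%E).
  by apply: lee_wpmul2l => //; rewrite lee_fin ltW.
by rewrite -EFinM lee_fin mulrC divfK// gt_eqF.
Qed.

(** The bound for truncations does not depend on M, so monotone convergence removes the
    truncation. *)
Lemma poincare_gradient : exists d : R,
  (\int[mu]_(x in B) (`|f x - d| `^ p)%:E <= (poincare_cst * r `^ p)%:E * Hp)%E.
Proof.
exists center.
have mfc : measurable_fun setT (fun x => `|f x - center|).
  by apply: measurableT_comp => //; exact: measurable_funB.
pose u (k : nat) (x : V) := (Num.min `|f x - center| k.+1%:R `^ p)%:E.
have lim_u x : u ^~ x @ \oo --> (`|f x - center| `^ p)%:E.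
  apply: cvg_near_cst; near=> k; rewrite /u min_l//.
  apply: (@le_trans _ _ k%:R); last by rewrite ler_nat.
  near: k; exact: nbhs_infty_ger.
have mu_ k : measurable_fun B (u k).
  apply: measurable_funTS; apply/measurable_EFinP.
  by apply: (measurableT_comp (measurable_powR p)); exact: measurable_minr.
have u0 k x : B x -> (0 <= u k x)%E by move=> _; rewrite lee_fin powR_ge0.
have nu x : B x -> nondecreasing_seq (u ^~ x).
  move=> _ k l kl; have m0 m : 0 <= Num.min `|f x - center| (m.+1%:R : R).
    by rewrite le_min normr_ge0/=.
  rewrite lee_fin ge0_ler_powR ?nnegrE ?m0 ?(ltW p0)// le_min !ge_min lexx/=.
  by rewrite ler_nat ltnS kl orbT.
have cv := cvg_monotone_convergence mB mu_ u0 nu.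
have -> : (\int[mu]_(x in B) (`|f x - center| `^ p)%:E =
    \int[mu]_(x in B) (limn (u ^~ x)))%E.
  by apply: eq_integral => x _; apply/esym/cvg_lim => //; exact: lim_u.
apply: (cvge_to_le (cv mu)); apply: nearW => k; exact: integral_truncated_le.
Unshelve. all: by end_near. Qed.

End poincare_gradient.

(** * Hausdorff measure and Vitali coverings *)

Section hausdorff_subadditivity.
Context {R : realType} {n : nat}.
Local Notation V := 'rV[R]_n.
Implicit Types (A B : set V) (s : R).
Local Open Scope ereal_scope.

Lemma hausdorff_gauge_ge0 s A : 0 <= hausdorff_gauge s A.
Proof. by rewrite /hausdorff_gauge; case: ifP => // _; exact: poweR_ge0. Qed.

Lemma hausdorff_gauge0 s : hausdorff_gauge s (set0 : set V) = 0.
Proof. by rewrite /hausdorff_gauge asboolT. Qed.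

Lemma hausdorff_pre_ge0 s delta A : 0 <= hausdorff_pre s delta A.
Proof.
apply: le_ereal_inf_tmp => _ [U _ <-].
by apply: nneseries_ge0 => k _ _; exact: hausdorff_gauge_ge0.
Qed.

Lemma hausdorff_pre_setU s delta A B :
  hausdorff_pre s delta (A `|` B) <= hausdorff_pre s delta A + hausdorff_pre s delta B.
Proof.
have [->|] := eqVneq (hausdorff_pre s delta A) +oo.
  by rewrite addye ?leey// -ltNye (lt_le_trans _ (hausdorff_pre_ge0 _ _ _)).
rewrite -ltey => Aoo.
have [->|] := eqVneq (hausdorff_pre s delta B) +oo.
  by rewrite addey ?leey// -ltNye (lt_le_trans _ (hausdorff_pre_ge0 _ _ _)).
rewrite -ltey => Boo.
apply/lee_addgt0Pr => e e0.
have e2 : (0 < e / 2)%R by rewrite divr_gt0.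
have Afin : hausdorff_pre s delta A \is a fin_num by rewrite ge0_fin_numE// hausdorff_pre_ge0.
have Bfin : hausdorff_pre s delta B \is a fin_num by rewrite ge0_fin_numE// hausdorff_pre_ge0.
have [_ [U [AU dU] <-] Ue] := lb_ereal_inf_adherent e2 Afin.
have [_ [W [BW dW] <-] We] := lb_ereal_inf_adherent e2 Bfin.
(* Two countable coverings interleaved: even indices carry [U], odd ones [W]. *)
pose X k := if odd k then W k./2 else U k./2.
apply: (@le_trans _ _ (\sum_(0 <= k <oo) hausdorff_gauge s (X k))).
  apply: ereal_inf_lbound; exists X => //; split.
    move=> v [/AU[k _ Uk]|/BW[k _ Wk]].
      by exists k.*2 => //; rewrite /X odd_double doubleK.
    by exists k.*2.+1 => //; rewrite /X /= odd_double/= uphalf_double.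
  by move=> k; rewrite /X; case: ifP.
have g0 F k : 0 <= hausdorff_gauge s (F k : set V) by exact: hausdorff_gauge_ge0.
apply: (@le_trans _ _ (\sum_(0 <= k <oo) hausdorff_gauge s (U k) +
    \sum_(0 <= k <oo) hausdorff_gauge s (W k))); last first.
  apply: (@le_trans _ _ (hausdorff_pre s delta A + (e / 2)%:E + (hausdorff_pre s delta B + (e / 2)%:E))).
    by apply: leeD; exact: ltW.
  by rewrite addeACA -EFinD -splitr.
apply: lime_le; first by apply: is_cvg_nneseries => k _ _.
apply: nearW => N.
have E : \sum_(0 <= k < N.*2) hausdorff_gauge s (X k) =
    \sum_(0 <= k < N) hausdorff_gauge s (U k) + \sum_(0 <= k < N) hausdorff_gauge s (W k).
  elim: N => [|N IH]; first by rewrite !big_nil adde0.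
  rewrite doubleS !big_nat_recr//= IH /X /= odd_double/= uphalf_double doubleK.
  by rewrite -addeA addeACA.
apply: (@le_trans _ _ (\sum_(0 <= k < N.*2) hausdorff_gauge s (X k))).
  by apply: lee_sum_nneg_natr => //; rewrite -addnn leq_addr.
rewrite E; apply: leeD; exact: nneseries_lim_ge.
Qed.

Lemma hausdorff_measure_setU s A B :
  hausdorff_measure s (A `|` B) <= hausdorff_measure s A + hausdorff_measure s B.
Proof.
apply: ge_ereal_sup => _ [delta d0 <-].
apply: (le_trans (hausdorff_pre_setU _ _ _ _)).
by apply: leeD; apply: ereal_sup_ubound; exists delta.
Qed.

Lemma hausdorff_measure0 s : hausdorff_measure s (set0 : set V) <= 0.
Proof.
apply: ge_ereal_sup => _ [delta d0 <-].
(* Empty sets are admissible in a covering, as their diameter is -oo. *)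
apply: ereal_inf_lbound; exists (fun=> set0) => /=.
  split=> // k; rewrite /ediam; set S := (X in ereal_sup X).
  have -> : S = set0 by apply/seteqP; split => // t [u []].
  by rewrite ereal_sup0 leNye.
by rewrite eseries0// => k _ _; exact: hausdorff_gauge0.
Qed.

End hausdorff_subadditivity.

Section vitali_covering.
Context {R : realType} {n : nat}.
Local Notation V := 'rV[R]_n.
Implicit Types (b d : V * R) (bs ds : seq (V * R)).

Definition bballs (k : R) bs : set V := \big[setU/set0]_(b <- bs) eball b.1 (k * b.2).

Lemma bballs_cons k b bs : bballs k (b :: bs) = eball b.1 (k * b.2) `|` bballs k bs.
Proof. by rewrite /bballs big_cons. Qed.

Lemma bballs_nil k : bballs k [::] = set0.
Proof. by rewrite /bballs big_nil. Qed.

Lemma bballsP k bs v : bballs k bs v <-> exists2 b, b \in bs & eball b.1 (k * b.2) v.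
Proof.
elim: bs => [|b bs IH]; first by rewrite bballs_nil; split => // -[].
rewrite bballs_cons; split.
  by case=> [bv|/IH[d dbs dv]]; [exists b => //; rewrite mem_head|exists d => //; rewrite in_cons dbs orbT].
move=> [d]; rewrite in_cons => /predU1P[->|dbs] dv; [by left|right].
by apply/IH; exists d.
Qed.

Lemma measurable_bballs k bs : measurable (bballs k bs).
Proof. by apply: bigsetU_measurable => b _; exact: measurable_eball. Qed.

Fixpoint disjoint_balls bs : Prop :=
  if bs is b :: bs' then eball b.1 b.2 `&` bballs 1 bs' = set0 /\ disjoint_balls bs' else True.

Lemma max_radius b0 bs : exists2 b, b \in b0 :: bs & forall d, d \in b0 :: bs -> d.2 <= b.2.
Proof.
elim: bs b0 => [|b1 bs IH] b0.
  by exists b0; rewrite ?mem_head// => d; rewrite inE => /eqP ->.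
have [b bbs bmax] := IH b1.
have [b0b|bb0] := leP b0.2 b.2.
  exists b; first by rewrite in_cons bbs orbT.
  by move=> d; rewrite in_cons => /predU1P[->//|]; exact: bmax.
exists b0; first by rewrite mem_head.
move=> d; rewrite in_cons => /predU1P[->//|/bmax h]; exact: le_trans h (ltW bb0).
Qed.

(** Greedy selection: keep a ball of largest radius and recurse on those disjoint from it. A
    discarded ball meets one at least as large, hence lies in its triple. *)
Lemma vitali_finite bs : (forall b, b \in bs -> 0 < b.2) ->
  exists ds, [/\ {subset ds <= bs}, disjoint_balls ds & bballs 1 bs `<=` bballs 3 ds].
Proof.
move: {2}(size bs) (leqnn (size bs)) => m.
elim: m bs => [|m IH] bs.
  rewrite leqn0 size_eq0 => /eqP -> _; exists [::]; split => //.
  by rewrite !bballs_nil.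
case: bs => [|b0 bs0] szb pos.
  by exists [::]; split => //; rewrite !bballs_nil.
set bs := b0 :: bs0 in szb pos *.
have [b bbs bmax] := max_radius b0 bs0; rewrite -/bs in bbs bmax.
pose P d := `[< eball d.1 d.2 `&` eball b.1 b.2 = set0 >].
have bb : ~~ P b.
  apply/asboolP => /seteqP[h _]; apply: (h b.1).
  by rewrite setIid /eball/= subrr enorm0 pos.
have [|d|ds [dsub ddis dcov]] := IH (seq.filter P bs).
- have : (count P bs < size bs)%N.
    by rewrite -(count_predC P) -addn1 leq_add2l -has_count; apply/hasP; exists b.
  by rewrite size_filter => /leq_trans/(_ szb); rewrite ltnS.
- by rewrite mem_filter => /andP[_]; exact: pos.
exists (b :: ds); split.
- move=> d; rewrite in_cons => /predU1P[->//|/dsub].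
  by rewrite mem_filter => /andP[].
- split => //; apply/seteqP; split => // v [bv /bballsP[d dds]].
  rewrite mul1r => dv; have := dsub _ dds; rewrite mem_filter => /andP[/asboolP h _].
  by rewrite -h; split.
- move=> v /bballsP[d dbs]; rewrite mul1r => dv; rewrite bballs_cons.
  have [Pd|] := boolP (P d).
    right; apply: dcov; apply/bballsP; exists d; last by rewrite mul1r.
    by rewrite mem_filter Pd.
  move=> /asboolP/eqP/set0P[y [dy yb]]; left; rewrite /eball/=.
  have := bmax _ dbs; move: dv dy yb; rewrite /eball/= => dv dy yb db.
  have := enorm_triangle v d.1 b.1; have := enorm_triangle d.1 y b.1.
  rewrite (enormB d.1 y) => h1 h2; lra.
Qed.

Lemma hausdorff_measure_bballs s (T : set V) k bs :
  (hausdorff_measure s (T `&` bballs k bs) <=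
   \sum_(b <- bs) hausdorff_measure s (T `&` eball b.1 (k * b.2)))%E.
Proof.
elim: bs => [|b bs IH]; first by rewrite bballs_nil setI0 big_nil hausdorff_measure0.
rewrite bballs_cons setIUr big_cons; apply: (le_trans (hausdorff_measure_setU _ _ _)).
exact: leeD.
Qed.

End vitali_covering.

(** * Chains of balls and the zero set *)

Section chain_of_balls.
Context {R : realType} {n : nat}.
Local Notation V := 'rV[R]_n.
Local Notation mu := (@leb R n).
Local Notation v := (ball_vol (R := R) (n := n)).
Variables (x0 : V) (rho : R).
Hypothesis rho0 : 0 < rho.
Implicit Types (x y : V) (k : nat).

(* [chain_ball x k] is the image of [eball x0 rho] under the homothety of centre
   [x] and ratio [2^-k]: unlike balls centred at [x], it stays in [eball x0 rho]. *)
Definition chain_radius k : R := rho * 2^-1 ^+ k.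
Definition chain_center x k : V := x + 2^-1 ^+ k *: (x0 - x).
Definition chain_ball x k : set V := eball (chain_center x k) (chain_radius k).

Lemma chain_radius_gt0 k : 0 < chain_radius k.
Proof. by rewrite mulr_gt0// exprn_gt0// invr_gt0. Qed.

Lemma chain_radiusS k : chain_radius k.+1 = chain_radius k / 2.
Proof. by rewrite /chain_radius exprSr mulrA. Qed.

Lemma chain_ball0 x : chain_ball x 0 = eball x0 rho.
Proof. by rewrite /chain_ball /chain_center /chain_radius expr0 mulr1 scale1r addrC subrK. Qed.

Lemma dist_chain_center x k : eball x0 rho x -> enorm (chain_center x k - x) < chain_radius k.
Proof.
rewrite /eball/= => xB; have h0 : 0 < 2^-1 ^+ k :> R by rewrite exprn_gt0// invr_gt0.
rewrite /chain_center addrC addKr enormZ ger0_norm ?(ltW h0)// enormB mulrC.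
by rewrite /chain_radius ltr_pM2r.
Qed.

Lemma mem_chain_ball x k : eball x0 rho x -> chain_ball x k x.
Proof. by move=> xB; rewrite /chain_ball /eball/= enormB dist_chain_center. Qed.

Lemma chain_ball_sub x k : eball x0 rho x -> chain_ball x k `<=` eball x (2 * chain_radius k).
Proof.
move=> xB y; rewrite /chain_ball /eball/= => h.
have := enorm_triangle y (chain_center x k) x; have := dist_chain_center k xB.
move: h; move: (enorm _) (enorm _) (enorm _) => a b c'; lra.
Qed.

Lemma chain_ballS x k : eball x0 rho x -> chain_ball x k.+1 `<=` chain_ball x k.
Proof.
rewrite {1}/eball/= => xB y; rewrite /chain_ball /eball/= chain_radiusS => h.
have := enorm_triangle y (chain_center x k.+1) (chain_center x k).
have -> : chain_center x k.+1 - chain_center x k = - (2^-1 ^+ k.+1 *: (x0 - x)).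
  by apply/rowP => i; rewrite !mxE exprS; field.
have h0 : 0 < 2^-1 ^+ k.+1 :> R by rewrite exprn_gt0// invr_gt0.
rewrite enormN enormZ ger0_norm ?(ltW h0)// (enormB x0).
have : 2^-1 ^+ k.+1 * enorm (x - x0) < 2^-1 ^+ k.+1 * rho by rewrite ltr_pM2l.
rewrite {2}exprSr => h1 h2.
have E : chain_radius k / 2 = 2^-1 ^+ k / 2 * rho by rewrite /chain_radius; ring.
rewrite (le_lt_trans h2)// [ltRHS](splitr (chain_radius k)) ltrD//.
by rewrite E.
Qed.

Lemma chain_ball_subB x k : eball x0 rho x -> chain_ball x k `<=` eball x0 rho.
Proof.
move=> xB; elim: k => [|k IH]; first by rewrite chain_ball0.
by apply: subset_trans IH; exact: chain_ballS.
Qed.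

Lemma chain_radius_small (e : R) : 0 < e -> exists N, chain_radius N < e.
Proof.
move=> e0; have e1 : 0 < e / rho by rewrite divr_gt0.
have [N _ hN] := near_infty_natSinv_expn_lt (PosNum e1).
exists N; have := hN N (leqnn N); rewrite /= => h.
rewrite /chain_radius mulrC -ltr_pdivlMr// (le_lt_trans _ h)//.
by rewrite exprVn div1r.
Qed.

Lemma lebesgue_chain_ball x k : mu (chain_ball x k) = (chain_radius k ^+ n * v)%:E.
Proof. by rewrite lebE lebesgue_eball// chain_radius_gt0. Qed.

End chain_of_balls.

Section ball_constants.
Context {R : realType} {n : nat}.
Local Notation V := 'rV[R]_n.
Local Notation mu := (@leb R n).
Variables (f : V -> R) (p : R).
Hypothesis mf : measurable_fun setT f.
Hypothesis p1 : 1 <= p.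

Let p0 : 0 <= p. Proof. exact: le_trans p1. Qed.

Lemma measurable_dist_powR (d : R) : measurable_fun setT (fun x => (`|f x - d| `^ p)%:E).
Proof.
apply/measurable_EFinP; apply: (measurableT_comp (measurable_powR p)).
by apply: measurableT_comp => //; exact: measurable_funB.
Qed.

(** Both constants are compared with f on the smaller set, so |d' - d|^p <= 2^p (|f - d|^p + |f -
    d'|^p) is integrated there. *)
Lemma dist_constants (A A' : set V) (d d' a b m : R) :
  measurable A -> measurable A' -> A' `<=` A -> mu A' = m%:E ->
  (\int[mu]_(x in A) (`|f x - d| `^ p)%:E <= a%:E)%E ->
  (\int[mu]_(x in A') (`|f x - d'| `^ p)%:E <= b%:E)%E ->
  `|d' - d| `^ p * m <= 2 `^ p * (a + b).
Proof.
move=> mA mA' AA mE ha hb; rewrite -lee_fin.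
have -> : ((`|d' - d| `^ p * m)%:E = \int[mu]_(x in A') (cst (`|d' - d| `^ p)%:E) x)%E.
  by rewrite integral_cst//= mE -EFinM.
apply: (@le_trans _ _ (\int[mu]_(x in A') ((2 `^ p)%:E * ((`|f x - d| `^ p)%:E + (`|f x - d'| `^ p)%:E)))%E).
  apply: ge0_le_integral => //.
  - by move=> x _; rewrite lee_fin powR_ge0.
  - apply: measurable_funTS; apply: emeasurable_funM => //.
    by apply: emeasurable_funD; exact: measurable_dist_powR.
  move=> x _; rewrite -EFinD -EFinM lee_fin.
  rewrite (le_trans _ (powRD_le _ _ _))//.
  rewrite ge0_ler_powR ?nnegrE ?addr_ge0//.
  by rewrite distrC [X in _ <= X + _]distrC -[d - d'](subrKA (f x)) -opprB; rewrite (le_trans (ler_normD _ _))// normrN distrC.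
rewrite (ge0_integralZl mu mA'); last 3 first.
- by apply: measurable_funTS; apply: emeasurable_funD; exact: measurable_dist_powR.
- by move=> x _; rewrite adde_ge0// lee_fin powR_ge0.
- by rewrite lee_fin powR_ge0.
rewrite EFinM; apply: lee_wpmul2l; first by rewrite lee_fin powR_ge0.
rewrite (ge0_integralD mu mA'); last 4 first.
- by move=> x _; rewrite lee_fin powR_ge0.
- by apply: measurable_funTS; exact: measurable_dist_powR.
- by move=> x _; rewrite lee_fin powR_ge0.
- by apply: measurable_funTS; exact: measurable_dist_powR.
rewrite EFinD; apply: leeD => //; apply: le_trans ha.
by apply: ge0_subset_integral => //; apply: measurable_funTS; exact: measurable_dist_powR.
Qed.

(** Integrates |d| <= |f| + |f - d| with [powR_split] on the last term: |f| is controlled in the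
    mean, |f - d| in L^p. *)
Lemma constant_le (A : set V) (d a b m e : R) :
  measurable A -> mu A = m%:E -> 0 < e ->
  (\int[mu]_(x in A) (`|f x|)%:E <= a%:E)%E ->
  (\int[mu]_(x in A) (`|f x - d| `^ p)%:E <= b%:E)%E ->
  `|d| * m <= a + e * m + e `^ (1 - p) * b.
Proof.
move=> mA mE e0 ha hb; rewrite -lee_fin.
have mfa : measurable_fun setT (fun x => (`|f x|)%:E).
  by apply/measurable_EFinP; exact: measurableT_comp.
have -> : ((`|d| * m)%:E = \int[mu]_(x in A) (cst `|d|%:E) x)%E.
  by rewrite integral_cst//= mE -EFinM.
apply: (@le_trans _ _ (\int[mu]_(x in A) ((`|f x|)%:E + (e%:E + (e `^ (1 - p))%:E * (`|f x - d| `^ p)%:E)))%E).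
  apply: ge0_le_integral => //.
  - by move=> x _; rewrite /cst lee_fin.
  - apply: measurable_funTS; apply: emeasurable_funD => //; apply: emeasurable_funD => //.
    by apply: emeasurable_funM => //; exact: measurable_dist_powR.
  move=> x _; rewrite -EFinM -!EFinD lee_fin.
  rewrite (@le_trans _ _ (`|f x| + `|f x - d|))//.
    by rewrite -[X in `|X| <= _](subKr (f x)) (le_trans (ler_normB _ _)).
  by rewrite lerD2l powR_split.
rewrite (ge0_integralD mu mA); last 4 first.
- by [].
- exact: measurable_funTS.
- by move=> x _; rewrite adde_ge0 ?mule_ge0 ?lee_fin ?powR_ge0// ltW.
- apply: measurable_funTS; apply: emeasurable_funD => //.
  by apply: emeasurable_funM => //; exact: measurable_dist_powR.
rewrite (ge0_integralD mu mA); last 4 first.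
- by move=> x _; rewrite lee_fin ltW.
- exact: measurable_cst.
- by move=> x _; rewrite mule_ge0 ?lee_fin ?powR_ge0.
- by apply: measurable_funTS; apply: emeasurable_funM => //; exact: measurable_dist_powR.
rewrite (ge0_integralZl mu mA); last 3 first.
- by apply: measurable_funTS; exact: measurable_dist_powR.
- by move=> x _; rewrite lee_fin powR_ge0.
- by rewrite lee_fin powR_ge0.
have -> : ((a + e * m + e `^ (1 - p) * b)%:E = a%:E + (e%:E * m%:E + (e `^ (1 - p))%:E * b%:E))%E.
  by rewrite -!EFinM -!EFinD addrA.
rewrite (integral_cst mu mA e%:E)/= mE.
apply: leeD => //; apply: leeD => //.
by apply: lee_wpmul2l; rewrite ?lee_fin ?powR_ge0.
Qed.

End ball_constants.

Section chain_estimate.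
Context {R : realType} {n : nat}.
Local Notation V := 'rV[R]_n.
Local Notation mu := (@leb R n).
Local Notation v := (ball_vol (R := R) (n := n)).
Variables (p sp s CP : R).
Hypothesis p1 : 1 <= p.
Hypothesis CP0 : 0 < CP.
Hypothesis sps : n%:R - sp < s.

Let p0 : 0 < p. Proof. exact: lt_le_trans p1. Qed.

Let v0 : 0 < v. Proof. exact: ball_vol_gt0. Qed.

(* [sp] stands for sigma * p, and [s = n - sp + chain_exp * p]. *)
Definition chain_exp : R := (sp + s - n%:R) / p.

(** The ratio of the geometric series of jumps between consecutive constants; it is below 1 because
    s > n - sp. *)
Definition chain_ratio : R := 2^-1 `^ chain_exp.

(** Under the root: 2^p from [dist_constants], 2 from its two energy terms, 2^n from the volume
    ratio of consecutive balls. *)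
Definition step_cst : R := (2 `^ (p + 1 + n%:R) * CP / v) `^ p^-1.

Definition sum_cst : R := step_cst / (1 - chain_ratio).

Lemma chain_exp_gt0 : 0 < chain_exp.
Proof. by rewrite divr_gt0//; move: sps; lra. Qed.

Lemma chain_ratio_gt0 : 0 < chain_ratio.
Proof. by rewrite powR_gt0// invr_gt0. Qed.

Lemma chain_ratio_lt1 : chain_ratio < 1.
Proof.
apply: (@lt_le_trans _ _ (1 `^ chain_exp)); last by rewrite powR1.
rewrite /chain_ratio; apply: gt0_ltr_powR; rewrite ?nnegrE ?invr_ge0//; first exact: chain_exp_gt0.
by rewrite invf_lt1// ltr1n.
Qed.

Lemma step_cst_gt0 : 0 < step_cst.
Proof. by rewrite powR_gt0// divr_gt0// mulr_gt0// powR_gt0. Qed.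

Lemma sum_cst_gt0 : 0 < sum_cst.
Proof. by rewrite divr_gt0 ?step_cst_gt0// subr_gt0 chain_ratio_lt1. Qed.

Variables (x0 : V) (rho : R) (f : V -> R) (E : set V -> R) (d0 : R).
Hypothesis rho0 : 0 < rho.
Hypothesis mf : measurable_fun setT f.
Hypothesis poinc : forall y r, 0 < r -> eball y r `<=` eball x0 rho ->
  exists d : R, (\int[mu]_(x in eball y r) (`|f x - d| `^ p)%:E <=
    (CP * r `^ sp * E (eball y r))%:E)%E.
Hypothesis poinc0 : (\int[mu]_(x in eball x0 rho) (`|f x - d0| `^ p)%:E <=
    (CP * rho `^ sp * E (eball x0 rho))%:E)%E.

Lemma powR_le_cancel (a b : R) : 0 <= a -> 0 <= b -> a `^ p <= b `^ p -> a <= b.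
Proof.
move=> a0 b0; apply: contraTT; rewrite -!ltNge => ba.
by apply: gt0_ltr_powR; rewrite ?nnegrE.
Qed.

Lemma chain_constant_le (x : V) (kappa : R) : 0 < kappa -> eball x0 rho x ->
  (forall e : R, 0 < e -> exists2 delta : R, 0 < delta & forall r, 0 < r < delta ->
    (\int[mu]_(y in eball x r) (`|f y|)%:E <= (e * r ^+ n)%:E)%E) ->
  (forall k, E (chain_ball x0 rho x k) <= kappa * chain_radius rho k `^ s) ->
  `|d0| <= sum_cst * kappa `^ p^-1 * rho `^ chain_exp.
Proof.
move=> k0 xB favg hE.
pose r := chain_radius rho; pose A := chain_ball x0 rho x.
have r_gt0 k : 0 < r k by exact: chain_radius_gt0.
have mA k : measurable (A k) by exact: measurable_eball.
have AE k : mu (A k) = (r k ^+ n * v)%:E by exact: lebesgue_chain_ball.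
have ep0 : 0 < chain_exp * p by apply: mulr_gt0 => //; exact: chain_exp_gt0.
(* Since r^sp r^s = r^n w, the mean of |f - d_k|^p over the ball A_k is of order kappa w_k, and w_k
   tends to 0. *)
pose w k := r k `^ (chain_exp * p).
have w0 k : 0 < w k by exact: powR_gt0.
have rw k : r k `^ sp * r k `^ s = r k ^+ n * w k.
  rewrite -(powRD_gt0 _ _ (r_gt0 k)) -powR_mulrn ?(ltW (r_gt0 k))//.
  rewrite /w -(powRD_gt0 _ _ (r_gt0 k)); congr (_ `^ _).
  by rewrite /chain_exp divfK ?gt_eqF//; lra.
have bound k d : (\int[mu]_(y in A k) (`|f y - d| `^ p)%:E <=
    (CP * r k `^ sp * E (A k))%:E)%E ->
  (\int[mu]_(y in A k) (`|f y - d| `^ p)%:E <= (CP * kappa * (r k ^+ n * w k))%:E)%E.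
  move=> /le_trans; apply; rewrite lee_fin -rw.
  have -> : CP * kappa * (r k `^ sp * r k `^ s) = CP * r k `^ sp * (kappa * r k `^ s) by ring.
  by apply: ler_wpM2l; [rewrite mulr_ge0 ?powR_ge0// ltW|exact: hE].
(* The constant of the first ball is prescribed, being the one to bound; the others are chosen. *)
have [d dE dB] : exists2 d : nat -> R, d 0%N = d0 & forall k,
    (\int[mu]_(y in A k) (`|f y - d k| `^ p)%:E <= (CP * kappa * (r k ^+ n * w k))%:E)%E.
  have /choice[g gP] : forall k, exists d, (\int[mu]_(y in A k) (`|f y - d| `^ p)%:E <=
      (CP * kappa * (r k ^+ n * w k))%:E)%E.
    move=> k; have [d dP] := poinc (r_gt0 k) (@chain_ball_subB _ _ _ _ x k xB).
    by exists d; exact: bound.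
  exists (fun k => if k is 0%N then d0 else g k); first by [].
  case=> [|k]; last exact: gP.
  apply: bound; rewrite /A chain_ball0 /r /chain_radius expr0 mulr1.
  exact: poinc0.
pose K := step_cst * kappa `^ p^-1 * rho `^ chain_exp.
have K0 : 0 < K by rewrite !mulr_gt0 ?step_cst_gt0// powR_gt0.
(* Compared through p-th powers: the right-hand side to the power p is a constant times kappa
   w_k. *)
have step k : `|d k.+1 - d k| <= K * chain_ratio ^+ k.
  have q0 := chain_ratio_gt0.
  apply: powR_le_cancel => //; first by rewrite mulr_ge0 ?exprn_ge0// ltW.
  have h := dist_constants mf p1 (mA k) (mA k.+1) (@chain_ballS _ _ _ _ x k xB) (AE k.+1) (dB k) (dB k.+1).
  have rS : r k.+1 = r k / 2 by exact: chain_radiusS.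
  have rle : r k.+1 <= r k by rewrite rS; have := r_gt0 k; lra.
  have wS : w k.+1 <= w k.
    apply: (ge0_ler_powR (ltW ep0)) => //; rewrite nnegrE; exact: ltW.
  have wE : w k = rho `^ (chain_exp * p) * (chain_ratio ^+ k) `^ p.
    rewrite /w /r /chain_radius powRM ?exprn_ge0 ?invr_ge0 ?(ltW rho0)//; congr (_ * _).
    have -> : 2^-1 ^+ k = 2^-1 `^ k%:R :> R by rewrite powR_mulrn// invr_ge0.
    rewrite /chain_ratio -(powR_mulrn _ (powR_ge0 _ _)) -!powRrM.
    by congr (_ `^ _); ring.
  have r1 : r k.+1 ^+ n = 2^-1 ^+ n * r k ^+ n by rewrite rS exprMn mulrC.
  have rn0 : 0 < r k ^+ n by rewrite exprn_gt0.
  have h2 : `|d k.+1 - d k| `^ p * (2^-1 ^+ n * v) <= 2 `^ p * (2 * (CP * kappa * w k)).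
    rewrite -(ler_pM2r rn0).
    have -> : `|d k.+1 - d k| `^ p * (2^-1 ^+ n * v) * r k ^+ n = `|d k.+1 - d k| `^ p * (r k.+1 ^+ n * v).
      by rewrite r1; ring.
    apply: (le_trans h); rewrite -[leRHS]mulrA; apply: ler_wpM2l; first exact: powR_ge0.
    have -> : 2 * (CP * kappa * w k) * r k ^+ n = CP * kappa * (r k ^+ n * w k) + CP * kappa * (r k ^+ n * w k) by ring.
    rewrite lerD2l; apply: ler_wpM2l; first by rewrite mulr_ge0// ltW.
    apply: ler_pM => //; rewrite ?exprn_ge0 ?(ltW (r_gt0 _)) ?(ltW (w0 _))//.
    by rewrite lerXn2r ?nnegrE ?(ltW (r_gt0 _)).
  have -> : (K * chain_ratio ^+ k) `^ p = 2 `^ (p + 1 + n%:R) * CP / v * kappa * w k.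
    rewrite powRM ?(ltW K0) ?exprn_ge0 ?(ltW q0)// /K.
    rewrite !powRM ?mulr_ge0 ?powR_ge0 ?(ltW step_cst_gt0)//.
    rewrite /step_cst -!powRrM !mulVf ?gt_eqF// !powRr1; last 2 first.
      - exact: ltW.
      - by rewrite divr_ge0 ?mulr_ge0 ?powR_ge0 ?ltW.
    by rewrite wE; ring.
  have c0 : 0 < 2^-1 ^+ n * v by rewrite mulr_gt0// exprn_gt0// invr_gt0.
  rewrite -(ler_pM2r c0) (le_trans h2)//.
  rewrite !powRD_gt0// powRr1// powR_mulrn//.
  rewrite le_eqVlt; apply/orP; left; apply/eqP.
  have n0 : 2 ^+ n != 0 :> R by rewrite gt_eqF// exprn_gt0.
  by rewrite exprVn; field; rewrite n0 gt_eqF.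
have q0 := chain_ratio_gt0; have q1 := chain_ratio_lt1.
have tele N : `|d0| <= `|d N| + K * (\sum_(k < N) chain_ratio ^+ k).
  elim: N => [|N IH]; first by rewrite big_ord0 mulr0 addr0 -dE.
  apply: (le_trans IH); rewrite big_ord_recr/= mulrDr addrA addrAC lerD2r.
  apply: (@le_trans _ _ (`|d N.+1| + `|d N.+1 - d N|)); last by rewrite lerD2l.
  by rewrite distrC -[X in `|X| <= _](subrK (d N.+1)) addrC (le_trans (ler_normD _ _)).
have geo N : \sum_(k < N) chain_ratio ^+ k <= (1 - chain_ratio)^-1.
  have q10 : 0 < 1 - chain_ratio by rewrite subr_gt0.
  rewrite -[leRHS]mul1r ler_pdivlMr// mulrC -opprB mulNr -subrX1 opprB.
  by rewrite gerBl exprn_ge0// ltW.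
apply/ler_addgt0Pr => e e0.
(* [constant_le] has three terms: the average of |f|, the free parameter, and the energy term M
   w_N. *)
pose e3 := e / 3.
have e30 : 0 < e3 by rewrite divr_gt0.
(* The averages are over the ball of radius 2 r_N about x, which contains A_N; dividing by 2^n
   compensates its larger volume. *)
have ef0 : 0 < e3 * v / 2 ^+ n by rewrite divr_gt0 ?exprn_gt0// mulr_gt0.
have [delta delta0 fdelta] := favg _ ef0.
pose M := e3 `^ (1 - p) * (CP * kappa) / v.
have M0 : 0 < M by rewrite divr_gt0// !mulr_gt0// powR_gt0.
(* The first entry yields 2 r_N < delta, the second M w_N <= e3. *)
have t0 : 0 < Num.min (delta / 2) ((e3 / M) `^ (chain_exp * p)^-1).
  by rewrite lt_min divr_gt0//= powR_gt0// divr_gt0.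
have [N] := chain_radius_small rho0 t0; rewrite -/(r N) lt_min => /andP[rN1 rN2].
have wN : M * w N <= e3.
  rewrite mulrC -ler_pdivlMr// /w.
  have -> : e3 / M = ((e3 / M) `^ (chain_exp * p)^-1) `^ (chain_exp * p).
    by rewrite -powRrM mulVf ?gt_eqF// powRr1// ltW// divr_gt0.
  by rewrite ge0_ler_powR ?nnegrE ?(ltW ep0) ?(ltW (r_gt0 _)) ?powR_ge0 ?(ltW rN2).
have rn0 : 0 < r N ^+ n by rewrite exprn_gt0.
have dN : `|d N| <= e.
  have fA : (\int[mu]_(y in A N) (`|f y|)%:E <= (e3 * v * r N ^+ n)%:E)%E.
    apply: (@le_trans _ _ (\int[mu]_(y in eball x (2 * r N)) (`|f y|)%:E)%E).
      apply: ge0_subset_integral => //; first exact: measurable_eball.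
        by apply: measurable_funTS; apply/measurable_EFinP; exact: measurableT_comp.
      exact: (@chain_ball_sub _ _ _ _ x N xB).
    apply: (le_trans (fdelta (2 * r N) _)).
      rewrite mulr_gt0//=; move: rN1; lra.
    rewrite lee_fin exprMn mulrA divfK// gt_eqF// exprn_gt0//.
  have := constant_le mf p1 (mA N) (AE N) e30 fA (dB N).
  have -> : e3 * v * r N ^+ n + e3 * (r N ^+ n * v) + e3 `^ (1 - p) * (CP * kappa * (r N ^+ n * w N))
     = (e3 + e3 + M * w N) * (r N ^+ n * v) by rewrite /M; field; rewrite gt_eqF.
  rewrite ler_pM2r ?mulr_gt0// => /le_trans; apply.
  by rewrite /e3 in wN *; lra.
rewrite (le_trans (tele N))// addrC lerD//.
have -> : sum_cst * kappa `^ p^-1 * rho `^ chain_exp = K * (1 - chain_ratio)^-1.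
  by rewrite /K /sum_cst; ring.
by apply: ler_wpM2l; [exact: ltW|exact: geo].
Qed.

End chain_estimate.

(** * Bounding the constant by the energy through the zero set *)

Section zero_set_poincare.
Context {R : realType} {n : nat}.
Local Notation V := 'rV[R]_n.
Local Notation mu := (@leb R n).
Local Notation v := (ball_vol (R := R) (n := n)).
Variables (p sp s CP theta : R).
Hypothesis p1 : 1 <= p.
Hypothesis CP0 : 0 < CP.
Hypothesis sps : n%:R - sp < s.
Hypothesis theta0 : 0 < theta.

Let p0 : 0 < p. Proof. exact: lt_le_trans p1. Qed.

Let v0 : 0 < v. Proof. exact: ball_vol_gt0. Qed.

Local Notation SC := (@sum_cst R n p sp s CP).
Local Notation CX := (@chain_exp R n p sp s).

(** From |f|^p <= 2^p (|f - d0|^p + |d0|^p): [CP] bounds the first term, and [zero_set_constant_le]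
    times the volume of the ball the second. *)
Definition zero_set_cst : R :=
  2 `^ p * (CP + v * (2 * SC) `^ p * theta ^+ 2 * 3 `^ s).

Let S0 : 0 < SC. Proof. exact: sum_cst_gt0. Qed.

Lemma zero_set_cst_gt0 : 0 < zero_set_cst.
Proof.
rewrite mulr_gt0 ?powR_gt0// addr_gt0// !mulr_gt0 ?powR_gt0 ?exprn_gt0//.
by rewrite mulr_gt0.
Qed.

Variables (x0 : V) (rho : R) (f : V -> R) (E : set V -> R) (T : set V).
Hypothesis rho0 : 0 < rho.
Hypothesis mf : measurable_fun setT f.
Hypothesis E_ge0 : forall A, 0 <= E A.
Hypothesis E_le : forall A B, measurable A -> measurable B ->
  A `<=` B -> B `<=` eball x0 rho -> E A <= E B.
Hypothesis E_super : forall A B, measurable A -> measurable B ->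
  A `&` B = set0 -> A `|` B `<=` eball x0 rho -> E A + E B <= E (A `|` B).
Hypothesis poinc : forall y r, 0 < r -> eball y r `<=` eball x0 rho ->
  exists d : R, (\int[mu]_(x in eball y r) (`|f x - d| `^ p)%:E <=
    (CP * r `^ sp * E (eball y r))%:E)%E.
Hypothesis closedT : closed T.
Hypothesis TB : T `<=` eball x0 rho.
Hypothesis avgT : forall x, T x -> forall e : R, 0 < e ->
  exists2 delta : R, 0 < delta & forall r, 0 < r < delta ->
    (\int[mu]_(y in eball x r) (`|f y|)%:E <= (e * r ^+ n)%:E)%E.
Hypothesis HT : ((theta^-1 * rho `^ s)%:E < hausdorff_measure s T)%E.
Hypothesis HTle : forall (r : R) (y : V), 0 < r ->
  (hausdorff_measure s (T `&` eball y r) <= (theta * r `^ s)%:E)%E.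

Lemma compact_zero_set : compact T.
Proof.
apply: (subclosed_compact closedT (@compact_ecball R n x0 rho)) => x /TB.
by rewrite /eball/= => /ltW.
Qed.

Lemma sum_disjoint_balls (ds : seq (V * R)) : disjoint_balls ds ->
  (forall b, b \in ds -> eball b.1 b.2 `<=` eball x0 rho) ->
  \sum_(b <- ds) E (eball b.1 b.2) <= E (bballs 1 ds).
Proof.
elim: ds => [|b ds IH] /=; first by rewrite big_nil.
move=> [bds dsd] sub; rewrite big_cons bballs_cons mul1r.
have subds : bballs 1 ds `<=` eball x0 rho.
  by move=> x /bballsP[d dds]; rewrite mul1r; apply: sub; rewrite in_cons dds orbT.
apply: (@le_trans _ _ (E (eball b.1 b.2) + E (bballs 1 ds))).
  by rewrite lerD2l IH// => d dds; apply: sub; rewrite in_cons dds orbT.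
apply: E_super => //; [exact: measurable_eball|exact: measurable_bballs|].
by move=> x [|/subds//]; apply: sub; rewrite mem_head.
Qed.

(** One theta comes from the upper bound on T in the tripled balls, the other from the lower bound
    on all of T; tripling the radii gives 3^s. *)
Lemma covering_energy_le (kappa : R) : 0 < kappa ->
  (forall x, T x -> exists b : V * R, [/\ 0 < b.2, eball b.1 b.2 `<=` eball x0 rho,
    eball b.1 b.2 x & kappa * b.2 `^ s <= E (eball b.1 b.2)]) ->
  kappa * rho `^ s <= theta ^+ 2 * 3 `^ s * E (eball x0 rho).
Proof.
move=> k0 cov.
pose D := [set b : V * R | [/\ 0 < b.2, eball b.1 b.2 `<=` eball x0 rho &
    kappa * b.2 `^ s <= E (eball b.1 b.2)]].
have := compact_zero_set; rewrite compact_cover.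
move=> /(_ _ D (fun b => eball b.1 b.2)) [].
- by move=> b _; exact: open_eball.
- by move=> x /cov[b [b0 bB bx bE]]; exists b.
move=> D' D'D covT.
have bP b : b \in finmap.enum_fset D' -> D b by move=> /D'D; rewrite inE.
have [] := @vitali_finite R n (finmap.enum_fset D').
  by move=> b /bP[].
move=> ds [dsD dis sub].
have Tsub : T `<=` bballs 3 ds.
  move=> x /covT[b bD' bx]; apply: sub; apply/bballsP; exists b => //.
  by rewrite mul1r.
have dsP b : b \in ds -> D b by move=> /dsD; exact: bP.
have h1 : \sum_(b <- ds) E (eball b.1 b.2) <= E (eball x0 rho).
  have dsB b : b \in ds -> eball b.1 b.2 `<=` eball x0 rho by move=> /dsP[].
  rewrite (le_trans (sum_disjoint_balls dis dsB))//.
  apply: E_le => //; [exact: measurable_bballs|exact: measurable_eball|].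
  by move=> x /bballsP[d /dsB dB]; rewrite mul1r; exact: dB.
have h2 : kappa * \sum_(b <- ds) b.2 `^ s <= E (eball x0 rho).
  rewrite (le_trans _ h1)// mulr_sumr big_seq [leRHS]big_seq; apply: ler_sum => b /dsP[_ _ h].
  exact: h.
have h3 : (hausdorff_measure s T <= (theta * 3 `^ s * \sum_(b <- ds) b.2 `^ s)%:E)%E.
  rewrite -(setIidl Tsub) (le_trans (hausdorff_measure_bballs _ _ _ _))//.
  rewrite mulr_sumr -sumEFin big_seq [X in (_ <= X)%E]big_seq; apply: lee_sum => b /dsP[b0 _ _].
  rewrite (le_trans (HTle _ _))//; first by rewrite mulr_gt0.
  by rewrite powRM ?(ltW b0)// lee_fin mulrA.
have := lt_le_trans HT h3; rewrite lte_fin => h4.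
have h5 : kappa * (theta^-1 * rho `^ s) <= kappa * (theta * 3 `^ s * \sum_(b <- ds) b.2 `^ s).
  by apply: ler_wpM2l; exact: ltW.
have t3 : 0 <= theta ^+ 2 * 3 `^ s by rewrite mulr_ge0 ?exprn_ge0 ?powR_ge0// ltW.
have := ler_wpM2l t3 h2; apply: le_trans.
have := ler_wpM2l (ltW theta0) h5.
have -> : theta * (kappa * (theta^-1 * rho `^ s)) = kappa * rho `^ s by field; rewrite gt_eqF.
by move/le_trans; apply; rewrite le_eqVlt; apply/orP; left; apply/eqP; ring.
Qed.

Lemma zero_set_constant_le (d0 : R) :
  (\int[mu]_(x in eball x0 rho) (`|f x - d0| `^ p)%:E <=
    (CP * rho `^ sp * E (eball x0 rho))%:E)%E ->
  `|d0| `^ p * rho ^+ n <=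
    (2 * SC) `^ p * theta ^+ 2 * 3 `^ s * rho `^ sp * E (eball x0 rho).
Proof.
(* For d0 = 0 the threshold kappa below would not be positive. *)
move=> hd0; have [->|d00] := eqVneq d0 0.
  rewrite normr0 powR0 ?gt_eqF// mul0r !mulr_ge0 ?exprn_ge0 ?powR_ge0 ?(ltW theta0)//.
have m0 : 0 < `|d0| by rewrite normr_gt0 d00.
pose m := `|d0|; pose c := 2 * SC * rho `^ CX.
have c0 : 0 < c by apply: mulr_gt0; [exact: mulr_gt0|exact: powR_gt0].
have mc0 : 0 < m / c by rewrite divr_gt0.
(* With this kappa the chain bound equals m / 2, less than m = |d0|; so at every point of T some
   chain ball must violate the energy bound. *)
pose kappa := (m / c) `^ p.
have k0 : 0 < kappa by rewrite powR_gt0.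
have := @covering_energy_le kappa k0.
have cov : forall x, T x -> exists b : V * R, [/\ 0 < b.2, eball b.1 b.2 `<=` eball x0 rho,
    eball b.1 b.2 x & kappa * b.2 `^ s <= E (eball b.1 b.2)].
  move=> x Tx; have xB := TB Tx; apply: contrapT => nex.
  have hE k : E (chain_ball x0 rho x k) <= kappa * chain_radius rho k `^ s.
    rewrite leNgt; apply/negP => h; apply: nex; exists (chain_center x0 x k, chain_radius rho k).
    split => /=; [exact: chain_radius_gt0|exact: (@chain_ball_subB _ _ _ _ x k xB)|exact: mem_chain_ball|exact: ltW].
  have := chain_constant_le p1 CP0 sps rho0 mf poinc hd0 k0 xB (avgT Tx) hE.
  rewrite /kappa -powRrM mulfV ?gt_eqF// powRr1 ?(ltW mc0)//.
  have -> : SC * (m / c) * rho `^ CX = m / 2.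
    rewrite /c; field.
    by rewrite !gt_eqF ?powR_gt0.
  by rewrite -/m; move: m0; rewrite -/m; move: (m) => a; lra.
move=> /(_ cov) h.
have E2 : c `^ p = (2 * SC) `^ p * rho `^ (sp + s - n%:R).
  have S20 : 0 <= 2 * SC by apply: mulr_ge0 => //; exact: ltW.
  rewrite /c powRM ?powR_ge0//; congr (_ * _).
  by rewrite -powRrM /chain_exp divfK// gt_eqF.
(* The powers of rho in c^p rho^n combine to rho^sp rho^s, and rho^s cancels against the covering
   estimate. *)
have E3 : rho `^ (sp + s - n%:R) * rho ^+ n = rho `^ sp * rho `^ s.
  rewrite -powR_mulrn ?(ltW rho0)// -!powRD_gt0//; congr (_ `^ _); ring.
have rs0 : 0 < rho `^ s by rewrite powR_gt0.
rewrite -(ler_pM2r rs0).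
have -> : `|d0| `^ p * rho ^+ n * rho `^ s = c `^ p * (kappa * rho `^ s) * rho ^+ n.
  have -> : `|d0| = c * (m / c) by rewrite mulrC divfK// gt_eqF.
  by rewrite powRM ?(ltW c0) ?(ltW mc0)//; rewrite -/kappa; ring.
have cr0 : 0 <= c `^ p * rho ^+ n by rewrite mulr_ge0 ?powR_ge0 ?exprn_ge0 ?(ltW rho0).
have := ler_wpM2l cr0 h.
have -> : c `^ p * rho ^+ n * (kappa * rho `^ s) = c `^ p * (kappa * rho `^ s) * rho ^+ n by ring.
move/le_trans; apply; rewrite E2.
have -> : (2 * SC) `^ p * rho `^ (sp + s - n%:R) * rho ^+ n *
  (theta ^+ 2 * 3 `^ s * E (eball x0 rho)) = (2 * SC) `^ p * (rho `^ (sp + s - n%:R) * rho ^+ n) *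
  (theta ^+ 2 * 3 `^ s * E (eball x0 rho)) by ring.
by rewrite E3 le_eqVlt; apply/orP; left; apply/eqP; ring.
Qed.

Lemma zero_set_poincare :
  (\int[mu]_(x in eball x0 rho) (`|f x| `^ p)%:E <=
    (zero_set_cst * rho `^ sp * E (eball x0 rho))%:E)%E.
Proof.
have [d0 hd0] := poinc rho0 (@subset_refl _ _).
have h := zero_set_constant_le hd0.
have mB : measurable (eball x0 rho) by exact: measurable_eball.
have md := measurable_dist_powR p mf d0.
apply: (@le_trans _ _ (\int[mu]_(x in eball x0 rho) ((2 `^ p)%:E * ((`|f x - d0| `^ p)%:E + (`|d0| `^ p)%:E)))%E).
  apply: ge0_le_integral => //.
  - apply: measurable_funTS; apply/measurable_EFinP; apply: (measurableT_comp (measurable_powR p)).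
    exact: measurableT_comp.
  - apply: measurable_funTS; apply: emeasurable_funM => //.
    by apply: emeasurable_funD.
  move=> x _; rewrite -EFinD -EFinM lee_fin.
  rewrite (le_trans _ (powRD_le _ _ (ltW p0)))//.
  rewrite (ge0_ler_powR (ltW p0)) ?nnegrE ?addr_ge0//.
  by rewrite -[X in `|X| <= _](subrK d0) ler_normD.
rewrite (ge0_integralZl mu mB); last 3 first.
- by apply: measurable_funTS; apply: emeasurable_funD.
- by move=> x _; rewrite adde_ge0// lee_fin powR_ge0.
- by rewrite lee_fin powR_ge0.
rewrite (ge0_integralD mu mB); last 4 first.
- by move=> x _; rewrite lee_fin powR_ge0.
- exact: measurable_funTS.
- by move=> x _; rewrite lee_fin powR_ge0.
- exact: measurable_cst.
rewrite (integral_cst mu mB) lebE lebesgue_eball// -EFinM.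
have -> : zero_set_cst * rho `^ sp * E (eball x0 rho) = 2 `^ p *
   (CP * rho `^ sp * E (eball x0 rho) + v * ((2 * SC) `^ p * theta ^+ 2 * 3 `^ s * rho `^ sp * E (eball x0 rho))).
  by rewrite /zero_set_cst; ring.
rewrite [X in (_ <= X)%E]EFinM; apply: lee_wpmul2l; first by rewrite lee_fin powR_ge0.
rewrite [X in (_ <= X)%E]EFinD; apply: leeD; first by rewrite -lebE.
rewrite lee_fin [X in X <= _]mulrA [X in X <= _]mulrC; exact: (ler_wpM2l (ltW v0) h).
Qed.

End zero_set_poincare.

(** * The fractional Poincare inequality *)

Section fractional_poincare.
Context {R : realType} {n : nat}.
Local Notation V := 'rV[R]_n.
Local Notation mu := (@leb R n).
Local Notation v := (ball_vol (R := R) (n := n)).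
Variables (f : V -> R) (sigma p : R).
Hypothesis mf : measurable_fun setT f.
Hypothesis p1 : 1 <= p.
Hypothesis sigma0 : 0 < sigma.

Let p0 : 0 < p. Proof. exact: lt_le_trans p1. Qed.

Let v0 : 0 < v. Proof. exact: ball_vol_gt0. Qed.

Definition frac_kernel (x y : V) : R :=
  (`|f x - f y| / enorm (x - y) `^ sigma) `^ p / enorm (x - y) ^+ n.

Lemma frac_kernel_ge0 x y : 0 <= frac_kernel x y.
Proof. by rewrite mulr_ge0 ?powR_ge0 ?invr_ge0 ?exprn_ge0 ?enorm_ge0. Qed.

Lemma measurable_frac_kernel :
  measurable_fun setT (fun z : V * V => (frac_kernel z.1 z.2)%:E).
Proof.
have mt : measurable_fun setT (fun z : V * V => enorm (z.1 - z.2)).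
  apply: (measurableT_comp measurable_enorm); apply: measurable_row_sub; [exact: measurable_fst|exact: measurable_snd].
apply/measurable_EFinP.
(* Inverses are written as powers with exponent -1, for which measurability is available; the two
   agree on nonnegative numbers. *)
rewrite (_ : (fun _ => _) = (fun z : V * V =>
   (`|f z.1 - f z.2| * (enorm (z.1 - z.2) `^ sigma) `^ (-1)) `^ p * (enorm (z.1 - z.2) ^+ n) `^ (-1))); last first.
  by apply/funext => z; rewrite /frac_kernel !powR_inv1 ?powR_ge0 ?exprn_ge0 ?enorm_ge0.
apply: measurable_funM.
  apply: (measurableT_comp (measurable_powR p)); apply: measurable_funM.
    apply: measurableT_comp => //; apply: measurable_funB.
      by apply: (measurableT_comp mf); exact: measurable_fst.
    by apply: (measurableT_comp mf); exact: measurable_snd.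
  apply: (measurableT_comp (measurable_powR (-1))).
  exact: (measurableT_comp (measurable_powR sigma)).
apply: (measurableT_comp (measurable_powR (-1))).
exact: measurable_funX.
Qed.

Definition frac_slice (A : set V) x := (\int[mu]_(y in A) (frac_kernel x y)%:E)%E.

Lemma frac_slice_ge0 A x : (0 <= frac_slice A x)%E.
Proof. by apply: integral_ge0 => y _; rewrite lee_fin frac_kernel_ge0. Qed.

Lemma measurable_frac_kernel2 x : measurable_fun setT (fun y => (frac_kernel x y)%:E).
Proof.
exact: (measurableT_comp measurable_frac_kernel (pair1_measurable x)).
Qed.

Lemma measurable_frac_slice A : measurable A -> measurable_fun setT (frac_slice A).
Proof.
move=> mA.
rewrite (_ : frac_slice A = fun x => (\int[mu]_y ((frac_kernel x y)%:E * (\1_A y)%:E))%E); last first.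
  apply/funext => x; rewrite /frac_slice integral_mkcond; apply: eq_integral => y _.
  by rewrite patchE indicE; case: ifPn => _; rewrite ?mule1 ?mule0.
apply: (@measurable_fun_fubini_tonelli_F _ _ _ _ R mu
   (fun z : V * V => ((frac_kernel z.1 z.2)%:E * (\1_A z.2)%:E)%E)).
  apply: emeasurable_funM; first exact: measurable_frac_kernel.
  apply/measurable_EFinP; apply: (measurableT_comp (measurable_indic mA)); exact: measurable_snd.
by move=> z; rewrite mule_ge0 ?lee_fin ?frac_kernel_ge0.
Qed.

Definition frac_energy (A : set V) := (\int[mu]_(x in A) frac_slice A x)%E.

Lemma frac_energy_ge0 A : (0 <= frac_energy A)%E.
Proof. by apply: integral_ge0 => x _; exact: frac_slice_ge0. Qed.

Lemma le_frac_slice A B x : measurable A -> measurable B -> A `<=` B ->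
  (frac_slice A x <= frac_slice B x)%E.
Proof.
move=> mA mB AB; apply: ge0_subset_integral => //.
- apply: measurable_funTS; exact: measurable_frac_kernel2.
- by move=> y _; rewrite lee_fin frac_kernel_ge0.
Qed.

Lemma le_frac_energy A B : measurable A -> measurable B -> A `<=` B ->
  (frac_energy A <= frac_energy B)%E.
Proof.
move=> mA mB AB; apply: (@le_trans _ _ (\int[mu]_(x in A) frac_slice B x)%E).
  apply: ge0_le_integral => //.
  - by move=> x _; exact: frac_slice_ge0.
  - apply: measurable_funTS; exact: measurable_frac_slice.
  - apply: measurable_funTS; exact: measurable_frac_slice.
  - by move=> x _; exact: le_frac_slice.
apply: ge0_subset_integral => //.
- apply: measurable_funTS; exact: measurable_frac_slice.
- by move=> y _; exact: frac_slice_ge0.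
Qed.

(** Only an inequality: the interactions between [A] and [B] are dropped. *)
Lemma frac_energy_setU A B : measurable A -> measurable B -> A `&` B = set0 ->
  (frac_energy A + frac_energy B <= frac_energy (A `|` B))%E.
Proof.
move=> mA mB AB0; have mAB := measurableU _ _ mA mB.
rewrite {3}/frac_energy ge0_integral_setU//; last 3 first.
- apply: measurable_funTS; exact: measurable_frac_slice.
- by move=> x _; exact: frac_slice_ge0.
- by apply/disj_setPS; rewrite AB0.
have le C : measurable C -> C `<=` A `|` B ->
    (frac_energy C <= \int[mu]_(x in C) frac_slice (A `|` B) x)%E.
  move=> mC CAB; apply: ge0_le_integral => //.
  - by move=> x _; exact: frac_slice_ge0.
  - by apply: measurable_funTS; exact: measurable_frac_slice.
  - by apply: measurable_funTS; exact: measurable_frac_slice.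
  - by move=> x _; exact: le_frac_slice.
by apply: leeD; apply: le.
Qed.

(** If every slice exceeded twice the mean, integration would give e >= 2e. This is no contradiction
    when the energy vanishes; then the slice is 0 almost everywhere on a set of positive measure. *)
Lemma exists_slice_le B m : measurable B -> mu B = m%:E -> 0 < m -> (frac_energy B < +oo)%E ->
  exists2 x, B x & (m%:E * frac_slice B x <= 2%:E * frac_energy B)%E.
Proof.
move=> mB mE m0 Eoo; have [E0|E0] := eqVneq (frac_energy B) 0%E.
  have ms : measurable_fun B (frac_slice B) by apply: measurable_funTS; exact: measurable_frac_slice.
  have : (\int[mu]_(x in B) `|frac_slice B x| = 0)%E.
    rewrite -[RHS]E0; apply: eq_integral => x _; rewrite gee0_abs//; exact: frac_slice_ge0.
  move/(ae_eq_integral_abs _ mB ms) => [N [mN N0 hN]].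
  apply: contrapT => nex; have BN : B `<=` N.
    move=> x Bx; apply: hN => /= /(_ Bx) h; apply: nex; exists x => //.
    by rewrite h mule0 E0 mule0.
  have : (mu B <= mu N)%E by apply: le_measure => //; rewrite inE.
  by rewrite N0 mE lee_fin leNgt m0.
have Epos : (0 < frac_energy B)%E by rewrite lt0e E0 frac_energy_ge0.
apply: contrapT => nex.
have Efin : frac_energy B = (fine (frac_energy B))%:E.
  by rewrite fineK// ge0_fin_numE// frac_energy_ge0.
set e := fine _ in Efin.
have e0 : 0 < e by rewrite -lte_fin -Efin.
have : (\int[mu]_(x in B) (cst (2 * e / m)%:E) x <= frac_energy B)%E.
  apply: ge0_le_integral => //.
  - by move=> x _; rewrite lee_fin divr_ge0 ?mulr_ge0// ltW.
  - apply: measurable_funTS; exact: measurable_frac_slice.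
  move=> x Bx; rewrite leNgt; apply/negP => h; apply: nex; exists x => //.
  apply: (@le_trans _ _ (m%:E * (2 * e / m)%:E)%E).
    by apply: lee_wpmul2l; [rewrite lee_fin ltW|exact: ltW].
  by rewrite Efin -!EFinM lee_fin mulrC divfK// gt_eqF.
rewrite integral_cst//= mE Efin -EFinM divfK ?gt_eqF// lee_fin.
by rewrite leNgt => /negP; apply; lra.
Qed.

(** The power 2^(n + sigma p) bounds |x - z| <= 2r, and the extra 2 comes from [exists_slice_le]. *)
Definition frac_poincare_cst : R := 2 `^ (n%:R + sigma * p + 1) / v.

Lemma frac_poincare_cst_gt0 : 0 < frac_poincare_cst.
Proof. by rewrite divr_gt0// powR_gt0. Qed.

(** For a well-chosen x the constant f(x) works: in the ball |x - z| <= 2r, so |f(x) - f(z)|^p is at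
    most (2r)^(n + sigma p) times the kernel. *)
Lemma frac_poincare y r : 0 < r -> (frac_energy (eball y r) < +oo)%E ->
  exists d : R, (\int[mu]_(x in eball y r) (`|f x - d| `^ p)%:E <=
    (frac_poincare_cst * r `^ (sigma * p) * fine (frac_energy (eball y r)))%:E)%E.
Proof.
move=> r0 Eoo; have mB : measurable (eball y r) by exact: measurable_eball.
have mE : mu (eball y r) = (r ^+ n * v)%:E by rewrite lebE lebesgue_eball.
have m0 : 0 < r ^+ n * v by rewrite mulr_gt0// exprn_gt0.
have [x Bx hx] := exists_slice_le mB mE m0 Eoo.
have r20 : 0 < 2 * r by rewrite mulr_gt0.
exists (f x).
apply: (@le_trans _ _ (\int[mu]_(z in eball y r) (((2 * r) `^ (n%:R + sigma * p))%:E * (frac_kernel x z)%:E))%E).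
  apply: ge0_le_integral => //.
  - apply: measurable_funTS; exact: measurable_dist_powR.
  - apply: measurable_funTS; apply: emeasurable_funM => //; exact: measurable_frac_kernel2.
  move=> z Bz; rewrite -EFinM lee_fin distrC.
  (* On the diagonal the left-hand side is 0; elsewhere the denominators are positive. *)
  have [->|xz] := eqVneq x z.
    rewrite subrr normr0 powR0 ?gt_eqF//; apply: mulr_ge0; first exact: powR_ge0.
    exact: frac_kernel_ge0.
  have t0 : 0 < enorm (x - z).
    rewrite lt0r enorm_ge0 andbT; apply: contra xz => /eqP t0; apply/eqP/rowP => i.
    have := coord_le_enorm (x - z) i; rewrite t0 !mxE normr_le0 subr_eq0.
    by move/eqP.
  rewrite /frac_kernel; move: t0.
  have : enorm (x - z) <= 2 * r.
    have := enorm_triangle x y z; rewrite /eball/= in Bx Bz.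
    rewrite (enormB y); move: Bx Bz; move: (enorm _) (enorm _) (enorm _) => a b c; lra.
  move: (enorm _) => t tr t0.
  rewrite (@powRM _ `|f x - f z| (t `^ sigma)^-1 p) ?invr_ge0 ?powR_ge0//.
  have -> : ((t `^ sigma)^-1) `^ p = (t `^ (sigma * p))^-1.
    by rewrite -powR_inv1 ?powR_ge0// -!powRrM -powR_inv1 ?powR_ge0// -powRrM; congr (_ `^ _); ring.
  have h : t `^ (n%:R + sigma * p) <= (2 * r) `^ (n%:R + sigma * p).
    apply: ge0_ler_powR; rewrite ?nnegrE ?(ltW t0) ?(ltW r20)//.
    by rewrite addr_ge0// ltW// mulr_gt0.
  have -> : `|f x - f z| `^ p / t `^ (sigma * p) / t ^+ n = `|f x - f z| `^ p / t `^ (n%:R + sigma * p).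
    rewrite powRD_gt0// powR_mulrn ?(ltW t0)//; field.
    by rewrite !gt_eqF// ?exprn_gt0// powR_gt0.
  rewrite mulrCA ler_peMr ?powR_ge0// ler_pdivlMr ?mul1r// powR_gt0//.
rewrite (ge0_integralZl mu mB); last 3 first.
- apply: measurable_funTS; exact: measurable_frac_kernel2.
- by move=> z _; rewrite lee_fin frac_kernel_ge0.
- by rewrite lee_fin powR_ge0.
rewrite -/(frac_slice _ _).
have Efin : frac_energy (eball y r) = (fine (frac_energy (eball y r)))%:E.
  by rewrite fineK// ge0_fin_numE// frac_energy_ge0.
rewrite Efin in hx; move: hx; move: (fine _) => e hx.
have sfin : frac_slice (eball y r) x \is a fin_num.
  rewrite ge0_fin_numE ?frac_slice_ge0// ltNge leye_eq; apply/eqP => h.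
  by move: hx; rewrite h -EFinM gt0_muley ?lte_fin// leye_eq.
move: hx; rewrite -(fineK sfin); move: (fine _) => s.
rewrite -!EFinM !lee_fin => hx.
have n0 : 0 < r ^+ n by rewrite exprn_gt0.
have c0 : 0 <= 2 `^ (n%:R + sigma * p) * r `^ (sigma * p) / v.
  by rewrite divr_ge0 ?mulr_ge0 ?powR_ge0// ltW.
have := ler_wpM2l c0 hx.
have -> : 2 `^ (n%:R + sigma * p) * r `^ (sigma * p) / v * (r ^+ n * v * s) = (2 * r) `^ (n%:R + sigma * p) * s.
  rewrite powRM ?(ltW r0)// (powRD_gt0 _ _ r0) powR_mulrn ?(ltW r0)//; field.
  by rewrite gt_eqF.
move/le_trans; apply; rewrite /frac_poincare_cst (powRD_gt0 _ 1)// powRr1//.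
by rewrite le_eqVlt; apply/orP; left; apply/eqP; ring.
Qed.

End fractional_poincare.

(** * Reduction to Borel functions *)

Section ae_integral.
Context d (T : measurableType d) (R : realType) (m : {measure set T -> \bar R}).
Implicit Types (D : set T) (f g : T -> \bar R).
Local Open Scope ereal_scope.
Import HBNNSimple.

(* Neither [f] nor [g] nor [D] need be measurable: a simple function below [f]
   can be set to 0 on a null set outside which [f = g]. *)
Lemma ge0_ae_le_integral D f g :
  (forall x, D x -> 0 <= f x) -> (forall x, D x -> 0 <= g x) -> ae_eq m D f g ->
  \int[m]_(x in D) f x <= \int[m]_(x in D) g x.
Proof.
move=> f0 g0 [N [mN N0 hN]]; rewrite !ge0_integralE//.
apply: ge_ereal_sup => _ [h /= hf <-].
have mNC : measurable (~` N) by exact: measurableC.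
have hE : sintegral m h = sintegral m (proj_nnsfun h mNC).
  rewrite -!integralT_nnsfun; apply: ge0_ae_eq_integral => //.
  - exact/measurable_EFinP.
  - exact/measurable_EFinP.
  - by move=> x _; rewrite lee_fin; exact: fun_ge0.
  - by move=> x _; rewrite lee_fin; exact: fun_ge0.
  exists N; split => // x /= hx; apply: contrapT => Nx; apply: hx => _.
  by rewrite /proj_nnsfun/= mindicE mem_set// mulr1.
apply: ereal_sup_ubound => /=; exists (proj_nnsfun h mNC) => // x.
rewrite /proj_nnsfun/= mindicE; case: (pselect (N x)) => Nx.
  rewrite memNset/= ?mulr0; last by move=> /(_ Nx).
  by rewrite patchE; case: ifPn => //; rewrite inE => /g0.
rewrite mem_set//= mulr1 (le_trans (hf x))// !patchE; case: ifPn => //; rewrite inE => Dx.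
by have -> : f x = g x by apply: contrapT => fg; apply: Nx; apply: hN => /(_ Dx).
Qed.

Lemma ge0_ae_eq_integralN D f g :
  (forall x, D x -> 0 <= f x) -> (forall x, D x -> 0 <= g x) -> ae_eq m D f g ->
  \int[m]_(x in D) f x = \int[m]_(x in D) g x.
Proof.
move=> f0 g0 fg; apply/eqP; rewrite eq_le; apply/andP; split.
  exact: ge0_ae_le_integral.
apply: ge0_ae_le_integral => //; exact: ae_eq_sym.
Qed.

Lemma ae_eq_integralN D f g : ae_eq m D f g ->
  \int[m]_(x in D) f x = \int[m]_(x in D) g x.
Proof.
move=> /ae_eq_funeposneg[fgp fgn]; rewrite integralE [RHS]integralE.
by congr (_ - _); apply: ge0_ae_eq_integralN.
Qed.

Lemma eq_ae_integral (U : Type) (a b : T -> U) D f g : ae_eq m D a b ->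
  (forall x, D x -> a x = b x -> f x = g x) ->
  \int[m]_(x in D) f x = \int[m]_(x in D) g x.
Proof.
move=> ab h; apply: ae_eq_integralN; apply: filterS ab => x abx Dx.
by apply: h => //; exact: abx.
Qed.

End ae_integral.

Section borel_representative.
Context {R : realType} {n : nat}.
Local Notation V := 'rV[R]_n.
Local Notation mu := (@lebesgue_rV R n).
Variables (Omega : set V) (f F : V -> R).
Hypothesis fF : ae_eq mu Omega f F.

Lemma ae_Lp_norm p : 0 < p ->
  Lp_norm Omega p f = ((\int[mu]_(x in Omega) (`|F x| `^ p)%:E) `^ p^-1)%E.
Proof.
move=> p0; rewrite /Lp_norm unlock; apply: (f_equal (fun z => poweR z p^-1)).
transitivity (\int[mu]_(x in Omega) (`|f x| `^ p)%:E)%E.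
  rewrite [RHS]integral_mkcond; apply: eq_integral => x _; rewrite /= !patchE.
  by case: ifPn => _; rewrite ?normr0 ?poweR_EFin ?powR0 ?gt_eqF.
by apply: (eq_ae_integral fF) => x _ ->.
Qed.

Lemma ae_gagliardo sigma p :
  gagliardo Omega sigma p f = ((\int[mu]_(x in Omega) \int[mu]_(y in Omega)
    (frac_kernel F sigma p x y)%:E) `^ p^-1)%E.
Proof.
apply: (f_equal (fun z => poweR z p^-1)).
apply: (eq_ae_integral fF) => x _ fx; apply: (eq_ae_integral fF) => y _ fy.
by rewrite /frac_kernel fx fy.
Qed.

(** The condition on T involves f only through such integrals, so it survives the change to a Borel
    representative. *)
Lemma ae_integral_norm A : A `<=` Omega ->
  (\int[mu]_(x in A) `|f x|%:E = \int[mu]_(x in A) `|F x|%:E)%E.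
Proof.
move=> AO; apply: (@eq_ae_integral _ _ _ mu _ f F); last by move=> x _ ->.
exact: (ae_eq_subset AO fF).
Qed.

End borel_representative.

Section zero_average.
Context {R : realType} {n : nat}.
Local Notation V := 'rV[R]_n.
Local Notation mu := (@lebesgue_rV R n).
Local Notation v := (ball_vol (R := R) (n := n)).

Lemma eball_sub (x0 x : V) rho r : r <= rho - enorm (x - x0) ->
  eball x r `<=` eball x0 rho.
Proof.
rewrite /eball => h y/= yr; have := enorm_triangle y x x0.
move: h yr; move: (enorm _) (enorm _) (enorm _) => a b c; lra.
Qed.

Lemma zero_limsup_average (f : V -> R) (x : V) :
  limf_esup (fun r => average_abs f (eball x r)) 0^'+ = 0%E ->
  forall e : R, 0 < e -> exists2 delta : R, 0 < delta & forall r, 0 < r < delta ->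
    (\int[mu]_(y in eball x r) `|f y|%:E <= (e * r ^+ n)%:E)%E.
Proof.
move=> lim0 e e0; have v0 : 0 < v by exact: ball_vol_gt0.
(* The average divides the integral by r^n v, hence the threshold e / v. *)
have ev0 : 0 < e / v by rewrite divr_gt0.
have : (limf_esup (fun r => average_abs f (eball x r)) 0^'+ < (e / v)%:E)%E.
  by rewrite lim0 lte_fin.
rewrite limf_esupE => /ereal_inf_lt[_ [U U0 <-] hU].
have [delta delta0 hd] := U0.
exists delta => // r /andP[r0 rd].
have Ur : U r.
  by apply: hd => //=; rewrite sub0r normrN gtr0_norm.
have : (average_abs f (eball x r) <= (e / v)%:E)%E.
  apply: ltW; apply: le_lt_trans hU; apply: ereal_sup_ubound; exists r => //.
have rv0 : 0 < r ^+ n * v by rewrite mulr_gt0// exprn_gt0.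
rewrite /average_abs lebesgue_eball// inver gt_eqF// lee_pdivrMl//.
move/le_trans; apply; rewrite -EFinM lee_fin.
by rewrite le_eqVlt; apply/orP; left; apply/eqP; field; rewrite gt_eqF.
Qed.

End zero_average.

(** * The inequality for an abstract energy *)

Section conclusion.
Context {R : realType} {n : nat}.
Local Notation V := 'rV[R]_n.
Local Notation mu := (@lebesgue_rV R n).
Variables (p sigma s CP theta : R).
Hypothesis p1 : 1 <= p.
Hypothesis CP0 : 0 < CP.
Hypothesis sps : n%:R - sigma * p < s.
Hypothesis theta0 : 0 < theta.
Variables (x0 : V) (rho : R) (f F : V -> R) (E : set V -> \bar R) (T : set V).
Hypothesis rho0 : 0 < rho.
Hypothesis mF : measurable_fun setT F.
Hypothesis fF : ae_eq mu (eball x0 rho) f F.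
Hypothesis E_ge0 : forall A, (0 <= E A)%E.
Hypothesis E_le : forall A B, measurable A -> measurable B -> A `<=` B -> (E A <= E B)%E.
Hypothesis E_super : forall A B, measurable A -> measurable B ->
  A `&` B = set0 -> (E A + E B <= E (A `|` B))%E.
Hypothesis E_fin : (E (eball x0 rho) < +oo)%E.
Hypothesis poinc : forall y r, 0 < r -> eball y r `<=` eball x0 rho ->
  exists d : R, (\int[mu]_(x in eball y r) (`|F x - d| `^ p)%:E <=
    (CP * r `^ (sigma * p) * fine (E (eball y r)))%:E)%E.
Hypothesis closedT : closed T.
Hypothesis TB : T `<=` eball x0 rho.
Hypothesis avgT : T `<=` [set x | eball x0 rho x /\
   limf_esup (fun r => average_abs f (eball x r)) 0^'+ = 0%E].
Hypothesis HT : ((theta^-1 * rho `^ s)%:E < hausdorff_measure s T)%E.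
Hypothesis HTle : forall (r : R) (y : V), 0 < r ->
  (hausdorff_measure s (T `&` eball y r) <= (theta * r `^ s)%:E)%E.

(** The common end of the cases sigma = 1 and sigma < 1. The p-th root turns rho^(sigma p) into
    rho^sigma. *)
Lemma sobolev_le_energy :
  (Lp_norm (eball x0 rho) p f <=
    (@zero_set_cst R n p (sigma * p) s CP theta `^ p^-1 * rho `^ sigma)%:E *
      E (eball x0 rho) `^ p^-1)%E.
Proof.
have p0 : 0 < p by exact: lt_le_trans p1.
have mB : measurable (eball x0 rho) by exact: measurable_eball.
have finE A : measurable A -> A `<=` eball x0 rho -> E A = (fine (E A))%:E.
  move=> mA AB; rewrite fineK// ge0_fin_numE ?E_ge0//.
  by rewrite (le_lt_trans _ E_fin)// E_le.
pose C := @zero_set_cst R n p (sigma * p) s CP theta.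
have C0 : 0 < C by exact: zero_set_cst_gt0.
have h : (\int[mu]_(x in eball x0 rho) (`|F x| `^ p)%:E <=
    (C * rho `^ (sigma * p) * fine (E (eball x0 rho)))%:E)%E.
  apply: (@zero_set_poincare R n p (sigma * p) s CP theta p1 CP0 sps theta0 x0 rho F
    (fun A => fine (E A)) T) => //.
  - by move=> A; exact/fine_ge0.
  - move=> A B mA mB' AB BB; rewrite -lee_fin -!finE//; first exact: E_le.
    exact: subset_trans BB.
  - move=> A B mA mB' AB0 ABB; rewrite -lee_fin EFinD -!finE//; first exact: E_super.
    + exact: measurableU.
    + by move=> x Bx; apply: ABB; right.
    + by move=> x Ax; apply: ABB; left.
  move=> x Tx e e0; have [xB lim0] := avgT Tx.
  have [delta delta0 hd] := zero_limsup_average lim0 e0.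
  (* Balls about x of radius below its distance to the sphere stay where f = F almost everywhere. *)
  have dist0 : 0 < rho - enorm (x - x0) by rewrite subr_gt0.
  exists (Num.min delta (rho - enorm (x - x0))); first by rewrite lt_min delta0.
  move=> r /andP[r0]; rewrite lt_min => /andP[rd rx].
  have rB : eball x r `<=` eball x0 rho by apply: eball_sub; exact: ltW.
  by rewrite -(ae_integral_norm fF rB) hd// r0.
rewrite (ae_Lp_norm fF p0) (finE _ mB)//.
apply: (@le_trans _ _ ((C * rho `^ (sigma * p) * fine (E (eball x0 rho)))%:E `^ p^-1)%E).
  apply: gt0_ler_poweR => //; first by rewrite invr_ge0 ltW.
  - by rewrite in_itv/= leey andbT; apply: integral_ge0 => x _; rewrite lee_fin powR_ge0.
  - rewrite in_itv/= leey andbT lee_fin; apply: mulr_ge0; last exact/fine_ge0.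
    by rewrite mulr_ge0 ?powR_ge0// ltW.
have e0 : 0 <= fine (E (eball x0 rho)) by exact/fine_ge0.
have Cr0 : 0 <= C * rho `^ (sigma * p) by apply: mulr_ge0; [exact: ltW|exact: powR_ge0].
rewrite !poweR_EFin -EFinM lee_fin (powRM _ Cr0 e0).
by rewrite (powRM _ (ltW C0) (powR_ge0 _ _)) -powRrM mulfK ?gt_eqF.
Qed.

End conclusion.

(** * The gradient energy and Borel representatives *)

Section gradient_energy.
Context {R : realType} {n : nat}.
Local Notation V := 'rV[R]_n.
Local Notation mu := (@leb R n).
Variables (p : R) (G : V -> V).
Hypothesis mG : measurable_fun setT G.

Definition grad_energy (A : set V) : \bar R := (\int[mu]_(x in A) (enorm (G x) `^ p)%:E)%E.

Lemma measurable_enorm_powR : measurable_fun setT (fun x => (enorm (G x) `^ p)%:E).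
Proof.
apply/measurable_EFinP; apply: (measurableT_comp (measurable_powR p)).
exact: (measurableT_comp measurable_enorm mG).
Qed.

Lemma grad_energy_ge0 A : (0 <= grad_energy A)%E.
Proof. by apply: integral_ge0 => x _; rewrite lee_fin powR_ge0. Qed.

Lemma le_grad_energy A B : measurable A -> measurable B -> A `<=` B ->
  (grad_energy A <= grad_energy B)%E.
Proof.
move=> mA mB AB; apply: ge0_subset_integral => //.
- by apply: measurable_funTS; exact: measurable_enorm_powR.
- by move=> x _; rewrite lee_fin powR_ge0.
Qed.

Lemma grad_energy_setU A B : measurable A -> measurable B -> A `&` B = set0 ->
  (grad_energy A + grad_energy B <= grad_energy (A `|` B))%E.
Proof.
move=> mA mB AB0; rewrite [leRHS]ge0_integral_setU//.
- by apply: measurable_funTS; exact: measurable_enorm_powR.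
- by move=> x _; rewrite lee_fin powR_ge0.
- by apply/disj_setPS; rewrite AB0.
Qed.

End gradient_energy.

Section integrable_of_Lp.
Context {R : realType} {n : nat}.
Local Notation V := 'rV[R]_n.
Local Notation mu := (@leb R n).

(** [powR_split] with a = 1 gives |u| <= 1 + w^p, and the set has finite measure. *)
Lemma integrable_of_powR (Omega : set V) (p : R) (u : V -> R) (w : V -> R) :
  measurable Omega -> (mu Omega < +oo)%E -> 1 <= p ->
  measurable_fun setT u -> measurable_fun setT w ->
  (forall x, ~ Omega x -> u x = 0) -> (forall x, `|u x| <= w x) ->
  (\int[mu]_(x in Omega) (w x `^ p)%:E < +oo)%E ->
  mu.-integrable setT (fun x => (u x)%:E).
Proof.
move=> mO Ooo p1 mea_u mea_w u0 uw woo.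
have mwp : measurable_fun setT (fun x => (w x `^ p)%:E).
  by apply/measurable_EFinP; exact: (measurableT_comp (measurable_powR p)).
apply/integrableP; split; first exact/measurable_EFinP.
have -> : (\int[mu]_x `|(u x)%:E| = \int[mu]_(x in Omega) `|u x|%:E)%E.
  rewrite [RHS]integral_mkcond; apply: eq_integral => x _; rewrite patchE.
  by case: ifPn => //; rewrite notin_setE => /u0 ->; rewrite abse0.
apply: (@le_lt_trans _ _ (\int[mu]_(x in Omega) (1%:E + (w x `^ p)%:E))%E).
  apply: ge0_le_integral => //.
  - by apply: measurable_funTS; apply/measurable_EFinP; exact: measurableT_comp.
  - by apply: measurable_funTS; exact: emeasurable_funD.
  move=> x _; rewrite -EFinD lee_fin (le_trans (uw x))//.
  have w0 : 0 <= w x by exact: le_trans (uw x).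
  by have := powR_split w0 ltr01 p1; rewrite powR1 mul1r.
rewrite (ge0_integralD mu mO); last 4 first.
- by move=> x _; rewrite lee_fin.
- exact: measurable_cst.
- by move=> x _; rewrite lee_fin powR_ge0.
- exact: measurable_funTS.
by rewrite (integral_cst mu mO) mul1e lte_add_pinfty.
Qed.

End integrable_of_Lp.

Section borel_gradient.
Context {R : realType} {n : nat}.
Local Notation V := 'rV[R]_n.
Local Notation mu := (@lebesgue_rV R n).
Variables (Omega : set V) (p : R) (f : V -> R) (g : V -> V).
Hypothesis mO : measurable Omega.
Hypothesis Ooo : (mu Omega < +oo)%E.
Hypothesis p1 : 1 <= p.

Let p0 : 0 < p. Proof. exact: lt_le_trans p1. Qed.

(** Vanishing outside [Omega] makes the representative integrable over R^n, the setting of the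
    kernel estimates. *)
Lemma borel_representative : ae_measurable Omega f ->
  exists F : V -> R, [/\ measurable_fun setT F, ae_eq mu Omega f F &
    forall x, ~ Omega x -> F x = 0].
Proof.
move=> [h mh fh]; exists (h \_ Omega); split.
- exact/(measurable_restrictT _ mO).
- apply: filterS fh => x /= fhx Ox; rewrite patchE mem_set//; exact: fhx.
- by move=> x Ox; rewrite patchE memNset.
Qed.

Lemma borel_weak_gradient : is_weak_gradient Omega f g ->
  exists G : V -> V, [/\ measurable_fun setT G, ae_eq mu Omega g G &
    forall x, ~ Omega x -> G x = 0].
Proof.
move=> [_ hg].
have /choice[H hH] : forall i, exists h : V -> R, [/\ measurable_fun setT h,
    ae_eq mu Omega (fun x => g x ord0 i) h & forall x, ~ Omega x -> h x = 0].
  move=> i; have [[[h mh gh] _] _] := hg i; exists (h \_ Omega); split.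
  - exact/(measurable_restrictT _ mO).
  - apply: filterS gh => x /= ghx Ox; rewrite patchE mem_set//; exact: ghx.
  - by move=> x Ox; rewrite patchE memNset.
exists (fun x => \row_i H i x); split.
- apply: measurable_fun_rV => i; rewrite (_ : (fun _ => _) = H i); last first.
    by apply/funext => x; rewrite mxE.
  by have [] := hH i.
- have : \forall x \ae mu, forall i, Omega x -> g x ord0 i = H i x.
    by apply: filter_forall => i; have [] := hH i.
  apply: filterS => x h Ox; apply/rowP => i; rewrite mxE; exact: h.
- by move=> x Ox; apply/rowP => i; rewrite !mxE; have [_ _ ->] := hH i.
Qed.

Variables (F : V -> R) (G : V -> V).
Hypothesis mF : measurable_fun setT F.
Hypothesis mG : measurable_fun setT G.
Hypothesis fF : ae_eq mu Omega f F.
Hypothesis gG : ae_eq mu Omega g G.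
Hypothesis F0 : forall x, ~ Omega x -> F x = 0.
Hypothesis G0 : forall x, ~ Omega x -> G x = 0.
Hypothesis Foo : (\int[mu]_(x in Omega) (`|F x| `^ p)%:E < +oo)%E.
Hypothesis Goo : (grad_energy p G Omega < +oo)%E.
Hypothesis wg : is_weak_gradient Omega f g.

(** [F] and [G] agree with [f] and [g] almost everywhere on [Omega] and vanish off it, so the weak
    gradient identity becomes one over R^n. *)
Lemma weak_gradient_poincare y r : 0 < r -> eball y r `<=` Omega ->
  exists d : R, (\int[mu]_(x in eball y r) (`|F x - d| `^ p)%:E <=
    (@poincare_cst R n p * r `^ p * fine (grad_energy p G (eball y r)))%:E)%E.
Proof.
move=> r0 BO; have mB : measurable (eball y r) by exact: measurable_eball.
have Fi : (@leb R n).-integrable setT (fun z => (F z)%:E).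
  apply: (@integrable_of_powR _ _ Omega p F (fun x => `|F x|)) => //.
  exact: measurableT_comp.
have Gi i : (@leb R n).-integrable setT (fun z => (G z ord0 i)%:E).
  apply: (@integrable_of_powR _ _ Omega p (fun z => G z ord0 i) (fun x => enorm (G x))) => //.
  - exact: (measurableT_comp (measurable_rV_coord i)).
  - exact: (measurableT_comp measurable_enorm mG).
  - by move=> x /G0 ->; rewrite mxE.
  - by move=> x; exact: coord_le_enorm.
have weak i phi : test_function Omega phi ->
   (\int[mu]_z (F z * partial i phi z)%:E = - \int[mu]_z (G z ord0 i * phi z)%:E)%E.
  move=> tphi; have [_ /(_ i)[_ /(_ _ tphi)]] := wg.
  have -> : (\int[mu]_(x in Omega) (f x * partial i phi x)%:E =
     \int[mu]_x (F x * partial i phi x)%:E)%E.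
    rewrite [RHS](_ : _ = \int[mu]_(x in Omega) (F x * partial i phi x)%:E)%E.
      by apply: (eq_ae_integral fF) => x _ ->.
    rewrite [RHS]integral_mkcond; apply: eq_integral => x _; rewrite patchE.
    by case: ifPn => //; rewrite notin_setE => /F0 ->; rewrite mul0r.
  move=> ->.
  have -> : (\int[mu]_(x in Omega) (g x ord0 i * phi x)%:E =
     \int[mu]_x (G x ord0 i * phi x)%:E)%E.
    rewrite [RHS](_ : _ = \int[mu]_(x in Omega) (G x ord0 i * phi x)%:E)%E.
      by apply: (eq_ae_integral gG) => x _ ->.
    rewrite [RHS]integral_mkcond; apply: eq_integral => x _; rewrite patchE.
    by case: ifPn => //; rewrite notin_setE => /G0 ->; rewrite mxE mul0r.
  by [].
have [d hd] := poincare_gradient r0 p1 BO Fi Gi weak.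
have Eoo : (grad_energy p G (eball y r) < +oo)%E.
  exact: (le_lt_trans (le_grad_energy p mG mB mO BO) Goo).
have Efin : grad_energy p G (eball y r) \is a fin_num.
  by rewrite (ge0_fin_numE (grad_energy_ge0 _ _ _)).
by exists d; apply: (le_trans hd); rewrite [X in (_ <= X)%E]EFinM (fineK Efin).
Qed.

End borel_gradient.

Lemma poincare_cst_gt0 (R : realType) (n : nat) (p : R) : 0 < @poincare_cst R n p.
Proof.
have t0 : 0 < 2 `^ p :> R by rewrite powR_gt0.
apply: mulr_gt0; first by rewrite !mulr_gt0.
apply: mulr_gt0; first by rewrite exprn_gt0.
apply: addr_gt0 => //; apply: divr_gt0; [exact: ball_vol_gt0|exact: bump_mass_gt0].
Qed.

Lemma poweR_ltey (R : realType) (x : \bar R) (r : R) : (0 <= x)%E -> 0 < r ->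
  (x `^ r < +oo)%E -> (x < +oo)%E.
Proof.
move=> x0 r0 h; rewrite ltNge leye_eq; apply/eqP => xoo.
by move: h; rewrite xoo poweRyr ?gt_eqF// ltxx.
Qed.

Theorem theorem1p3 (R : realType) (n : nat) (hn : (1 <= n)%N)
    (theta sigma p s : R)
    (htheta : 0 < theta)
    (hsigma : 0 < sigma <= 1)
    (hp : 1 < p <= n%:R / sigma)
    (hs : n%:R - sigma * p < s <= n%:R) :
  exists2 C : R, 0 < C &
    forall (rho : R) (x0 : 'rV[R]_n) (f : 'rV[R]_n -> R) (T : set 'rV[R]_n),
      0 < rho ->
      sobolev (eball x0 rho) sigma p f ->
      closed T ->
      T `<=` eball x0 rho ->
      T `<=` [set x | eball x0 rho x /\
                limf_esup (fun r => average_abs f (eball x r)) 0^'+ = 0%E] ->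
      ((theta^-1 * rho `^ s)%:E < hausdorff_measure s T)%E ->
      (forall (r : R) (y : 'rV[R]_n), 0 < r ->
        (hausdorff_measure s (T `&` eball y r) <= (theta * r `^ s)%:E)%E) ->
      (Lp_norm (eball x0 rho) p f <=
        (C * rho `^ sigma)%:E * sobolev_seminorm (eball x0 rho) sigma p f)%E.
Proof.
have [sigma0 sigma1] := andP hsigma; have [sps _] := andP hs.
have p1 : 1 <= p by have [/ltW] := andP hp.
have p0 : 0 < p by exact: lt_le_trans p1.
pose CP := if sigma == 1 then @poincare_cst R n p else @frac_poincare_cst R n sigma p.
have CP0 : 0 < CP.
  by rewrite /CP; case: ifP => _; [exact: poincare_cst_gt0|exact: frac_poincare_cst_gt0].
exists (@zero_set_cst R n p (sigma * p) s CP theta `^ p^-1).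
  by apply: powR_gt0; exact: zero_set_cst_gt0.
move=> rho x0 f T rho0 [mf exg normoo] cT TB avg HT HTle.
have mB : measurable (eball x0 rho) by exact: measurable_eball.
have Boo : (lebesgue_rV n (eball x0 rho) < +oo)%E by rewrite lebesgue_eball// ltry.
have [F [mF fF F0]] := borel_representative mB mf.
have Lp_ge0 : (0 <= Lp_norm (eball x0 rho) p f)%E by exact: Lnorm_ge0.
have [sE|sN] := eqVneq sigma 1.
  (* The value picked by [xget] is a weak gradient because one exists. *)
  have wg : is_weak_gradient (eball x0 rho) f (weak_gradient (eball x0 rho) f).
    by have [g hg] := exg sE; exact: (xgetPex (fun=> 0) (ex_intro _ g hg)).
  have [G [mG gG G0]] := borel_weak_gradient mB wg.
  have semiE : sobolev_seminorm (eball x0 rho) sigma p f =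
      (grad_energy p G (eball x0 rho) `^ p^-1)%E.
    rewrite /sobolev_seminorm sE eqxx.
    have eG : ae_eq (lebesgue_rV n) (eball x0 rho)
        (enorm \o weak_gradient (eball x0 rho) f) (enorm \o G).
      by apply: filterS gG => x h Bx; rewrite /= h.
    rewrite (ae_Lp_norm eG p0); apply: (f_equal (fun z => poweR z p^-1)).
    by apply: eq_integral => x _; rewrite /= ger0_norm// enorm_ge0.
  have semi_ge0 : (0 <= sobolev_seminorm (eball x0 rho) sigma p f)%E.
    by rewrite semiE poweR_ge0.
  have Goo : (grad_energy p G (eball x0 rho) < +oo)%E.
    apply: (@poweR_ltey _ _ p^-1); rewrite ?invr_gt0//; first exact: grad_energy_ge0.
    by rewrite -semiE (le_lt_trans _ normoo)// leeDr.
  have Foo : (\int[lebesgue_rV n]_(x in eball x0 rho) (`|F x| `^ p)%:E < +oo)%E.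
    apply: (@poweR_ltey _ _ p^-1); rewrite ?invr_gt0//.
      by apply: integral_ge0 => x _; rewrite lee_fin powR_ge0.
    by rewrite -(ae_Lp_norm fF p0) (le_lt_trans _ normoo)// leeDl.
  rewrite semiE; apply: (@sobolev_le_energy R n p sigma s CP theta p1 CP0 sps htheta
    x0 rho f F (grad_energy p G) T rho0 mF fF) => //.
  - exact: grad_energy_ge0.
  - by move=> A B; exact: le_grad_energy.
  - by move=> A B; exact: grad_energy_setU.
  rewrite /CP sE eqxx mul1r => y r r0 BO.
  exact: (weak_gradient_poincare mB Boo p1 mF mG fF gG F0 G0 Foo Goo wg r0 BO).
have semiE : sobolev_seminorm (eball x0 rho) sigma p f =
    (frac_energy F sigma p (eball x0 rho) `^ p^-1)%E.
  by rewrite /sobolev_seminorm (negbTE sN) (ae_gagliardo fF).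
have Eoo : (frac_energy F sigma p (eball x0 rho) < +oo)%E.
  apply: (@poweR_ltey _ _ p^-1); rewrite ?invr_gt0//; first exact: frac_energy_ge0.
  by rewrite -semiE (le_lt_trans _ normoo)// leeDr.
rewrite semiE; apply: (@sobolev_le_energy R n p sigma s CP theta p1 CP0 sps htheta
  x0 rho f F (frac_energy F sigma p) T rho0 mF fF) => //.
- exact: frac_energy_ge0.
- by move=> A B; exact: le_frac_energy.
- by move=> A B; exact: frac_energy_setU.
rewrite /CP (negbTE sN) => y r r0 BO.
have mb : measurable (eball y r) by exact: measurable_eball.
apply: (frac_poincare mF p1 sigma0 r0).
exact: (le_lt_trans (le_frac_energy sigma p mF mb mB BO) Eoo).
Qed.
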